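(* Let $\sigma>0$, $\mu\in\mathbb{R}^n$, $y=\mu+\varepsilon$ with $\varepsilon\sim N(0,\sigma^2I_n)$. Let $\hat\mu:\mathbb{R}^n\to\mathbb{R}^n$ be 1-Lipschitz with $\nabla\hat\mu(y)$ almost surely symmetric positive semi-definite; write $\hat\mu=\hat\mu(y)$, $\hat{\mathsf{df}}=\operatorname{div}\hat\mu=\operatorname{trace}[\nabla\hat\mu]$ and $\widehat{\mathsf{SURE}}=\|y-\hat\mu\|^2+2\sigma^2\operatorname{div}\hat\mu-\sigma^2n$. Then $$\operatorname{Var}\Big(\widehat{\mathsf{SURE}}-\mathbb{E}\big[\|\mu-\hat\mu\|^2\big]+(n\sigma^2-\|\varepsilon\|^2)\Big)\le4\,\mathbb{E}\big[\sigma^2\widehat{\mathsf{SURE}}+\sigma^4\hat{\mathsf{df}}\big].$$ Moreover, there exist non-negative random variables $X_n$ and $Y_n$ with $\mathbb{E}[X_n^2]=\mathbb{E}[Y_n^2]=1$ such that $$\frac{\big|\widehat{\mathsf{SURE}}-\mathbb{E}[\|\mu-\hat\mu\|^2]+(n\sigma^2-\|\varepsilon\|^2)\big|}{\sigma^2\sqrt n}\le X_n\Big[\hat\gamma_n^{1/2}+4Y_n/n^{1/2}+\sqrt{4Y_n}\,(6/n)^{1/4}\Big],\qquad(1)$$ where $\hat\gamma_n=4\{\widehat{\mathsf{SURE}}/(n\sigma^2)+\operatorname{trace}[\nabla\hat\mu]/n\}_+$. Consequently, for positive $\alpha,\beta_1,\beta_2$ with $\alpha+\beta_1+\beta_2=\delta<1$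 and $\kappa_{n,\beta_2}=2(6/(\beta_2n))^{1/4}+4/(\beta_2n)^{1/2}$, $$\mathbb{P}\bigg\{\frac{|\widehat{\mathsf{SURE}}-\mathbb{E}[\|\mu-\hat\mu\|^2]|}{\sigma^2\sqrt{2n}}\le v_\alpha+\frac{\hat\gamma_n^{1/2}+\kappa_{n,\beta_2}}{(2\beta_1)^{1/2}}\bigg\}\ge1-\delta,\qquad(2)$$ where $v_\alpha$ is defined by $\mathbb{P}\{(2n)^{-1/2}|\chi^2_n-n|>v_\alpha\}=\alpha$. Moreover, (1) (for suitable such $X_n,Y_n$) and (2) still hold with $\mathbb{E}[\|\mu-\hat\mu\|^2]$ replaced by $\|\mu-\hat\mu\|^2$.
   Context: $\chi^2_n$ denotes a chi-square random variable with $n$ degrees of freedom; $a_+=\max(a,0)$; $\|\cdot\|$ is the Euclidean norm; 1-Lipschitz means $\|\hat\mu(u)-\hat\mu(v)\|\le\|u-v\|$ for all $u,v$; $\nabla\hat\mu$ is the $n\times n$ matrix whose columns are the gradients of the components of $\hat\mu$ (existing almost everywhere), evaluated at $y$; $\operatorname{div}\hat\mu=\sum_i\partial\hat\mu_i/\partial y_i$. *)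

(* Defs.v *)
From HB Require Import structures.
From mathcomp Require Import all_boot all_order all_algebra.
From mathcomp Require Import all_classical all_reals all_analysis.

Set Implicit Arguments.
Unset Strict Implicit.
Unset Printing Implicit Defensive.

Import Order.TTheory GRing.Theory Num.Theory.
Import numFieldNormedType.Exports.

Local Open Scope classical_set_scope.
Local Open Scope ring_scope.

(* Vectors of R^n are row vectors. The library norm on 'rV[R]_n is the sup
   norm, so the Euclidean norm is defined separately. *)
Definition enorm (R : realType) (n : nat) (u : 'rV[R]_n) : R :=
  Num.sqrt (\sum_(i < n) u 0 i ^+ 2).

Definition partial (R : realType) (n : nat) (i : 'I_n) (g : 'rV[R]_n -> R)
  (x : 'rV[R]_n) : R := 'D_(delta_mx 0 i) g x.

(* Column j is the gradient of the j-th component of f. As 'D is total, the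
   entries are meaningful only where the partial derivatives exist, which is
   almost everywhere when f is Lipschitz. *)
Definition gradmx (R : realType) (n : nat) (f : 'rV[R]_n -> 'rV[R]_n)
    (x : 'rV[R]_n) : 'M[R]_n :=
  \matrix_(i < n, j < n) partial i (fun u => f u 0 j) x.

Definition divergence (R : realType) (n : nat) (f : 'rV[R]_n -> 'rV[R]_n)
    (x : 'rV[R]_n) : R :=
  \sum_(i < n) partial i (fun u => f u 0 i) x.

Definition sym_psd (R : realType) (n : nat) (A : 'M[R]_n) : Prop :=
  A^T = A /\ forall v : 'rV[R]_n, 0 <= (v *m A *m v^T) 0 0.

(* Lipschitz for the Euclidean norm (k.-lipschitz would use the sup norm). *)
Definition lipschitz1 (R : realType) (n : nat) (f : 'rV[R]_n -> 'rV[R]_n) :=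
  forall u v : 'rV[R]_n, enorm (f u - f v) <= enorm (u - v).

(* Z ~ N(0, s^2 I_n): the coordinates of Z are measurable, each one has law
   N(0, s^2), and they are mutually independent. The product rule for
   sub-families is obtained by taking some of the B i to be setT. The second
   parameter of normal_prob is the standard deviation. *)
Definition centered_normal (R : realType) (d : measure_display)
    (T : measurableType d) (P : probability T R) (n : nat) (s : R)
    (Z : T -> 'rV[R]_n) : Prop :=
  [/\ forall i : 'I_n, measurable_fun setT (fun w => Z w 0 i),
      forall (i : 'I_n) (B : set R), measurable B ->
        P [set w | B (Z w 0 i)] = normal_prob 0 s B
    & forall B : 'I_n -> set R, (forall i, measurable (B i)) ->
        P [set w | forall i, B i (Z w 0 i)] =
        \big[mule/1%E]_(i < n) P [set w | B i (Z w 0 i)]].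

(* X has the law of ||Z||^2 for some Z ~ N(0, I_n), possibly defined on
   another probability space. *)
Definition is_chi_square (R : realType) (d : measure_display)
    (T : measurableType d) (P : probability T R) (n : nat) (X : T -> R) :
    Prop :=
  measurable_fun setT X /\
  exists (d' : measure_display) (T' : measurableType d')
         (P' : probability T' R) (Z : T' -> 'rV[R]_n),
    centered_normal P' 1 Z /\
    forall B : set R, measurable B ->
      P [set w | B (X w)] = P' [set w | B (enorm (Z w) ^+ 2)].

Definition SURE (R : realType) (n : nat) (sigma : R)
    (muhat : 'rV[R]_n -> 'rV[R]_n) (y : 'rV[R]_n) : R :=
  enorm (y - muhat y) ^+ 2 + 2 * sigma ^+ 2 * divergence muhat y
  - sigma ^+ 2 * n%:R.

Definition gammahat (R : realType) (n : nat) (sigma : R)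
    (muhat : 'rV[R]_n -> 'rV[R]_n) (y : 'rV[R]_n) : R :=
  4 * Num.max
        (SURE sigma muhat y / (n%:R * sigma ^+ 2)
         + \tr (gradmx muhat y) / n%:R) 0.

Definition kappa (R : realType) (n : nat) (beta : R) : R :=
  2 * (6 / (beta * n%:R)) `^ (4^-1) + 4 / Num.sqrt (beta * n%:R).

(* Main.v *)
(* Write F(x) = muhat(mu + x) - mu and A = grad F(eps). For vector fields q and
   functions k with exponentially growing Lipschitz constants, Gaussian integration
   by parts applied twice gives
     Var(eps.q - s^2 div q) = s^2 E|q|^2 + s^4 E tr((grad q)^2),
   and with the Poincare inequality for k
     Var(eps.q - s^2 div q + k) <= s^2 E|q + grad k|^2 + s^4 E tr((grad q)^2).
   Up to constants SURE - risk + (n s^2 - |eps|^2), the same with the loss, and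
   S = SURE + s^2 df are all of this form with q and k affine, respectively
   quadratic, in (eps, F). Since 0 <= A <= 1 (1-Lipschitz maps have contractive
   gradients), the right sides are at most 4 s^2 E S in the first two cases and
   4 s^2 E S + 6 n s^4 in the third. With X and Y the normalized absolute deviations
   of the SURE error and of S, z = (4 E S / (n s^2))^(1/2) satisfies
   z^2 <= gammahat + (4 Y / sqrt n) (z + sqrt 6), and solving for z gives (1);
   (2) follows by Markov's inequality and a union bound.

   The integration by parts is done with difference quotients, whose Gaussian
   adjoints are explicit, and the almost everywhere differentiability of Lipschitz
   functions comes from Radon-Nikodym on each coordinate line. The Poincare
   inequality follows from the one-dimensional one by the Efron-Stein inequality. *)
Require Import Defs.
From HB Require Import structures.
From mathcomp Require Import all_boot all_order all_algebra.
From mathcomp Require Import all_classical all_reals all_analysis.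
From mathcomp Require Import measurable_realfun.
From mathcomp Require Import ring lra.

Set Implicit Arguments.
Unset Strict Implicit.
Unset Printing Implicit Defensive.

Import Order.TTheory GRing.Theory Num.Theory.
Import numFieldNormedType.Exports.

Local Open Scope classical_set_scope.
Local Open Scope ring_scope.

(** * Measurability on row vectors *)

(** The obstacle is low regularity. A Lipschitz map is only shown to have its partial derivatives
    almost everywhere, and at such a point they do not control other directions, so the Lipschitz
    bound does not give a contractive gradient pointwise. The contraction is therefore proved
    weakly: quotients along v, tested against continuous functions under the Gaussian law, converge
    to the sum of v_i times the partial derivatives, and the test functions are then replaced by
    indicators.

    Likewise the second order formula is usually derived with second derivatives. For difference
    quotients the commutator with the adjoint is the number (exp(h^2/s^2) - 1)/h^2 times a
    multiplication operator, so only first derivatives survive in the limit and no smoothing is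
    involved.

    Row vectors are not an iterated product. Fubini in one coordinate is done by exchanging
    coordinates between two independent copies, and the same exchanges carry the Efron-Stein
    argument. *)

Lemma derivable_cvg_seq (R : realType) (V : normedModType R) (u : V -> R)
    (v x : V) (h : nat -> R) : derivable u x v ->
  (forall m, h m != 0) -> h @ \oo --> 0 ->
  (h m)^-1 * (u (h m *: v + x) - u x) @[m --> \oo] --> 'D_v u x.
Proof.
move=> du h0 hc.
have : h @ \oo --> 0^'.
  move=> A A0; have : \forall m \near \oo, (h m != 0 -> A (h m)) := hc _ A0.
  by apply: filterS => m; apply; exact: h0.
by move=> /cvg_comp /(_ du) /=.
Qed.

Section row_vector_measurable.
Context {R : realType} {n : nat}.

Definition rbox (B : 'I_n -> set R) : set 'rV[R]_n :=
  [set x | forall i, B i (x 0 i)].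

Definition rboxes : set (set 'rV[R]_n) :=
  [set A | exists2 B : 'I_n -> set R, forall i, measurable (B i) & A = rbox B].

(* Boxes are chosen as generators because they form a pi-system on which the law
   of a vector with independent coordinates is explicit. *)
HB.instance Definition _ := @isMeasurable.Build (sigma_display rboxes)
  'rV[R]_n <<s rboxes >> (@sigma_algebra0 _ setT rboxes)
  (@sigma_algebraC _ rboxes) (@sigma_algebra_bigcup _ setT rboxes).

Lemma measurable_rbox (B : 'I_n -> set R) :
  (forall i, measurable (B i)) -> measurable (rbox B).
Proof. by move=> mB; apply: sub_sigma_algebra; exists B. Qed.

Lemma measurable_coord (i : 'I_n) :
  measurable_fun setT (fun x : 'rV[R]_n => x 0 i).
Proof.
move=> _ Y mY; rewrite setTI.
rewrite [X in measurable X](_ : _ = rbox (fun j => if j == i then Y else setT)).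
  by apply: measurable_rbox => j; case: ifP.
apply/seteqP; split => x /=; first by move=> Yx j; case: eqP => [->|].
by move=> /(_ i); rewrite eqxx.
Qed.

Lemma measurable_rV d (T : measurableType d) (f : T -> 'rV[R]_n) :
  (forall i, measurable_fun setT (fun w => f w 0 i)) -> measurable_fun setT f.
Proof.
move=> mf; apply: (@measurability _ _ _ _ _ _ rboxes) => //.
move=> _ [_ [B mB ->] <-]; rewrite setTI.
rewrite [X in measurable X](_ : _ =
    \bigcap_(i in [set: 'I_n]) ((fun w => f w 0 i) @^-1` B i)).
  apply: fin_bigcap_measurable => // i _; rewrite -[X in measurable X]setTI.
  exact: mf.
by apply/seteqP; split => w /= Bw; [move=> i _; exact: Bw|move=> i; exact: Bw].
Qed.

(** Balls of the sup norm are boxes, so an open set is the union of the countably many boxes with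
    rational endpoints that it contains. *)
Lemma open_measurable_rV (U : set 'rV[R]_n) : open U -> measurable U.
Proof.
move=> oU.
pose V (p : 'rV[rat]_n * 'rV[rat]_n) : set 'rV[R]_n :=
  rbox (fun i => `]ratr (p.1 0 i), ratr (p.2 0 i)[%classic).
have -> : U = \bigcup_(p in [set p | V p `<=` U]) V p.
  apply/seteqP; split => [x Ux|x [p pU Vx]]; last exact: pU.
  have [e /= e0 eU] := (@nbhs_ballP _ _ x U).1 (open_nbhs_nbhs (conj oU Ux)).
  have ex i : exists ab : rat * rat,
      [/\ x 0 i - e < ratr ab.1 < x 0 i & x 0 i < ratr ab.2 < x 0 i + e].
    have [|a] := @rat_in_itvoo R (x 0 i - e) (x 0 i); first by rewrite ltrBlDr ltrDl.
    have [|b] := @rat_in_itvoo R (x 0 i) (x 0 i + e); first by rewrite ltrDl.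
    by rewrite !in_itv => ha hb; exists (a, b).
  have [g hg] := choice ex.
  exists (\row_i (g i).1, \row_i (g i).2).
    move=> y Vy; apply: eU; split=> // i0 i; rewrite (ord1 i0).
    have := Vy i; rewrite /= in_itv /= !mxE => /andP[h1 h2].
    have [/andP[a1 a2] /andP[a3 a4]] := hg i.
    rewrite /ball /= ltr_distlC; apply/andP; split; lra.
  move=> i /=; rewrite in_itv /= !mxE.
  by have [/andP[a1 a2] /andP[a3 a4]] := hg i; apply/andP; split.
rewrite bigcup_mkcond; apply: countable_bigcupT_measurable => // p.
by case: ifP => // _; apply: measurable_rbox => i; exact: measurable_itv.
Qed.

Lemma continuous_measurable_rV (f : 'rV[R]_n -> R) :
  continuous f -> measurable_fun setT f.
Proof.
move=> cf; apply: (measurability _ (RGenOInfty.measurableE R)).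
move=> _ [_ [a ->] <-]; rewrite setTI; apply: open_measurable_rV.
by apply: open_comp; [move=> *; exact: cf|exact: interval_open].
Qed.

Section directional_derivative.
Variables (u : 'rV[R]_n -> R) (v : 'rV[R]_n).
Hypothesis cu : continuous u.

Let q (h : R) (x : 'rV[R]_n) : R := h^-1 * (u (h *: v + x) - u x).

Let cq h : continuous (q h).
Proof.
move=> x.
have c1 : (fun y => u (h *: v + y)) y @[y --> x] --> u (h *: v + x).
  apply: (@continuous_comp _ _ _ (fun y => h *: v + y) u); last exact: cu.
  exact: (@cvgD _ _ _ (nbhs x) _ (cst (h *: v)) id _ _ (cvg_cst _) cvg_id).
have c2 : (fun=> h^-1) y @[y --> x] --> h^-1 by exact: (@cvg_cst _ _ _ (nbhs x)).
have c3 : u y @[y --> x] --> u x by exact: cu.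
exact: (cvgM c2 (cvgB c1 c3)).
Qed.

(* The Cauchy criterion for the difference quotients at 0, at precision 1/(k+1)
   and scale 1/(m+1): a closed condition on x since each q h is continuous. *)
Let F (k m : nat) : set 'rV[R]_n := [set x | forall h h' : R,
  h != 0 -> h' != 0 -> `|h| < m.+1%:R^-1 -> `|h'| < m.+1%:R^-1 ->
  `|q h x - q h' x| <= k.+1%:R^-1].

Let mF k m : measurable (F k m).
Proof.
rewrite -[X in measurable X]setCK; apply: measurableC; apply: open_measurable_rV.
rewrite openE => x /existsNP[h] /existsNP[h'] /not_implyP[h0] /not_implyP[h'0].
move=> /not_implyP[hm] /not_implyP[h'm] /negP; rewrite -ltNge => qlt.
have cqq : continuous (fun y => `|q h y - q h' y|).
  move=> y.
  have c1 : q h z @[z --> y] --> q h y by exact: cq.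
  have c2 : q h' z @[z --> y] --> q h' y by exact: cq.
  exact: cvg_norm (cvgB c1 c2).
have := cvgr_gt _ (cqq x) _ qlt => /(_ (nbhs_filter x)).
apply: (@filterS _ (nbhs x) (nbhs_filter x)) => y /= yq.
by move=> /(_ h h' h0 h'0 hm h'm); rewrite leNgt yq.
Qed.

Let derivableE : [set x | derivable u x v] = \bigcap_k \bigcup_m F k m.
Proof.
apply/seteqP; split=> x /=.
  move=> /cvg_ex[l /= /cvgrPdist_lt ul] k _.
  (* [F] compares two quotients with each other, so each has to be within half the precision of the
     limit. *)
  have k0 : (0 : R) < 2^-1 * k.+1%:R^-1 by rewrite mulr_gt0 // invr_gt0.
  have := ul _ k0; rewrite near_withinE => /nbhs_ballP[e /= e0 eul].
  have [m] := ltr_add_invr e0; rewrite add0r => me.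
  exists m => // h h' h0 h'0 hm h'm.
  have b (t : R) : `|t| < m.+1%:R^-1 -> t != 0 -> `|l - q t x| < 2^-1 * k.+1%:R^-1.
    move=> tm t0; apply: eul => //; rewrite /ball /= sub0r normrN.
    exact: lt_trans tm me.
  have := b h hm h0; have := b h' h'm h'0.
  move: (q h x) (q h' x) (l : R) k.+1%:R^-1 => a a' l0 c.
  rewrite !ltr_distlC !ler_distlC => /andP[? ?] /andP[? ?]; apply/andP; split; lra.
move=> Fx; apply: cauchy_cvg; apply: cauchy_exP => e e0.
have [k] := ltr_add_invr e0; rewrite add0r => ke.
have [m _ Fkm] := Fx k I.
(* Any admissible step can be the centre of the Cauchy ball; [m.+2] makes this one strictly smaller
   than the scale. *)
pose h0 : R := m.+2%:R^-1.
have h00 : h0 != 0 by rewrite invr_eq0.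
have h0m : `|h0| < m.+1%:R^-1.
  by rewrite ger0_norm ?invr_ge0 // ltf_pV2 ?posrE // ltr_nat.
exists (q h0 x).
change (\forall h \near 0^', ball (q h0 x) e (q h x)); rewrite near_withinE.
apply/nbhs_ballP; exists m.+1%:R^-1 => //= h; rewrite /ball /= sub0r normrN => hm hn0.
apply: le_lt_trans ke; exact: Fkm.
Qed.

Lemma measurable_derivable : measurable [set x | derivable u x v].
Proof.
rewrite derivableE; apply: bigcapT_measurable => k.
by apply: bigcupT_measurable => m; exact: mF.
Qed.

(** Off the set of derivability ['D] returns the fixed value [point]. Hence it is the pointwise
    limit of the quotients cut off to that set, plus [point] on the complement. *)
Lemma measurable_derive : measurable_fun setT (fun x => 'D_v u x).
Proof.
pose c : R := point.
pose D := [set x | derivable u x v].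
apply: (@measurable_fun_cvg _ _ _ _
  (fun m x => q m.+1%:R^-1 x * \1_D x + c * (1 - \1_D x))).
  move=> m; apply: measurable_funD; apply: measurable_funM => //.
  - by apply: continuous_measurable_rV; exact: cq.
  - by apply: measurable_indic; exact: measurable_derivable.
  - by apply: measurable_funB => //; apply: measurable_indic; exact: measurable_derivable.
move=> x _; rewrite indicE; have [Dx|nDx] := boolP (x \in D).
  under eq_fun do rewrite subrr mulr0 addr0 mulr1.
  rewrite inE in Dx.
  apply: derivable_cvg_seq => //; exact: cvg_harmonic.
under eq_fun do rewrite subr0 mulr0 add0r mulr1.
rewrite (_ : 'D_v u x = c); first exact: cvg_cst.
move: nDx; rewrite notin_setE => nd.
by rewrite /derive; apply: getPN => l /= ul; apply: nd; apply/cvg_ex; exists l.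
Qed.

End directional_derivative.

End row_vector_measurable.

(** * Locally Lipschitz functions on the line *)

Section lipschitz_stieltjes.
Context {R : realType}.
Notation leb := (@lebesgue_measure R).

Lemma lipschitz_continuous (g : R -> R) (K : R) :
  (forall x y, x <= y -> `|g y - g x| <= K * (y - x)) -> continuous g.
Proof.
move=> lg x; apply/cvgrPdist_lt => e e0.
pose K1 := `|K| + 1.
have K10 : 0 < K1 by rewrite ltr_pwDr.
apply/nbhs_ballP; exists (e / K1); first exact: divr_gt0.
move=> y; rewrite /ball /= => xy.
have lg' : `|g x - g y| <= K1 * `|x - y|.
  have KK1 : K <= K1 by rewrite /K1; have := ler_norm K; lra.
  have [le|/ltW le] := leP x y.
    rewrite distrC (distrC x y) (ger0_norm (_ : 0 <= y - x)) ?subr_ge0 //.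
    by rewrite (le_trans (lg _ _ le)) // ler_wpM2r // subr_ge0.
  rewrite (ger0_norm (_ : 0 <= x - y)) ?subr_ge0 //.
  by rewrite (le_trans (lg _ _ le)) // ler_wpM2r // subr_ge0.
by rewrite (le_lt_trans lg') // mulrC -ltr_pdivlMr.
Qed.

Lemma near_addr_derive (F G : R -> R) (c x : R) :
  (\near x, G x + c = F x) -> derivable G x 1 ->
  derivable F x 1 /\ 'D_1 F x = 'D_1 G x.
Proof.
move=> FE dG.
have dGc : is_derive x 1 (G + cst c) ('D_1 G x).
  rewrite -[X in is_derive _ _ _ X]addr0; apply: is_deriveD.
  exact: DeriveDef.
split; first exact: (near_eq_derivable FE (@ex_derive _ _ _ _ _ _ _ dGc)).
by rewrite -(@near_eq_derive _ _ _ _ _ _ (1 : R) FE) -(@derive_val _ _ _ _ _ _ _ dGc).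
Qed.

Variables (F : R -> R) (K : R).
Hypotheses (K0 : 0 < K) (ndF : {homo F : x y / x <= y}).
Hypothesis lipF : forall x y, x <= y -> F y - F x <= K * (y - x).

Let cF : continuous F.
Proof.
apply: (@lipschitz_continuous _ K) => x y xy.
by rewrite ger0_norm ?lipF // subr_ge0 ndF.
Qed.

(** Monotone because F grows at rate at most K. Its Stieltjes measure is what K times Lebesgue
    measure has in excess of that of F. *)
Let H x := K * x - F x.

Let ndH : {homo H : x y / x <= y}.
Proof. by move=> x y xy; rewrite /H; have := lipF xy; rewrite mulrBr; lra. Qed.

Let cH : continuous H.
Proof.
move=> x; apply: cvgB; last exact: cF.
by apply: cvgM; [exact: cvg_cst|exact: cvg_id].
Qed.

Let rc (g : R -> R) : continuous g -> right_continuous g.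
Proof. by move=> cg x; apply: cvg_at_right_filter; exact: cg. Qed.

HB.instance Definition _ := isCumulative.Build R _ R F ndF (rc cF).
HB.instance Definition _ := isCumulative.Build R _ R H ndH (rc cH).

Let mF := lebesgue_stieltjes_measure F.
Let mH := lebesgue_stieltjes_measure H.

Let stieltjes_itv (g : cumulative R R) (a b : R) : a <= b ->
  lebesgue_stieltjes_measure g `]a, b] = (g b - g a)%:E.
Proof.
move=> ab; rewrite /lebesgue_stieltjes_measure /measure_extension/=.
by rewrite measurable_mu_extE/=; [rewrite wlength_itv_bnd|exact: is_ocitv].
Qed.

(* Hence the Stieltjes measure of F is at most K times the Lebesgue measure and
   has a density. *)
Let mFH (A : set R) : measurable A ->
  (mF A + mH A = K%:E * leb A)%E.
Proof.
move=> mA; pose k := NngNum (ltW K0).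
have addE B : measure_add mF mH B = (mF B + mH B)%E by exact: measure_addE.
rewrite -addE (_ : (K%:E * leb A)%E = mscale k leb A) //.
apply: (@measure_unique _ R (measurableTypeR R) (@ocitv R)
  (fun k => `]- k%:R, k%:R]%classic) erefl (@ocitvI R)) => //.
- by move=> i; exact: is_ocitv.
- apply/seteqP; split => // x _ /=.
  exists (Num.bound `|x : R|) => //=; rewrite in_itv /=.
  have := archi_boundP (normr_ge0 (x : R)); rewrite ltr_norml => /andP[-> /ltW ->] //.
- move=> _ [[a b] _ <-]; rewrite [LHS](addE _) /= /mscale /=.
  have [ab|ba] := leP a b; last first.
    rewrite set_itv_ge ?bnd_simp -?leNgt ?ltW // /mF /mH.
    by rewrite [leb _]measure0 mule0 !measure0 adde0.
  rewrite /mF /mH !stieltjes_itv // lebesgue_measure_itv /= lte_fin /H.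
  have [_|/(conj ab)/andP/le_anti ->] := ltP a b.
    by rewrite -!EFinB -EFinM -EFinD; congr EFin; ring.
  by rewrite mule0 -EFinD; congr EFin; ring.
- move=> i; rewrite [ltLHS](addE _) /mF /mH !stieltjes_itv ?ltry //.
    by have := ler0n R i; lra.
  by have := ler0n R i; lra.
Qed.

(** On []- M, M]] the Stieltjes measure of F is finite and absolutely continuous, so Radon-Nikodym
    provides a density. On the open interval F is, up to a constant, the indefinite integral of that
    density, which is differentiable almost everywhere. *)
Lemma lipschitz_stieltjes_density (M : R) : 0 < M ->
  exists f : R -> R, [/\ leb.-integrable setT (EFin \o f),
    forall a b, - M <= a -> a <= b -> b <= M ->
      (\int[leb]_(x in `]a, b]) f x)%R = F b - F a &
    {ae leb, forall x, - M < x < M -> derivable F x 1 /\ 'D_1 F x = f x}].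
Proof.
move=> M0; pose D : set R := `]- M, M]%classic.
have MM : - M <= M by lra.
have mD : measurable (D : set (measurableTypeR R)) by exact: measurable_itv.
have Dfin : (mF D < +oo)%E by rewrite /mF /D stieltjes_itv // ltry.
pose nu := mfrestr mD Dfin.
have nuE A : nu A = mF (A `&` D) by [].
have numu : nu `<< leb.
  apply/null_content_dominatesP => A mA lA; rewrite nuE.
  apply/eqP; rewrite eq_le measure_ge0 andbT.
  have mAD : measurable (A `&` D) by exact: measurableI.
  have -> : (0 = K%:E * leb (A `&` D))%E.
    rewrite (_ : leb _ = 0%E) ?mule0 //; apply/eqP; rewrite eq_le measure_ge0 andbT.
    by rewrite -lA le_measure ?inE.
  by rewrite -mFH // leeDl.
have [f [f0 ffin intf nuf]] := radon_nikodym_sigma_finite numu.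
have nufE A : measurable (A : set (measurableTypeR R)) ->
  mF (A `&` D) = (\int[leb]_(x in A) f x)%E by exact: nuf.
have ff : EFin \o (fine \o f) = f by apply/funext => x /=; rewrite fineK.
have Fitv a b : - M <= a -> a <= b -> b <= M ->
    (\int[leb]_(x in `]a, b]) (fine (f x)))%R = F b - F a.
  move=> Ma ab bM; rewrite /Rintegral.
  under eq_integral do rewrite fineK //.
  rewrite -nufE; last exact: measurable_itv.
  rewrite (_ : _ `&` D = `]a, b]%classic); first by rewrite /mF stieltjes_itv.
  apply: setIidl => x /=; rewrite !in_itv /= => /andP[ax xb]; apply/andP; split.
    exact: le_lt_trans ax.
  exact: le_trans bM.
exists (fine \o f); split => //; first by rewrite ff.
have intS A : measurable A -> leb.-integrable A (EFin \o (fine \o f)).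
  by move=> mA; rewrite ff; apply: (integrableS measurableT).
have := @FTC1Ny R (fine \o f) (fun y => intS _ (measurable_itv _))
  (open_integrable_locally openT (intS _ measurableT)).
apply: filterS; first exact: (ae_filter_ringOfSetsType leb).
move=> x [dG]; rewrite derive1E => G' /andP[Mx xM].
pose G y := (\int[leb]_(t in `]-oo, y]) (fine \o f) t)%R.
(* [nu] has no mass to the left of - M, so integrating from -oo amounts to integrating from - M. *)
have GE : \forall y \near x, G y = F y - F (- M).
  have : \forall y \near x, - M < y < M.
    near=> y; apply/andP; split; near: y; [exact: lt_nbhsr|exact: lt_nbhsl].
  apply: filterS => y /andP[My yM].
  have -> : G y = fine (mF (`]-oo, y] `&` D)).
    rewrite nufE; last exact: measurable_itv.
    by rewrite /G /Rintegral; under eq_integral do rewrite /= fineK //.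
  have -> : F y - F (- M) = fine (mF `]- M, y]) by rewrite /mF stieltjes_itv // ltW.
  congr (fine (mF _)); apply/seteqP; split => z /=; rewrite !in_itv /=.
    by rewrite /D /= in_itv /= => -[-> /andP[-> _]].
  rewrite /D /= in_itv /= => /andP[-> zy]; split => //.
  exact: le_trans zy (ltW yM).
have FE : \forall y \near x, G y + F (- M) = F y.
  by move: GE; apply: filterS => y ->; rewrite subrK.
by rewrite -G'; exact: near_addr_derive FE dG.
Unshelve. all: by end_near. Qed.

End lipschitz_stieltjes.

Section locally_lipschitz.
Context {R : realType}.
Notation leb := (@lebesgue_measure R).

(** The constant may depend on the interval: on a coordinate line, a function with exponentially
    growing Lipschitz constants has in general no uniform one. *)
Definition locally_lipschitz (g : R -> R) := forall M, exists K, forall x y,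
  - M <= x -> x <= y -> y <= M -> `|g y - g x| <= K * (y - x).

(** For M >= 0, a monotone 1-Lipschitz retraction onto [-M, M]. Composing with it makes a locally
    Lipschitz function globally Lipschitz without changing it on the interval. *)
Definition clamp (M t : R) := Num.max (- M) (Num.min t M).

Lemma clamp_itv M : 0 < M -> forall t, - M <= clamp M t <= M.
Proof.
move=> M0 t; have MM : - M <= M by lra.
by rewrite /clamp; apply/andP; split; rewrite ?ge_max ?le_max ?lexx // MM ge_min lexx orbT.
Qed.

Lemma clamp_id M t : - M <= t <= M -> clamp M t = t.
Proof. by move=> /andP[Mt tM]; rewrite /clamp min_l // max_r. Qed.

Lemma ler_clamp M s t : s <= t -> clamp M s <= clamp M t.
Proof. by move=> st; rewrite /clamp le_max2 // le_min2. Qed.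

Lemma clamp_lip M s t : s <= t -> clamp M t - clamp M s <= t - s.
Proof.
move=> st; apply: (@le_trans _ _ (Num.min t M - Num.min s M)); rewrite /clamp.
  have : Num.min s M <= Num.min t M by rewrite le_min2.
  move: (Num.min s M) (Num.min t M) => a b ab.
  by case: (leP (- M) a) => ?; case: (leP (- M) b) => ?; lra.
by case: (leP s M) => ?; case: (leP t M) => ?; lra.
Qed.

Lemma locally_lipschitz_continuous (g : R -> R) :
  locally_lipschitz g -> continuous g.
Proof.
move=> lg x; pose M := `|x| + 1; have [K gK] := lg M.
have M0 : 0 < M by rewrite ltr_pwDr.
pose c := clamp M.
have cM := clamp_itv M0; have cE := @clamp_id M.
have cmono := @ler_clamp M; have clip := @clamp_lip M.
have cgc : continuous (g \o c).
  apply: (@lipschitz_continuous _ _ `|K|) => s t st /=.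
  have /andP[h1 h2] := cM s; have /andP[h3 h4] := cM t.
  rewrite (le_trans (gK _ _ h1 (cmono _ _ st) h4)) //.
  rewrite (@le_trans _ _ (`|K| * (c t - c s))) //.
    by rewrite ler_wpM2r ?ler_norm // subr_ge0 cmono.
  by rewrite ler_wpM2l // clip.
have xM : - M <= x <= M.
  by rewrite -ler_norml /M lerDl.
have : g (c y) @[y --> x] --> g (c x) by exact: (cgc x).
rewrite {2}/c (cE x) //.
apply: cvg_trans; apply: near_eq_cvg.
have : \forall y \near x, - M < y < M.
  have : - M < x < M by rewrite -ltr_norml /M ltrDl.
  move=> /andP[? ?]; near=> y; apply/andP; split; near: y; [exact: lt_nbhsr|exact: lt_nbhsl].
by apply: filterS => y /andP[My yM]; rewrite /c cE // !ltW.
Unshelve. all: by end_near. Qed.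

(* The monotone case is applied to t |-> g (clamp M t) + K * clamp M t. *)
Let core (g : R -> R) (M : R) : 0 < M -> locally_lipschitz g ->
  exists f : R -> R, [/\ leb.-integrable `]- M, M] (EFin \o f),
    forall a b, - M <= a -> a <= b -> b <= M ->
      (\int[leb]_(x in `]a, b]) f x)%R = g b - g a &
    {ae leb, forall x, - M < x < M -> derivable g x 1 /\ 'D_1 g x = f x}].
Proof.
move=> M0 lg; have [K0 gK0] := lg M; pose K := `|K0| + 1.
have K_gt0 : 0 < K by rewrite ltr_pwDr.
have gK x y : - M <= x -> x <= y -> y <= M -> `|g y - g x| <= K * (y - x).
  move=> Mx xy yM; apply: le_trans (gK0 _ _ Mx xy yM) _.
  by rewrite ler_wpM2r ?subr_ge0 // /K; have := ler_norm K0; lra.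
pose c := clamp M.
have cM := clamp_itv M0; have cE := @clamp_id M.
have cmono := @ler_clamp M; have clip := @clamp_lip M.
pose F t := g (c t) + K * c t.
have gc s t : s <= t -> `|g (c t) - g (c s)| <= K * (c t - c s).
  move=> st; have /andP[h1 h2] := cM s; have /andP[h3 h4] := cM t.
  exact: gK (cmono _ _ st) _.
have ndF : {homo F : x y / x <= y}.
  by move=> s t st; rewrite /F; have := gc _ _ st; rewrite ler_norml mulrBr; lra.
(* A slope K comes from g and another K from the linear term that makes F monotone. *)
have lipF x y : x <= y -> F y - F x <= (K *+ 2) * (y - x).
  move=> xy; rewrite /F; have := gc _ _ xy; rewrite ler_norml => /andP[_ h].
  have : K * (c y - c x) <= K * (y - x) by rewrite ler_pM2l // clip.
  move: h; rewrite !mulrBr mulr2n; lra.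
have [|f [intf fF dF]] := lipschitz_stieltjes_density _ ndF lipF M0.
  by rewrite pmulrn_lgt0.
have FE x : - M <= x <= M -> F x = g x + K * x by move=> xM; rewrite /F /c cE.
have mI a b : measurable (`]a, b] : set (measurableTypeR R)) by exact: measurable_itv.
have lfin a b : (leb `]a, b] < +oo)%E.
  by rewrite lebesgue_measure_itv /=; case: ifP => _; rewrite -?EFinB ltry.
have intK a b : leb.-integrable `]a, b] (EFin \o cst K).
  apply/integrableP; split; first exact/measurable_EFinP.
  rewrite (_ : (fun _ => _) = cst `|K|%:E) // integral_cst //.
  by rewrite lte_mul_pinfty //; exact: lfin.
have intf' a b : leb.-integrable `]a, b] (EFin \o f).
  exact: integrableS intf.
exists (fun x => f x - K); split.
- rewrite (_ : EFin \o _ = (EFin \o f) \- (EFin \o cst K))%E //.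
  exact: integrableB.
- move=> a b Ma ab bM; rewrite RintegralB // fF //.
  rewrite (Rintegral_cst leb (mI a b)).
  rewrite [X in fine X](_ : _ = (b - a)%:E); last first.
    rewrite [LHS]lebesgue_measure_itv /= lte_fin.
    have [_ //|/(conj ab)/andP/le_anti ->] := ltP a b; by rewrite subrr.
  rewrite !FE /=; last 2 first.
  + by rewrite Ma (le_trans ab).
  + by rewrite bM (le_trans Ma).
  by ring.
- move: dF; apply: filterS; first exact: (ae_filter_ringOfSetsType leb).
  move=> x h xM; have [dFx DF] := h xM; rewrite -DF.
  have dG : is_derive x 1 (F - K *: id) ('D_1 F x - K *: 1).
    by apply: is_deriveB; exact: DeriveDef.
  have FEn : \forall y \near x, (F - K *: id) y + 0 = g y.
    move: xM => /andP[? ?].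
    have : \forall y \near x, - M < y < M.
      near=> y; apply/andP; split; near: y; [exact: lt_nbhsr|exact: lt_nbhsl].
    apply: filterS => y /andP[My yM].
    rewrite addr0 (_ : (F - K *: id) y = F y - K * y) //.
    by rewrite FE ?ltW // addrK.
  have [dg Dg] := near_addr_derive FEn (@ex_derive _ _ _ _ _ _ _ dG).
  split => //; rewrite Dg (@derive_val _ _ _ _ _ _ _ dG).
  by rewrite /GRing.scale /= mulr1.
Unshelve. all: by end_near. Qed.

Lemma locally_lipschitz_derivable (g : R -> R) :
  locally_lipschitz g -> {ae leb, forall x, derivable g x 1}.
Proof.
move=> lg.
have : {ae leb, forall x, forall m, - m.+1%:R < x < m.+1%:R -> derivable g x 1}.
  apply: ae_foralln => m.
  have [|f [_ _]] := @core g m.+1%:R _ lg; first by [].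
  apply: filterS; first exact: (ae_filter_ringOfSetsType leb).
  by move=> x h xm; have [] := h xm.
apply: filterS; first exact: (ae_filter_ringOfSetsType leb).
move=> x /(_ (Num.bound `|x : R|)); apply; rewrite -ltr_norml.
by rewrite (lt_trans (archi_boundP (normr_ge0 (x : R)))) // ltr_nat.
Qed.

(** The integrand is any measurable w that agrees with the derivative where it exists. Sections of
    partial derivatives and reflected derivatives then fit directly, whatever their values
    elsewhere. *)
Lemma locally_lipschitz_FTC (g w : R -> R) a b : locally_lipschitz g ->
  measurable_fun setT w -> {ae leb, forall x, derivable g x 1 -> w x = 'D_1 g x} ->
  a <= b -> leb.-integrable `]a, b] (EFin \o w) /\
  (\int[leb]_(x in `]a, b]) w x)%R = g b - g a.
Proof.
move=> lg mw wg ab.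
(* The added 1 puts a and b strictly inside, where [core] identifies the derivative with the
   density. *)
pose M := Num.max `|a| `|b| + 1.
have aM : `|a| < M by rewrite (@le_lt_trans _ _ (Num.max `|a| `|b|)) ?le_max ?lexx // ltrDl.
have bM : `|b| < M by rewrite (@le_lt_trans _ _ (Num.max `|a| `|b|)) ?le_max ?lexx ?orbT // ltrDl.
have M0 : 0 < M by rewrite (le_lt_trans _ aM).
have [f [intf fg df]] := core M0 lg.
move: aM bM; rewrite !ltr_norml => /andP[Ma aM] /andP[Mb bM].
have mI : measurable (`]a, b] : set (measurableTypeR R)) by exact: measurable_itv.
have sub : `]a, b]%classic `<=` `]- M, M]%classic.
  move=> x /=; rewrite !in_itv /= => /andP[ax xb].
  by rewrite (lt_trans Ma ax) (le_trans xb (ltW bM)).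
have intab : leb.-integrable `]a, b] (EFin \o f).
  by apply: integrableS intf => //; exact: measurable_itv.
have mw' : measurable_fun `]a, b] (EFin \o w).
  by apply/measurable_EFinP; exact: measurable_funTS.
have ae : ae_eq leb `]a, b]%classic (EFin \o f) (EFin \o w).
  move: wg df; apply: filterS2; first exact: (ae_filter_ringOfSetsType leb).
  move=> x h1 h2 /=; rewrite in_itv /= => /andP[ax xb].
  have [|dg Dg] := h2; first by rewrite (lt_trans Ma ax) (le_lt_trans xb bM).
  by rewrite -Dg h1.
have mf := measurable_int leb intab.
split.
  apply/integrableP; split => //; move/integrableP: intab => [_].
  rewrite (@ae_eq_integral _ _ _ leb _ (abse \o (EFin \o w))) //.
  - by apply: measurableT_comp.
  - by apply: measurableT_comp.
  - exact: ae_eq_abse.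
rewrite -fg //; [|exact: ltW..]; apply: (congr1 fine).
by apply/esym/ae_eq_integral.
Qed.

End locally_lipschitz.

(** The image measure is described by its values on measurable sets, so that nu can itself be a
    Lebesgue, normal or product measure rather than a syntactic [pushforward]. *)
Lemma ge0_integral_transfer d d' (X : measurableType d) (Y : measurableType d')
    (R : realType) (mu : {measure set X -> \bar R})
    (nu : {measure set Y -> \bar R}) (phi : X -> Y) (f : Y -> \bar R) :
  measurable_fun setT phi ->
  (forall A, measurable A -> nu A = mu (phi @^-1` A)) ->
  measurable_fun setT f -> (forall y, 0 <= f y)%E ->
  (\int[nu]_y f y = \int[mu]_x f (phi x))%E.
Proof.
move=> mphi numu mf f0.
rewrite (eq_measure_integral (pushforward mu phi)); last by move=> A mA _; exact: numu.
by rewrite ge0_integral_pushforward // preimage_setT.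
Qed.

(** * Affine changes of variables for Lebesgue measure *)

Section lebesgue_affine.
Context {R : realType}.
Notation leb := (@lebesgue_measure R).

Let leb_itv (a b : R) : a <= b -> leb `]a, b]%classic = (b - a)%:E.
Proof.
move=> ab; rewrite [LHS]lebesgue_measure_itv /= lte_fin.
by have [_ //|/(conj ab)/andP/le_anti ->] := ltP a b; rewrite subrr.
Qed.

(** Both sides are measures in A that agree on half-open intervals, and these determine Lebesgue
    measure. *)
Lemma lebesgue_measure_affine (a h : R) (A : set R) : 0 < a -> measurable A ->
  (leb A = a%:E * leb ((fun x : R => (a * x + h)%R) @^-1` A))%E.
Proof.
move=> a0 mA; pose f x : R := a * x + h.
have mf : measurable_fun setT (f : measurableTypeR R -> measurableTypeR R).
  apply: measurable_funD; last exact: measurable_cst.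
  by apply: measurable_funM; [exact: measurable_cst|exact: measurable_id].
pose k := NngNum (ltW a0).
have := @lebesgue_measure_unique R (mscale k
  (measure_function_pushforward__canonical__measure_function_Measure leb mf)) _ A mA.
apply => _ [[b c] _ <-] /=; rewrite /mscale /= /pushforward.
have -> : f @^-1` `]b, c] = `](b - h) / a, (c - h) / a]%classic.
  apply/seteqP; split => x /=; rewrite /f !in_itv /= ltr_pdivrMr // ler_pdivlMr //;
   rewrite (mulrC x) ltrBlDr lerBrDr //.
have [bc|cb] := leP b c; last first.
  rewrite !set_itv_ge ?bnd_simp -?leNgt ?measure0 ?mule0 ?ltW //.
  by rewrite ltr_pM2r ?invr_gt0 // ltrD2r.
rewrite !leb_itv //; last by rewrite ler_pM2r ?invr_gt0 // lerD2r.
by rewrite -EFinM; congr EFin; field; rewrite gt_eqF.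
Qed.

Lemma lebesgue_measure_opp (A : set R) : measurable A -> leb A = leb (-%R @^-1` A).
Proof.
move=> mA.
have mf : measurable_fun setT (-%R : measurableTypeR R -> measurableTypeR R).
  exact: oppr_measurable.
have := @lebesgue_measure_unique R (measure_function_pushforward__canonical__measure_function_Measure leb mf) _ A mA.
apply => _ [[b c] _ <-] /=; rewrite /pushforward.
have [bc|cb] := leP b c; last first.
  by rewrite !set_itv_ge ?bnd_simp -?leNgt ?preimage_set0 ?measure0 // ltW.
(* Reflection moves the closed end to the left, which does not change the length. *)
have -> : -%R @^-1` `]b, c] = `[- c, - b[%classic.
  by apply/seteqP; split => x /=; rewrite !in_itv /= lerNl ltrNr andbC.
rewrite leb_itv // [RHS]lebesgue_measure_itv /= lte_fin ltrN2.
have [_ //|/(conj bc)/andP/le_anti ->] := ltP b c; last by rewrite subrr.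
by rewrite -EFinB opprK addrC.
Qed.

Lemma ge0_integral_affine (a h : R) (f : R -> \bar R) : 0 < a ->
  measurable_fun setT f -> (forall x, 0 <= f x)%E ->
  (\int[leb]_x f x = a%:E * \int[leb]_x f (a * x + h)%R)%E.
Proof.
move=> a0 mf f0; pose k := NngNum (ltW a0).
have mphi : measurable_fun setT (fun x : measurableTypeR R => a * x + h : measurableTypeR R).
  apply: measurable_funD; last exact: measurable_cst.
  by apply: measurable_funM; [exact: measurable_cst|exact: measurable_id].
have mfphi : measurable_fun setT (fun x : R => f (a * x + h)).
  exact: (measurableT_comp mf mphi).
rewrite (@ge0_integral_transfer _ _ _ _ _ (mscale k leb) leb _ _ mphi) //.
  by rewrite ge0_integral_mscale.
by move=> A mA; rewrite /mscale /=; exact: lebesgue_measure_affine.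
Qed.

Lemma ge0_integral_opp (f : R -> \bar R) :
  measurable_fun setT f -> (forall x, 0 <= f x)%E ->
  (\int[leb]_x f x = \int[leb]_x f (- x)%R)%E.
Proof.
move=> mf f0.
have mphi : measurable_fun setT (-%R : measurableTypeR R -> measurableTypeR R).
  exact: oppr_measurable.
rewrite (@ge0_integral_transfer _ _ _ _ _ leb leb _ _ mphi) //.
by move=> A mA; exact: lebesgue_measure_opp.
Qed.

End lebesgue_affine.

(** * The Gaussian Poincare inequality on the line *)

Section normal.
Context {R : realType}.
Notation leb := (@lebesgue_measure R).
Variable s : R.
Hypothesis s0 : 0 < s.
Notation N := (normal_prob 0 s).
Notation phi := (normal_pdf 0 s).

(** The density and the Radon-Nikodym derivative of the normal law have the same integral over every
    measurable set, hence agree almost everywhere. *)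
Lemma ge0_integral_normal (f : R -> \bar R) :
  measurable_fun setT f -> (forall x, 0 <= f x)%E ->
  (\int[N]_x f x = \int[leb]_x (f x * (phi x)%:E))%E.
Proof.
move=> mf f0.
have Nleb := @normal_prob_dominates R 0 s.
rewrite -(Radon_Nikodym_SigmaFinite.change_of_variables Nleb) //.
have mphi : measurable_fun setT (EFin \o phi).
  by apply/measurable_EFinP; exact: measurable_normal_pdf.
have iRN := Radon_Nikodym_SigmaFinite.f_integrable Nleb.
apply: ae_eq_integral => //.
- by apply: emeasurable_funM => //; exact: measurable_int iRN.
- exact: emeasurable_funM.
- apply: ae_eqe_mul2l.
  apply: integral_ae_eq => // E _ mE.
  by rewrite -Radon_Nikodym_SigmaFinite.f_integral.
Qed.

Lemma normal_pdf_centerE x : phi x = normal_peak s * expR (- x ^+ 2 / (s ^+ 2 *+ 2)).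
Proof. by rewrite normal_pdfE ?gt_eqF // /normal_fun subr0. Qed.

Lemma normal_pdf_shift h x :
  phi (x - h) = expR ((h * x - h ^+ 2 / 2) / s ^+ 2) * phi x.
Proof.
rewrite !normal_pdf_centerE mulrCA -expRD; congr (_ * expR _).
by field; rewrite gt_eqF.
Qed.

(** Translation invariance of Lebesgue measure moves the shift to the density, and completing the
    square gives the exponential: the Cameron-Martin formula in one dimension. *)
Lemma ge0_integral_normal_shift h (f : R -> \bar R) :
  measurable_fun setT f -> (forall x, 0 <= f x)%E ->
  (\int[N]_x f (x + h)%R =
   \int[N]_x (f x * (expR ((h * x - h ^+ 2 / 2) / s ^+ 2))%:E))%E.
Proof.
move=> mf f0.
have mexp : measurable_fun setT
    (fun x : R => (expR ((h * x - h ^+ 2 / 2) / s ^+ 2))%:E).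
  apply/measurable_EFinP; apply: measurableT_comp => //.
  by apply: measurable_funM => //; apply: measurable_funB => //.
have mphi : measurable_fun setT (EFin \o phi).
  by apply/measurable_EFinP; exact: measurable_normal_pdf.
have mfh : measurable_fun setT (fun x : R => f (x + h)).
  by apply: measurableT_comp => //; exact: measurable_funD.
rewrite !ge0_integral_normal //; last 2 first.
- exact: emeasurable_funM.
- by move=> x; rewrite mule_ge0 // lee_fin expR_ge0.
rewrite (@ge0_integral_affine R 1 h (fun x => _ * (expR _)%:E * _)%E) //; last 2 first.
- by apply: emeasurable_funM => //; exact: emeasurable_funM.
- by move=> x; rewrite !mule_ge0 // lee_fin ?expR_ge0 ?normal_pdf_ge0.
rewrite mul1e; apply: eq_integral => x _; rewrite mul1r -muleA -EFinM.
by rewrite -normal_pdf_shift addrK.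
Qed.

(** Apply the shift formula to the constant function 1 with shift c s^2: the exponent becomes c x
    minus a constant, and the other side is the total mass. *)
Lemma normal_expR_lin c : (\int[N]_x (expR (c * x)%R)%:E =
  (expR (c ^+ 2 * s ^+ 2 / 2)%R)%:E)%E.
Proof.
have := @ge0_integral_normal_shift (c * s ^+ 2) (cst 1%E) (measurable_cst _) (fun=> lee01).
rewrite integral_cst // mul1e [X in X = _ -> _]probability_setT => /esym.
under eq_integral.
  move=> x _; rewrite mul1e.
  rewrite (_ : _ / _ = c * x + (- (c ^+ 2 * s ^+ 2 / 2))); last first.
    by field; rewrite gt_eqF.
  rewrite expRD expRN EFinM; over.
rewrite ge0_integralZr //; last first.
  by apply/measurable_EFinP; apply: measurableT_comp => //; exact: measurable_funM.
move/(congr1 (fun z => z * (expR (c ^+ 2 * s ^+ 2 / 2))%:E)%E).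
by rewrite -muleA -EFinM mulVf ?gt_eqF ?expR_gt0 // mule1 mul1e.
Qed.

Lemma normal_expR_norm_lty c : (\int[N]_x (expR (c * `|x|))%:E < +oo)%E.
Proof.
have mexp c' : measurable_fun setT (fun x : R => (expR (c' * x))%:E).
  apply/measurable_EFinP; apply: measurableT_comp => //; exact: measurable_funM.
apply: (@le_lt_trans _ _ (\int[N]_x ((expR (c * x))%:E + (expR (- c * x))%:E))%E).
  apply: ge0_le_integral => //.
  - apply/measurable_EFinP; apply: measurableT_comp => //.
    by apply: measurable_funM => //; exact: measurableT_comp.
  - exact: (emeasurable_funD (mexp c) (mexp (- c))).
  - move=> x _; rewrite -EFinD lee_fin.
    have := expR_ge0 (c * x); have := expR_ge0 (- c * x).
    by case: (ger0P x) => _; rewrite ?mulrN ?mulNr; lra.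
rewrite ge0_integralD //; last 2 first.
- exact: (mexp c).
- exact: (mexp (- c)).
by rewrite !normal_expR_lin -EFinD ltry.
Qed.

(** Cauchy-Schwarz, obtained by integrating (w - m)^2 >= 0 with m the mean slope. If w^2 is not
    integrable, the right side is infinite because b - a > 0. *)
Lemma sqr_increment_le (g w : R -> R) (a b : R) : locally_lipschitz g ->
  measurable_fun setT w -> {ae leb, forall x, derivable g x 1 -> w x = 'D_1 g x} ->
  a < b -> (((g b - g a) ^+ 2)%:E <=
            (b - a)%:E * \int[leb]_(t in `]a, b]) (w t ^+ 2)%:E)%E.
Proof.
move=> lg mw wg ab; have [iw Iw] := locally_lipschitz_FTC lg mw wg (ltW ab).
have L0 : 0 < b - a by rewrite subr_gt0.
have mI : measurable (`]a, b]%classic : set (measurableTypeR R)) by exact: measurable_itv.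
have lI : leb `]a, b]%classic = (b - a)%:E.
  by rewrite [LHS]lebesgue_measure_itv /= lte_fin ab.
have mw2 : measurable_fun `]a, b]%classic (fun t => (w t ^+ 2)%:E).
  by apply/measurable_EFinP; apply: measurable_funTS; exact: measurable_funX.
have [iw2|] := ltP (\int[leb]_(t in `]a, b]) (w t ^+ 2)%:E)%E +oo%E; last first.
  rewrite leye_eq => /eqP ->; rewrite gt0_muley ?lte_fin //; exact: leey.
have intw2 : leb.-integrable `]a, b] (fun t => (w t ^+ 2)%:E).
  apply/integrableP; split => //.
  by under eq_integral do rewrite /= ger0_norm ?sqr_ge0 //.
pose m := (g b - g a) / (b - a).
have intm : leb.-integrable `]a, b] (EFin \o cst (m ^+ 2)).
  apply/integrableP; split; first exact/measurable_EFinP.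
  rewrite (_ : (fun _ => _) = cst `|m ^+ 2|%:E) // integral_cst //.
  by rewrite lte_mul_pinfty // [X in (X < _)%E]lI ltry.
have int2 : leb.-integrable `]a, b] (EFin \o (fun t => 2 * m * w t)).
  rewrite (_ : EFin \o _ = (fun t => (2 * m)%:E * (EFin \o w) t)%E) //.
  exact: integrableZl.
have : \int[leb]_(t in `]a, b]) (2 * m * w t - m ^+ 2) <=
       \int[leb]_(t in `]a, b]) (w t ^+ 2).
  apply: le_Rintegral => //.
    exact: (integrableB mI int2 intm).
  move=> t _; have := sqr_ge0 (w t - m); rewrite !expr2; lra.
rewrite RintegralB // RintegralZl // Iw (Rintegral_cst leb mI).
rewrite [X in fine X]lI /= => h.
have -> : (\int[leb]_(t in `]a, b]) (w t ^+ 2)%:E =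
    (\int[leb]_(t in `]a, b]) (w t ^+ 2))%R%:E)%E.
  rewrite /Rintegral fineK //; exact: integrable_fin_num.
rewrite -EFinM lee_fin -ler_pdivrMl // ; apply: le_trans h.
by rewrite le_eqVlt; apply/orP; left; apply/eqP; rewrite /m; field; rewrite gt_eqF.
Qed.

Lemma normal_tail_first_moment t : 0 <= t ->
  (\int[leb]_(y in `[t, +oo[) (y * phi y)%:E = (s ^+ 2 * phi t)%:E)%E.
Proof.
move=> t0.
pose k := (s ^+ 2 *+ 2)^-1; pose C := - s ^+ 2 * normal_peak s.
have k0 : 0 < k by rewrite invr_gt0 pmulrn_lgt0 // exprn_gt0.
(* An antiderivative of y phi(y), equal to - s^2 phi; C is chosen for this. *)
pose F z := C * expR (- k * z ^+ 2).
have FE z : F z = - (s ^+ 2 * phi z).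
  rewrite /F /C normal_pdf_centerE mulNr mulNr -mulrA; congr (- (_ * (_ * expR _))).
  by rewrite !mulNr mulrC.
have dF y : is_derive y (1 : R) F (y * phi y).
  have d1 : is_derive y (1 : R) (fun z => - k * z ^+ 2) (- k * (2 * y)).
    by apply: is_derive_eq; rewrite /GRing.scale /= mulr1; ring.
  pose q z : R := - k * z ^+ 2.
  have d2 := @is_derive1_comp _ expR q y _ _ (is_derive_expR (q y)) d1.
  have d3 := is_deriveZ C d2.
  suff -> : y * phi y = C *: (expR (q y) * (- k * (2 * y))) by exact: d3.
  rewrite /q /GRing.scale /= normal_pdf_centerE /C.
  rewrite (_ : - y ^+ 2 / _ = - k * y ^+ 2); last by rewrite !mulNr mulrC.
  by move: (expR _) => E; rewrite /k; field; rewrite gt_eqF.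
have cphi : continuous (fun y : R => y * phi y).
  by move=> y; apply: cvgM; [exact: cvg_id|apply: continuous_normal_pdf; rewrite gt_eqF].
have cF : continuous F.
  by move=> y; apply: differentiable_continuous; apply/derivable1_diffP; exact: ex_derive.
rewrite (@ge0_continuous_FTC2y _ _ F t 0).
- by rewrite FE sub0e EFinN oppeK.
- by move=> x tx; rewrite mulr_ge0 ?normal_pdf_ge0 // (le_trans t0).
- exact: continuous_subspaceT.
- rewrite -(mulr0 C); apply: cvgM; first exact: cvg_cst.
  (* For x >= 1 the Gaussian factor lies below exp(- k x), which tends to 0. *)
  have h : expR (- (x * k)) @[x --> +oo] --> (0 : R).
    apply: (cvg_comp (fun x => x * k) (fun z => expR (- z)) _ (@cvgr_expR R)).
    apply: gt0_cvgMly => //; exact: cvg_id.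
  apply: (squeeze_cvgr _ (cvg_cst 0) h).
  near=> x; rewrite expR_ge0 /= ler_expR mulNr lerN2 (mulrC k) ler_pM2r //.
  by rewrite expr2 ler_peMl //; near: x; exact: nbhs_pinfty_ge.
- by move=> x _; exact: ex_derive.
- by apply: cvg_at_right_filter; exact: cF.
- by move=> x _; rewrite derive1E derive_val.
Unshelve. all: by end_near. Qed.

(* Cauchy-Schwarz on ]0, y], then Fubini: the weight of w t ^+ 2 becomes the
   integral of y * phi y over y >= t, which is s ^+ 2 * phi t. *)
Let poincare_half (g w : R -> R) : locally_lipschitz g ->
  measurable_fun setT w -> {ae leb, forall x, derivable g x 1 -> w x = 'D_1 g x} ->
  (\int[leb]_(y in `]0%R, +oo[) ((g y - g 0) ^+ 2 * phi y)%:E <=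
   (s ^+ 2)%:E * \int[leb]_(t in `]0%R, +oo[) (w t ^+ 2 * phi t)%:E)%E.
Proof.
move=> lg mw wg.
have mphi := measurable_normal_pdf (0 : R) s.
have mg : measurable_fun setT g.
  by apply: continuous_measurable_fun; exact: locally_lipschitz_continuous.
pose H (p : R * R) : \bar R :=
  (if (0 < p.2) && (p.2 <= p.1) then p.1 * phi p.1 * w p.2 ^+ 2 else 0)%:E.
have H0 p : (0 <= H p)%E.
  rewrite /H lee_fin; case: ifP => // /andP[h1 h2].
  rewrite mulr_ge0 ?sqr_ge0 // mulr_ge0 ?normal_pdf_ge0 //.
  exact: le_trans (ltW h1) h2.
have mH : measurable_fun setT H.
  apply/measurable_EFinP; apply: measurable_fun_ifT.
  - by apply: measurable_and; [exact: measurable_fun_ltr|exact: measurable_fun_ler].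
  - apply: measurable_funM; first apply: measurable_funM => //.
      exact: measurableT_comp.
    by apply: measurable_funX; exact: measurableT_comp.
  - exact: measurable_cst.
pose I0 : set R := `]0, +oo[%classic.
have mI0 : measurable (I0 : set (measurableTypeR R)) by exact: measurable_itv.
apply: (@le_trans _ _ (\int[leb]_(y in I0) \int[leb]_t H (y, t))%E).
  apply: ge0_le_integral => //.
  - by move=> y _; rewrite lee_fin mulr_ge0 ?sqr_ge0 ?normal_pdf_ge0.
  - apply/measurable_EFinP; apply: measurable_funTS; apply: measurable_funM => //.
    by apply: measurable_funX; exact: measurable_funB.
  - by apply: measurable_funTS; exact: measurable_fun_fubini_tonelli_F.
  - move=> y; rewrite /I0 /= in_itv /= andbT => y0.
    have -> : (\int[leb]_t H (y, t))%E =
        ((y * phi y)%:E * \int[leb]_(t in `]0%R, y]) (w t ^+ 2)%:E)%E.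
      rewrite -ge0_integralZl //.
      + rewrite [RHS]integral_mkcond; apply: eq_integral => t _.
        rewrite /H /= patchE mem_setE in_itv /=.
        by case: ifP => ty //; rewrite EFinM.
      + by apply/measurable_EFinP; apply: measurable_funTS; exact: measurable_funX.
      + by move=> x _; rewrite lee_fin sqr_ge0.
      + by rewrite lee_fin mulr_ge0 ?normal_pdf_ge0 // ltW.
    have := sqr_increment_le lg mw wg y0; rewrite subr0 => h.
    rewrite [X in (_ <= X)%E](_ : _ = (phi y)%:E *
      (y%:E * \int[leb]_(t in `]0%R, y]) (w t ^+ 2)%:E))%E; last first.
      by rewrite muleA -EFinM (mulrC (phi y)).
    by rewrite mulrC EFinM lee_wpmul2l // lee_fin normal_pdf_ge0.
have -> : (\int[leb]_(y in I0) \int[leb]_t H (y, t) = \int[leb]_t \int[leb]_y H (y, t))%E.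
  rewrite -fubini_tonelli // integral_mkcond; apply: eq_integral => y _.
  rewrite patchE mem_setE in_itv /= andbT; case: ifPn => // y0.
  rewrite integral0_eq // => t _; rewrite /H /= ifF //; apply/negbTE/negP => /andP[t0 ty].
  by move: y0; rewrite (lt_le_trans t0 ty).
rewrite -ge0_integralZl //; last 3 first.
- by apply/measurable_EFinP; apply: measurable_funTS; apply: measurable_funM => //; exact: measurable_funX.
- by move=> x _; rewrite lee_fin mulr_ge0 ?sqr_ge0 ?normal_pdf_ge0.
- by rewrite lee_fin sqr_ge0.
rewrite [leRHS]integral_mkcond le_eqVlt; apply/orP; left; apply/eqP.
apply: eq_integral => t _; rewrite patchE mem_setE in_itv /= andbT; case: ifPn => [t0|nt].
  rewrite -EFinM mulrCA EFinM -normal_tail_first_moment ?ltW //.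
  rewrite -ge0_integralZl //; last 3 first.
  - apply/measurable_EFinP; apply: measurable_funTS; exact: measurable_funM.
  - move=> x; rewrite /= in_itv /= andbT => tx.
    by rewrite lee_fin mulr_ge0 ?normal_pdf_ge0 // (le_trans (ltW t0)).
  - by rewrite lee_fin sqr_ge0.
  rewrite [RHS]integral_mkcond; apply: eq_integral => y _.
  rewrite patchE mem_setE in_itv /= andbT /H /= t0 /=.
  by case: ifPn => ty //; rewrite -EFinM mulrC.
apply: integral0_eq => y _; rewrite /H /= ifF //; apply/negbTE/negP => /andP[t0 _].
by move: nt; rewrite t0.
Qed.

(** The second moment about [g 0] dominates the variance, so this is stronger than the usual
    inequality, with the same constant. Starting at 0 lets the two half-lines be treated separately,
    the negative one by reflection. *)
Lemma normal_poincare (g w : R -> R) : locally_lipschitz g ->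
  measurable_fun setT w -> {ae leb, forall x, derivable g x 1 -> w x = 'D_1 g x} ->
  (\int[N]_y ((g y - g 0) ^+ 2)%:E <= (s ^+ 2)%:E * \int[N]_t (w t ^+ 2)%:E)%E.
Proof.
move=> lg mw wg.
have mg : measurable_fun setT g.
  by apply: continuous_measurable_fun; exact: locally_lipschitz_continuous.
have mphi := measurable_normal_pdf (0 : R) s.
have phiN y : phi (- y) = phi y by rewrite !normal_pdf_centerE sqrrN.
pose I0 : set R := `]0, +oo[%classic.
have mI0 : measurable (I0 : set (measurableTypeR R)) by exact: measurable_itv.
(* The value at 0 is replaced by 0 because neither open half-line contains that point. This leaves
   the left integrand unchanged, as it vanishes there, and can only lower the right one. *)
have split_half (f : R -> R) : measurable_fun setT f -> (forall y, 0 <= f y) ->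
    (\int[leb]_y (if y == 0%R then 0 else f y)%:E =
     \int[leb]_(y in I0) (f y)%:E + \int[leb]_(y in I0) (f (- y)%R)%:E)%E.
  move=> mf f0.
  have mfN : measurable_fun setT (fun y : R => f (- y)) by exact: measurableT_comp.
  have mfI : measurable_fun setT (EFin \o (f \_ I0)).
    by apply/measurable_EFinP; apply/(measurable_restrictT _ _).1 => //; exact: measurable_funTS.
  have mfI' : measurable_fun setT (EFin \o ((fun y => f (- y)) \_ I0)).
    by apply/measurable_EFinP; apply/(measurable_restrictT _ _).1 => //; exact: measurable_funTS.
  have pos (h : R -> R) y : (forall y, 0 <= h y) -> (0 <= (EFin \o (h \_ I0)) y)%E.
    by move=> h0; rewrite /= lee_fin patchE; case: ifP.
  have e (h : R -> R) : (\int[leb]_(y in I0) (h y)%:E = \int[leb]_y (EFin \o (h \_ I0)) y)%E.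
    rewrite integral_mkcond; apply: eq_integral => y _.
    by rewrite /= !patchE; case: ifP.
  rewrite !e (@ge0_integral_opp _ (EFin \o ((fun y => f (- y)) \_ I0))) //; last first.
    by move=> x; exact: pos.
  rewrite -ge0_integralD //; last 3 first.
  - by move=> x _; exact: pos.
  - by move=> x _; exact: pos.
  - exact: (measurableT_comp mfI' (@oppr_measurable R setT)).
  apply: eq_integral => y _; rewrite /= !patchE !mem_setE !in_itv /= !andbT opprK oppr_gt0 -EFinD.
  by case: (ltgtP y 0) => [_|_|_]; rewrite ?addr0 ?add0r.
have mg2 : measurable_fun setT (fun y => (g y - g 0) ^+ 2).
  by apply: measurable_funX; exact: measurable_funB.
have mw2 : measurable_fun setT (fun y => (w y) ^+ 2) by exact: measurable_funX.
rewrite ge0_integral_normal; last 2 first.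
- exact/measurable_EFinP.
- by move=> y; rewrite lee_fin sqr_ge0.
rewrite ge0_integral_normal; last 2 first.
- exact/measurable_EFinP.
- by move=> y; rewrite lee_fin sqr_ge0.
have h1 := poincare_half lg mw wg.
have lgN : locally_lipschitz (fun y => g (- y)).
  move=> M; have [K gK] := lg M; exists K => x y Mx xy yM.
  have hy : - M <= - y by rewrite lerN2.
  have hx : - x <= M by rewrite lerNl.
  have hxy : - y <= - x by rewrite lerN2.
  have := gK _ _ hy hxy hx; rewrite distrC => /le_trans; apply.
  by rewrite opprK addrC.
have wgN : {ae leb, forall x, derivable (fun y => g (- y)) x 1 ->
    - w (- x) = 'D_1 (fun y => g (- y)) x}.
  have [A [mA A0 Asub]] := wg.
  exists (-%R @^-1` A); split.
  - by rewrite -[X in measurable X]setTI; exact: oppr_measurable.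
  - by rewrite -lebesgue_measure_opp.
  - move=> x /= nx; apply: Asub => /= wx; apply: nx => dgN.
    have gE : g = (fun y => g (- y)) \o (fun y : R => - y).
      by apply/funext => y /=; rewrite opprK.
    have dN' : is_derive (- x : R) (1 : R) (fun y : R => - y) (- 1).
      by apply: is_derive_eq.
    have dg' : is_derive (- - x : R) (1 : R) (fun y => g (- y)) ('D_1 (fun y => g (- y)) x).
      by rewrite opprK; exact: DeriveDef.
    have d2 := @is_derive1_comp _ (fun y => g (- y)) (fun y => - y) (- x) _ _ dg' dN'.
    rewrite -gE in d2.
    rewrite (wx (@ex_derive _ _ _ _ _ _ _ d2)) (@derive_val _ _ _ _ _ _ _ d2).
    by rewrite mulrN1 opprK.
have mwN : measurable_fun setT (fun y : R => - w (- y)).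
  by apply: measurableT_comp => //; exact: measurableT_comp.
have h2 := poincare_half lgN mwN wgN.
rewrite oppr0 in h2.
have mF : measurable_fun setT (fun y => (g y - g 0) ^+ 2 * phi y) by exact: measurable_funM.
have mG : measurable_fun setT (fun y => (w y) ^+ 2 * phi y) by exact: measurable_funM.
have F0 y : 0 <= (g y - g 0) ^+ 2 * phi y by rewrite mulr_ge0 ?sqr_ge0 ?normal_pdf_ge0.
have G0 y : 0 <= (w y) ^+ 2 * phi y by rewrite mulr_ge0 ?sqr_ge0 ?normal_pdf_ge0.
apply: (@le_trans _ _ ((s ^+ 2)%:E *
    \int[leb]_y (if y == 0%R then 0 else w y ^+ 2 * phi y)%:E)%E); last first.
  apply: lee_wpmul2l; first by rewrite lee_fin sqr_ge0.
  apply: ge0_le_integral => //.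
  - by move=> y _; rewrite lee_fin; case: ifP.
  - apply/measurable_EFinP; apply: measurable_fun_ifT => //.
    exact: measurable_fun_eqr.
  - exact/measurable_EFinP.
  - by move=> y _; rewrite -EFinM lee_fin; case: ifP.
rewrite split_half // ge0_muleDr; last 2 first.
- by apply: integral_ge0 => y _; rewrite lee_fin.
- by apply: integral_ge0 => y _; rewrite lee_fin.
under eq_integral => y _.
  rewrite -EFinM (_ : _ * _ = if y == 0 then 0 else (g y - g 0) ^+ 2 * phi y); last first.
    by case: eqP => // ->; rewrite subrr expr0n mul0r.
  over.
rewrite split_half //; apply: leeD; first exact: h1.
move: h2; under eq_integral do rewrite -phiN.
move=> /le_trans; apply; rewrite le_eqVlt; apply/orP; left; apply/eqP; congr (_ * _)%E.
by apply: eq_integral => y _; rewrite sqrrN phiN.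
Qed.

End normal.

(** * Gaussian measures on row vectors *)

Section row_vector_product.
Context {R : realType} {n : nat}.
Notation rV := 'rV[R]_n.

Let rboxes2 : set (set (rV * rV)) :=
  [set A `*` B | A in @rboxes R n & B in @rboxes R n].

(** Products of boxes are stable under intersection and have explicit Gaussian measure, which makes
    them the generators to use for uniqueness on pairs. The two projections show that they generate
    the product sigma-algebra. *)
Let measurable_rboxes2 : @measurable _ (rV * rV)%type = <<s rboxes2 >>.
Proof.
rewrite measurable_prod_measurableType; apply/seteqP; split; last first.
  apply: smallest_sub; first exact: smallest_sigma_algebra.
  move=> _ [A rA [B rB <-]]; apply: sub_sigma_algebra.
  by exists A; [exact: sub_sigma_algebra|exists B => //; exact: sub_sigma_algebra].
apply: smallest_sub; first exact: smallest_sigma_algebra.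
move=> _ [A mA [B mB <-]].
have rT : @rboxes R n setT by exists (fun=> setT) => //; apply/seteqP; split.
have mfst : measurable_fun setT (fst : g_sigma_algebraType rboxes2 -> rV).
  apply: (@measurability _ _ _ _ _ _ (@rboxes R n)) => // _ [C rC <-].
  rewrite setTI; apply: sub_sigma_algebra; exists C => //; exists setT => //.
  by apply/seteqP; split => -[x y] //= [].
have msnd : measurable_fun setT (snd : g_sigma_algebraType rboxes2 -> rV).
  apply: (@measurability _ _ _ _ _ _ (@rboxes R n)) => // _ [C rC <-].
  rewrite setTI; apply: sub_sigma_algebra; exists setT => //; exists C => //.
  by apply/seteqP; split => -[x y] //= [].
have -> : A `*` B = (setT `&` fst @^-1` A) `&` (setT `&` snd @^-1` B).
  by rewrite !setTI.
apply: (@measurableI _ (g_sigma_algebraType rboxes2)).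
- exact: mfst.
- exact: msnd.
Qed.

Lemma rbox_measure_unique (m1 m2 : {measure set rV -> \bar R}) :
  (m1 setT < +oo)%E ->
  (forall B, (forall i, measurable (B i)) -> m1 (rbox B) = m2 (rbox B)) ->
  forall A, measurable A -> m1 A = m2 A.
Proof.
move=> m1T m12 A mA.
have rT : @rbox R n (fun=> setT) = setT by apply/seteqP; split.
apply: (@measure_unique _ R _ (@rboxes R n) (fun=> setT)) => //.
- move=> _ _ [B1 mB1 ->] [B2 mB2 ->]; exists (fun i => B1 i `&` B2 i).
    by move=> i; exact: measurableI.
  apply/seteqP; split => x /=; first by move=> [h1 h2] i; split; [exact: h1|exact: h2].
  by move=> h; split => i; have [] := h i.
- by move=> _; exists (fun=> setT).
- by apply/seteqP; split => // x _; exists 0%N.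
- by move=> _ [B mB ->]; exact: m12.
Qed.

Lemma rbox2_measure_unique (m1 m2 : {measure set (rV * rV) -> \bar R}) :
  (m1 setT < +oo)%E ->
  (forall A B, (forall i, measurable (A i)) -> (forall i, measurable (B i)) ->
    m1 (rbox A `*` rbox B) = m2 (rbox A `*` rbox B)) ->
  forall A, measurable A -> m1 A = m2 A.
Proof.
move=> m1T m12 A mA.
have rT : @rbox R n (fun=> setT) = setT by apply/seteqP; split.
have rI A1 A2 : @rboxes R n A1 -> @rboxes R n A2 -> @rboxes R n (A1 `&` A2).
  move=> [B1 mB1 ->] [B2 mB2 ->]; exists (fun i => B1 i `&` B2 i).
    by move=> i; exact: measurableI.
  apply/seteqP; split => x /=; first by move=> [h1 h2] i; split; [exact: h1|exact: h2].
  by move=> h; split => i; have [] := h i.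
apply: (@measure_unique _ R _ rboxes2 (fun=> setT)) => //.
- move=> _ _ [A1 rA1 [B1 rB1 <-]] [A2 rA2 [B2 rB2 <-]].
  exists (A1 `&` A2); first exact: rI.
  exists (B1 `&` B2); first exact: rI.
  by rewrite setXI.
- move=> _; exists setT; first by exists (fun=> setT).
  by exists setT; [exists (fun=> setT)|rewrite setXTT].
- by apply/seteqP; split => // x _; exists 0%N.
- by move=> _ [_ [A1 mA1 ->] [_ [B1 mB1 ->] <-]]; exact: m12.
Qed.

End row_vector_product.

Section gaussian_measure.
Context {R : realType} {n : nat}.
Notation rV := 'rV[R]_n.

(** Prescribing the values on boxes suffices, as boxes form a generating pi-system. Taking a bare
    set function lets a [pushforward] be an argument. *)
Definition gaussian (s : R) (Q : set rV -> \bar R) :=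
  forall B : 'I_n -> set R, (forall i, measurable (B i)) ->
    Q (rbox B) = (\big[mule/1]_(i < n) normal_prob 0 s (B i))%E.

Definition upd (i : 'I_n) (t : R) (x : rV) : rV :=
  \row_j (if j == i then t else x 0 j).

Lemma updE i t x j : upd i t x 0 j = if j == i then t else x 0 j.
Proof. by rewrite mxE. Qed.

Lemma upd_upd i t u x : upd i t (upd i u x) = upd i t x.
Proof. by apply/rowP => j; rewrite !mxE; case: eqP. Qed.

Lemma upd_shift i (h : R) (x : rV) : h *: delta_mx 0 i + x = upd i (x 0 i + h) x.
Proof.
apply/rowP => j; rewrite !mxE eqxx /=.
by case: eqP => [->|]; rewrite ?mulr1 ?mulr0 ?add0r // addrC.
Qed.

Lemma measurable_upd d (T : measurableType d) (i : 'I_n) (t : T -> R) (x : T -> rV) :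
  measurable_fun setT t -> measurable_fun setT x ->
  measurable_fun setT (fun w => upd i (t w) (x w)).
Proof.
move=> mt mx; apply: measurable_rV => j.
under eq_fun do rewrite mxE.
by case: (j == i) => //; exact: (measurableT_comp (measurable_coord j) mx).
Qed.

(* Exchanges the coordinates in D between the two copies; by independence this
   preserves Q \x Q, which is how single coordinates get resampled. *)
Definition swap_coords (D : pred 'I_n) (p : rV * rV) : rV * rV :=
  (\row_j (if D j then p.2 0 j else p.1 0 j), \row_j (if D j then p.1 0 j else p.2 0 j)).

Lemma measurable_swap_coords D : measurable_fun setT (swap_coords D).
Proof.
by apply: measurable_fun_pair; apply: measurable_rV => j;
  under eq_fun do rewrite mxE; case: (D j);
  exact: (measurableT_comp (measurable_coord j)).
Qed.

Lemma swap_coordsD D D' p :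
  swap_coords D (swap_coords D' p) = swap_coords (fun j => D j (+) D' j) p.
Proof.
by rewrite /swap_coords; congr pair; apply/rowP => j; rewrite !mxE; case: (D j); case: (D' j).
Qed.

Lemma swap_coords1 i p : (swap_coords (pred1 i) p).1 = upd i (p.2 0 i) p.1.
Proof. by apply/rowP => j; rewrite !mxE /=; case: eqP => [->|]. Qed.

Variables (s : R) (s0 : 0 < s) (Q : probability rV R).
Hypothesis gQ : gaussian s Q.

Let N_setT : normal_prob 0 s [set: R] = 1%E.
Proof. exact: probability_setT. Qed.

Lemma gaussian_coord i (B : set R) : measurable B ->
  Q ((fun x : rV => x 0 i) @^-1` B) = normal_prob 0 s B.
Proof.
move=> mB.
have -> : (fun x : rV => x 0 i) @^-1` B = rbox (fun j => if j == i then B else setT).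
  apply/seteqP; split => x /=; first by move=> Bx j; case: eqP => [->|].
  by move=> /(_ i); rewrite eqxx.
rewrite gQ; last by move=> j; case: ifP.
rewrite (bigD1 i) //= eqxx big1 ?mule1 // => j /negbTE ->; exact: N_setT.
Qed.

(** On a product of two boxes the exchange only permutes the one-dimensional factors, and products
    of boxes determine the measure. *)
Lemma swap_coords_preserves D (A : set (rV * rV)) : measurable A ->
  (Q \x Q)%E A = (Q \x Q)%E (swap_coords D @^-1` A).
Proof.
move=> mA; have ms := measurable_swap_coords D.
pose m2 := measure_function_pushforward__canonical__measure_function_Measure (Q \x Q)%E ms.
apply: (@rbox2_measure_unique R n (Q \x Q)%E m2) => //.
  rewrite -setXTT [ltLHS](product_measure1E _ _ measurableT measurableT).
  change ((Q [set: rV] * Q [set: rV] < +oo)%E).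
  by rewrite probability_setT mule1 ltry.
move=> B C mB mC; rewrite /m2 /= /pushforward.
have -> : swap_coords D @^-1` (rbox B `*` rbox C) =
    rbox (fun j => if D j then C j else B j) `*` rbox (fun j => if D j then B j else C j).
  apply/seteqP; split => -[x y] /= [h1 h2]; split => j; have := h1 j; have := h2 j;
   by rewrite !mxE /=; case: (D j).
have E2 X Y : (forall i, measurable (X i)) -> (forall i, measurable (Y i)) ->
    (Q \x Q)%E (rbox X `*` rbox Y) = ((\big[mule/1]_(i < n) normal_prob 0 s (X i)) *
      (\big[mule/1]_(i < n) normal_prob 0 s (Y i)))%E.
  move=> mX mY; rewrite [LHS](product_measure1E _ _ (measurable_rbox mX) (measurable_rbox mY)).
  exact: (f_equal2 mule (gQ mX) (gQ mY)).
rewrite [LHS](E2 _ _ mB mC) [RHS]E2; try by move=> j; case: (D j).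
rewrite -!big_split /=; apply: eq_bigr => j _.
by case: (D j) => //; rewrite muleC.
Qed.

Lemma ge0_swap_coords D (F : rV * rV -> \bar R) :
  measurable_fun setT F -> (forall p, 0 <= F p)%E ->
  (\int[(Q \x Q)%E]_p F p = \int[(Q \x Q)%E]_p F (swap_coords D p))%E.
Proof.
move=> mF F0; apply: ge0_integral_transfer => //; first exact: measurable_swap_coords.
by move=> A mA; exact: swap_coords_preserves.
Qed.

Lemma ge0_integral_coord i (f : R -> \bar R) :
  measurable_fun setT f -> (forall t, 0 <= f t)%E ->
  (\int[normal_prob 0 s]_t f t = \int[Q]_x f (x 0%R i))%E.
Proof.
move=> mf f0; apply: (@ge0_integral_transfer _ _ _ _ _ Q (normal_prob 0 s) (fun x : rV => x 0 i)) => //.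
  exact: measurable_coord.
by move=> A mA; exact: (esym (gaussian_coord i mA)).
Qed.

(** Fubini in coordinate i: the coordinate is exchanged with that of an independent copy, which then
    enters only through its law N(0, s^2). *)
Lemma ge0_resample i (F : rV -> \bar R) :
  measurable_fun setT F -> (forall x, 0 <= F x)%E ->
  (\int[Q]_x F x = \int[Q]_x \int[normal_prob 0 s]_t F (upd i t x))%E.
Proof.
move=> mF F0.
have mFf : measurable_fun setT (fun p : rV * rV => F p.1) by exact: measurableT_comp.
transitivity (\int[(Q \x Q)%E]_p F p.1)%E.
  rewrite fubini_tonelli1 //; apply: eq_integral => x _.
  by rewrite /fubini_F /= integral_cst // [X in (_ * X)%E](@probability_setT _ _ _ Q) mule1.
rewrite (ge0_swap_coords (pred1 i)) // fubini_tonelli1 //; last first.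
  exact: (measurableT_comp mFf (measurable_swap_coords _)).
apply: eq_integral => x _; rewrite /fubini_F.
under eq_integral do rewrite swap_coords1 /=.
rewrite (ge0_integral_coord i) //.
apply: measurableT_comp => //; apply: measurable_upd => //; exact: measurable_cst.
Qed.

(** The shift and the exponential involve coordinate i only, so resampling it reduces the claim to
    the shift formula on the line. *)
Lemma ge0_shift i h (F : rV -> \bar R) :
  measurable_fun setT F -> (forall x, 0 <= F x)%E ->
  (\int[Q]_x F (h *: delta_mx 0 i + x)%R =
   \int[Q]_x (F x * (expR ((h * x 0 i - h ^+ 2 / 2) / s ^+ 2))%:E))%E.
Proof.
move=> mF F0.
have mU : measurable_fun setT (fun x : rV => F (h *: delta_mx 0 i + x)).
  under eq_fun do rewrite upd_shift.
  apply: measurableT_comp => //; apply: measurable_upd => //.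
  by apply: measurable_funD => //; exact: measurable_coord.
have mexp : measurable_fun setT (fun x : rV => expR ((h * x 0 i - h ^+ 2 / 2) / s ^+ 2)).
  apply: measurableT_comp => //; apply: measurable_funM => //; apply: measurable_funB => //.
  by apply: measurable_funM => //; exact: measurable_coord.
rewrite (ge0_resample i) // [RHS](ge0_resample i); last 2 first.
- by apply: emeasurable_funM => //; exact/measurable_EFinP.
- by move=> x; rewrite mule_ge0 // lee_fin expR_ge0.
apply: eq_integral => x _.
under eq_integral => t _ do rewrite upd_shift updE eqxx upd_upd.
under [RHS]eq_integral => t _ do rewrite updE eqxx.
rewrite (@ge0_integral_normal_shift _ _ s0 h (fun t => F (upd i t x))) //.
apply: measurableT_comp => //; apply: measurable_upd => //; exact: measurable_cst.
Qed.

(** Again Fubini: the inner integral of the indicator over coordinate i vanishes on every line. *)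
Lemma ae_resample i (E : set rV) : measurable E ->
  (forall x, (normal_prob 0 s).-negligible [set t | E (upd i t x)]) -> Q E = 0%E.
Proof.
move=> mE nE.
have mI : measurable_fun setT (EFin \o (\1_E : rV -> R)).
  by apply/measurable_EFinP; exact: measurable_indic.
have mu x : measurable_fun setT (fun t : R => upd i t x).
  by apply: measurable_upd => //; exact: measurable_cst.
rewrite -[E]setIT -integral_indic // (ge0_resample i) //.
apply: integral0_eq => x _.
have -> : (\int[normal_prob 0 s]_t (\1_E (upd i t x))%:E =
    \int[normal_prob 0 s]_t (\1_[set t | E (upd i t x)] t)%:E)%E.
  by apply: eq_integral => t _; rewrite !indicE; congr (_%:R%:E); apply/idP/idP; rewrite !inE.
have mE' : measurable [set t | E (upd i t x)].
  by rewrite -[X in measurable X]setTI; exact: mu.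
by rewrite integral_indic // setIT; apply: measure_negligible.
Qed.

End gaussian_measure.

(** * Functions of exponential growth *)

Section tame.
Context {R : realType} {n : nat}.
Notation rV := 'rV[R]_n.
Implicit Types (F G : rV -> R) (x : rV).

Definition nrm1 (x : rV) : R := \sum_i `|x 0 i|.

(* Exponential growth is integrable against a Gaussian, and is stable under
   products, translations and the Cameron-Martin densities. *)
Definition edom (K : R) (x : rV) : R := K * expR (K * nrm1 x).

Definition tame (F : rV -> R) :=
  measurable_fun setT F /\ exists2 K, 0 <= K & forall x, `|F x| <= edom K x.

Lemma nrm1_ge0 x : 0 <= nrm1 x.
Proof. by apply: sumr_ge0 => i _; exact: normr_ge0. Qed.

Lemma ler_coord_nrm1 (x : rV) i : `|x 0 i| <= nrm1 x.
Proof.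
by rewrite /nrm1 (bigD1 i) //= lerDl; apply: sumr_ge0 => j _; exact: normr_ge0.
Qed.

Lemma nrm1_upd i t (x : rV) : nrm1 (upd i t x) <= `|t| + nrm1 x.
Proof.
rewrite /nrm1 (bigD1 i) //= [in X in _ <= X](bigD1 i) //= updE eqxx lerD2l.
under eq_bigr => j /negbTE ji do rewrite updE ji.
by rewrite lerDr normr_ge0.
Qed.

Lemma nrm1_shift i h (x : rV) : nrm1 (h *: delta_mx 0 i + x) <= `|h| + nrm1 x.
Proof.
rewrite upd_shift /nrm1 (bigD1 i) //= [in X in _ <= X](bigD1 i) //= updE eqxx.
under eq_bigr => j /negbTE ji do rewrite updE ji.
by rewrite addrA lerD2r; apply: le_trans (ler_normD _ _) _; rewrite addrC.
Qed.

Lemma ler_edom K K' x : 0 <= K -> K <= K' -> edom K x <= edom K' x.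
Proof.
move=> K0 KK'; rewrite /edom ler_pM ?expR_ge0 // ler_expR ler_wpM2r //.
exact: nrm1_ge0.
Qed.

Lemma edom_ge0 K x : 0 <= K -> 0 <= edom K x.
Proof. by move=> K0; rewrite mulr_ge0 ?expR_ge0. Qed.

Lemma edomD K K' x : 0 <= K -> 0 <= K' -> edom K x + edom K' x <= edom (K + K') x.
Proof.
move=> K0 K'0; rewrite {3}/edom mulrDl lerD // ler_wpM2l // ler_expR ler_wpM2r ?nrm1_ge0 //.
  by rewrite lerDl.
by rewrite lerDr.
Qed.

(** One parameter is both factor and rate. The product has factor K K' and rate K + K', and their
    sum dominates both. *)
Lemma edomM K K' x : 0 <= K -> 0 <= K' ->
  edom K x * edom K' x <= edom (K * K' + (K + K')) x.
Proof.
move=> K0 K'0; rewrite /edom mulrACA -expRD -mulrDl ler_pM ?expR_ge0 ?mulr_ge0 //.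
  by rewrite lerDl addr_ge0.
by rewrite ler_expR ler_wpM2r ?nrm1_ge0 // lerDr mulr_ge0.
Qed.

Lemma measurable_nrm1 : measurable_fun setT nrm1.
Proof.
by apply: measurable_sum => i; apply: measurableT_comp => //; exact: measurable_coord.
Qed.

Lemma measurable_edom K : measurable_fun setT (edom K).
Proof.
apply: measurable_funM => //; apply: measurableT_comp => //.
by apply: measurable_funM => //; exact: measurable_nrm1.
Qed.

Lemma tame_edom K : 0 <= K -> tame (edom K).
Proof.
move=> K0; split; first exact: measurable_edom.
by exists K => // x; rewrite ger0_norm // edom_ge0.
Qed.

Lemma tame_le F G : measurable_fun setT F -> tame G ->
  (forall x, `|F x| <= `|G x|) -> tame F.
Proof.
move=> mF [_ [K K0 GK]] FG; split => //; exists K => // x.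
exact: le_trans (FG x) (GK x).
Qed.

Lemma tame_cst c : tame (fun=> c).
Proof.
split; first exact: measurable_cst.
exists `|c| => // x; rewrite /edom ler_peMr //.
by rewrite -[leLHS]expR0 ler_expR mulr_ge0 ?nrm1_ge0.
Qed.

Lemma tameD F G : tame F -> tame G -> tame (fun x => F x + G x).
Proof.
move=> [mF [K K0 FK]] [mG [K' K'0 GK]]; split; first exact: measurable_funD.
exists (K + K'); first exact: addr_ge0.
move=> x; apply: le_trans (ler_normD _ _) _; apply: le_trans (edomD x K0 K'0).
by rewrite lerD.
Qed.

Lemma tameM F G : tame F -> tame G -> tame (fun x => F x * G x).
Proof.
move=> [mF [K K0 FK]] [mG [K' K'0 GK]]; split; first exact: measurable_funM.
exists (K * K' + (K + K')); first by rewrite !addr_ge0 ?mulr_ge0.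
move=> x; rewrite normrM; apply: le_trans (edomM x K0 K'0).
by rewrite ler_pM.
Qed.

Lemma tameZ c F : tame F -> tame (fun x => c * F x).
Proof. by move=> tF; apply: tameM => //; exact: tame_cst. Qed.

Lemma tameN F : tame F -> tame (fun x => - F x).
Proof.
move=> tF; apply: (tame_le _ tF); last by move=> x; rewrite normrN.
by case: tF => mF _; exact: measurableT_comp.
Qed.

Lemma tameB F G : tame F -> tame G -> tame (fun x => F x - G x).
Proof. by move=> tF tG; apply: tameD => //; exact: tameN. Qed.

Lemma tameX2 F : tame F -> tame (fun x => F x ^+ 2).
Proof. by move=> tF; apply: tameM. Qed.

Lemma tame_norm F : tame F -> tame (fun x => `|F x|).
Proof.
move=> tF; apply: (tame_le _ tF); last by move=> x; rewrite normr_id.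
by case: tF => mF _; exact: measurableT_comp.
Qed.

Lemma tame_sum (I : Type) (r : seq I) (P : pred I) (F : I -> rV -> R) :
  (forall i, P i -> tame (F i)) -> tame (fun x => \sum_(i <- r | P i) F i x).
Proof.
move=> tF; elim: r => [|i r IH].
  by under eq_fun do rewrite big_nil; exact: tame_cst.
under eq_fun do rewrite big_cons.
by case Pi: (P i) => //; apply: tameD => //; exact: tF.
Qed.

Lemma tame_coord i : tame (fun x : rV => x 0 i).
Proof.
split; first exact: measurable_coord.
exists 1 => // x; rewrite /edom !mul1r.
apply: le_trans (ler_coord_nrm1 x i) _; apply: le_trans (expR_ge1Dx _).
by rewrite lerDr.
Qed.

Lemma tame_exp i a b : tame (fun x : rV => expR (a * x 0 i + b)).
Proof.
split.
  apply: measurableT_comp => //; apply: measurable_funD => //.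
  by apply: measurable_funM => //; exact: measurable_coord.
have e1 : 1 <= expR `|b| by rewrite -[leLHS]expR0 ler_expR.
exists (expR `|b| + `|a|); first by rewrite addr_ge0 ?expR_ge0.
move=> x; rewrite ger0_norm ?expR_ge0 // expRD mulrC /edom.
apply: ler_pM; rewrite ?expR_ge0 //.
  by rewrite (@le_trans _ _ (expR `|b|)) ?ler_expR ?ler_norm // lerDl.
rewrite ler_expR (le_trans (ler_norm _)) // normrM.
apply: ler_pM => //; last exact: ler_coord_nrm1.
by rewrite lerDr expR_ge0.
Qed.

Lemma measurable_shift i h (F : rV -> R) : measurable_fun setT F ->
  measurable_fun setT (fun x => F (h *: delta_mx 0 i + x)).
Proof.
move=> mF; under eq_fun do rewrite upd_shift.
apply: measurableT_comp => //; apply: measurable_upd => //.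
by apply: measurable_funD => //; exact: measurable_coord.
Qed.

Lemma edom_shift K i h x : 0 <= K ->
  edom K (h *: delta_mx 0 i + x) <= edom (K * expR (K * `|h|)) x.
Proof.
move=> K0; have e1 : 1 <= expR (K * `|h|) by rewrite -[leLHS]expR0 ler_expR mulr_ge0.
apply: (@le_trans _ _ (K * expR (K * `|h|) * expR (K * nrm1 x))).
  rewrite /edom -mulrA -expRD -mulrDr ler_wpM2l // ler_expR ler_wpM2l //.
  exact: nrm1_shift.
rewrite /edom ler_wpM2l ?mulr_ge0 ?expR_ge0 // ler_expR ler_wpM2r ?nrm1_ge0 //.
by rewrite ler_peMr.
Qed.

Lemma tame_shift i h F : tame F -> tame (fun x => F (h *: delta_mx 0 i + x)).
Proof.
move=> [mF [K K0 FK]]; split; first exact: measurable_shift.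
exists (K * expR (K * `|h|)); first by rewrite mulr_ge0 ?expR_ge0.
by move=> x; apply: le_trans (FK _) _; exact: edom_shift.
Qed.

End tame.

Lemma integral_transfer d d' (X : measurableType d) (Y : measurableType d')
    (R : realType) (mu : {measure set X -> \bar R})
    (nu : {measure set Y -> \bar R}) (phi : X -> Y) (f : Y -> \bar R) :
  measurable_fun setT phi ->
  (forall A, measurable A -> nu A = mu (phi @^-1` A)) ->
  nu.-integrable setT f ->
  mu.-integrable setT (fun x => f (phi x)) /\
  (\int[nu]_y f y = \int[mu]_x f (phi x))%E.
Proof.
move=> mphi numu /integrableP[mf fi].
have ifphi : mu.-integrable setT (fun x => f (phi x)).
  apply/integrableP; split; first exact: measurableT_comp.
  rewrite -(@ge0_integral_transfer _ _ _ _ _ mu nu phi (fun y => `|f y|)%E) //.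
  exact: measurableT_comp.
split => //.
rewrite (eq_measure_integral (pushforward mu phi)); last by move=> A mA _; exact: numu.
by rewrite integral_pushforward // preimage_setT.
Qed.

(** * Expectations under a Gaussian law *)

Section expectation.
Context {R : realType} {n : nat}.
Notation rV := 'rV[R]_n.
Implicit Types (F G : rV -> R) (x : rV).
Variables (s : R) (s0 : 0 < s) (Q : probability rV R).
Hypothesis gQ : gaussian s Q.

Notation Ex F := (\int[Q]_x F x).

(** Some coordinate satisfies [nrm1 x <= n%:R * |x_i|], so [edom K] is bounded by a sum of functions
    of one coordinate each. The separate summand K covers n = 0. *)
Let edom_lty K : 0 <= K -> (\int[Q]_x (edom K x)%:E < +oo)%E.
Proof.
move=> K0.
pose G (x : rV) : R := K + \sum_i K * expR (K * n%:R * `|x 0 i|).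
have mc i : measurable_fun setT (fun x : rV => K * expR (K * n%:R * `|x 0 i|)).
  apply: measurable_funM => //; apply: measurableT_comp => //.
  by apply: measurable_funM => //; apply: measurableT_comp => //; exact: measurable_coord.
have ge0c i x : 0 <= K * expR (K * n%:R * `|(x : rV) 0 i|) by rewrite mulr_ge0 ?expR_ge0.
apply: (@le_lt_trans _ _ (\int[Q]_x (K%:E + \sum_i (K * expR (K * n%:R * `|x 0%R i|))%:E))%E).
  apply: ge0_le_integral => //.
  - by move=> x _; rewrite lee_fin edom_ge0.
  - by apply/measurable_EFinP; exact: measurable_edom.
  - apply: emeasurable_funD => //; apply: emeasurable_sum => i; exact/measurable_EFinP.
  - move=> x _; rewrite sumEFin -EFinD lee_fin.
    have [[i hi]|nh] := pselect (exists i, nrm1 x <= n%:R * `|x 0 i|).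
      rewrite (bigD1 i) //= addrCA /edom -[leLHS]addr0 lerD //.
        by rewrite ler_wpM2l // ler_expR -mulrA ler_wpM2l.
      by rewrite addr_ge0 // sumr_ge0.
    have h i : n%:R * `|x 0 i| <= nrm1 x.
      by apply/ltW; rewrite ltNge; apply/negP => ?; apply: nh; exists i.
    have [n0|n0] := posnP n; last first.
      exfalso; apply: nh; pose i0 := Ordinal n0.
      apply: contrapT => /forallNP h'.
      have : \sum_(i < n) (n%:R * `|x 0 i|) < \sum_(i < n) nrm1 x.
        apply: ltr_sum; first by apply/hasP; exists i0; rewrite ?mem_index_enum.
        by move=> i _; rewrite ltNge; apply/negP; exact: h'.
      by rewrite -mulr_sumr sumr_const card_ord mulr_natl ltxx.
    rewrite -[leLHS]addr0 lerD ?sumr_ge0 // /edom.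
    rewrite /nrm1 big1 ?mulr0 ?expR0 ?mulr1 //.
    by move=> i _; move: (ltn_ord i); rewrite {2}n0.
rewrite ge0_integralD //; last 2 first.
- by move=> x _; apply: sume_ge0 => i _; rewrite lee_fin.
- by apply: emeasurable_sum => i; exact/measurable_EFinP.
rewrite ge0_integral_sum //; [|by move=> i; exact/measurable_EFinP|by move=> i x _; rewrite lee_fin].
rewrite integral_cst // [X in (_ * X)%E](@probability_setT _ _ _ Q) mule1.
rewrite lte_add_pinfty ?ltry //; apply/lte_sum_pinfty => i _.
have -> : (\int[Q]_x (K * expR (K * n%:R * `|x 0%R i|))%:E =
   K%:E * \int[Q]_x (expR (K * n%:R * `|x 0%R i|))%:E)%E.
  under eq_integral do rewrite EFinM.
  rewrite ge0_integralZl //.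
  - apply/measurable_EFinP; apply: measurableT_comp => //.
    by apply: measurable_funM => //; apply: measurableT_comp => //; exact: measurable_coord.
have <- := @ge0_integral_coord _ _ _ _ gQ i (fun t => (expR (K * n%:R * `|t|))%:E).
- by rewrite lte_mul_pinfty //; exact: normal_expR_norm_lty.
- apply/measurable_EFinP; apply: measurableT_comp => //.
  by apply: measurable_funM => //; exact: measurableT_comp.
- by move=> t; rewrite lee_fin expR_ge0.
Qed.

Lemma tame_integrable F : tame F -> Q.-integrable setT (EFin \o F).
Proof.
move=> [mF [K K0 FK]]; apply/integrableP; split; first exact/measurable_EFinP.
apply: le_lt_trans (edom_lty K0).
apply: ge0_le_integral => //.
- by apply/measurable_EFinP; exact: measurableT_comp.
- by apply/measurable_EFinP; exact: measurable_edom.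
- by move=> x _; rewrite /= lee_fin.
Qed.

Lemma EFin_Ex F : tame F -> (\int[Q]_x (F x)%:E)%E = (Ex F)%:E.
Proof.
by move=> tF; rewrite /Rintegral fineK //; apply: integrable_fin_num => //; exact: tame_integrable.
Qed.

Lemma ExD F G : tame F -> tame G -> Ex (fun x => F x + G x) = Ex F + Ex G.
Proof. by move=> tF tG; rewrite RintegralD //; exact: tame_integrable. Qed.

Lemma ExB F G : tame F -> tame G -> Ex (fun x => F x - G x) = Ex F - Ex G.
Proof. by move=> tF tG; rewrite RintegralB //; exact: tame_integrable. Qed.

Lemma ExZ c F : tame F -> Ex (fun x => c * F x) = c * Ex F.
Proof. by move=> tF; rewrite RintegralZl //; exact: tame_integrable. Qed.

Lemma Ex_cst c : Ex (fun=> c) = c.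
Proof.
by rewrite (Rintegral_cst Q measurableT) [X in fine X](@probability_setT _ _ _ Q) /= mulr1.
Qed.

Lemma Ex_sum (I : Type) (r : seq I) (P : pred I) (F : I -> rV -> R) :
  (forall i, P i -> tame (F i)) ->
  Ex (fun x => \sum_(i <- r | P i) F i x) = \sum_(i <- r | P i) Ex (F i).
Proof.
move=> tF; elim: r => [|i r IH].
  by under eq_Rintegral do rewrite big_nil; rewrite Ex_cst big_nil.
under eq_Rintegral do rewrite big_cons.
rewrite big_cons; case: ifP => Pi //.
by rewrite ExD ?IH //; [exact: tF|exact: tame_sum].
Qed.

Lemma Ex_ae_eq F G : tame F -> tame G -> {ae Q, forall x, F x = G x} -> Ex F = Ex G.
Proof.
move=> [mF _] [mG _] FG; apply: (congr1 fine); apply: ae_eq_integral => //.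
- exact/measurable_EFinP.
- exact/measurable_EFinP.
- by move: FG; apply: filterS => x h _ /=; rewrite h.
Qed.

Lemma Ex_ge0 F : (forall x, 0 <= F x) -> 0 <= Ex F.
Proof. by move=> F0; apply: Rintegral_ge0. Qed.

Lemma Ex_ae_le F G : tame F -> tame G -> {ae Q, forall x, F x <= G x} -> Ex F <= Ex G.
Proof.
move=> tF tG FG.
(* [le_Rintegral] asks for the inequality everywhere; replacing G by this maximum changes it only on
   a null set. *)
pose H x := Num.max (F x) (G x).
have tH : tame H.
  apply: (@tame_le _ _ _ (fun x => `|F x| + `|G x|)).
  - by case: tF => ? _; case: tG => ? _; exact: measurable_maxr.
  - by apply: tameD; exact: tame_norm.
  - move=> x; rewrite [leRHS]ger0_norm ?addr_ge0 // /H.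
    by case: (leP (F x) (G x)) => _; rewrite ?lerDl ?lerDr normr_ge0.
have -> : Ex G = Ex H.
  by apply: Ex_ae_eq => //; move: FG; apply: filterS => x h; rewrite /H max_r.
apply: le_Rintegral => //; try exact: tame_integrable.
by move=> x _; rewrite /H le_max lexx.
Qed.

Lemma Ex_shift i h F : tame F ->
  Ex (fun x => F (h *: delta_mx 0 i + x)) =
  Ex (fun x => F x * expR ((h * x 0 i - h ^+ 2 / 2) / s ^+ 2)).
Proof.
have tE : tame (fun x : rV => expR ((h * x 0 i - h ^+ 2 / 2) / s ^+ 2)).
  have := tame_exp i (h / s ^+ 2) (- (h ^+ 2 / 2) / s ^+ 2).
  by under eq_fun do rewrite mulrAC -mulrDl.
have nonneg G : tame G -> (forall x, 0 <= G x) ->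
    Ex (fun x => G (h *: delta_mx 0 i + x)) =
    Ex (fun x => G x * expR ((h * x 0 i - h ^+ 2 / 2) / s ^+ 2)).
  move=> [mG _] G0; apply: (congr1 fine).
  rewrite (@ge0_shift _ _ _ s0 _ gQ i h (EFin \o G)) //; first exact/measurable_EFinP.
move=> tF; case: (tF) => mF [K K0 FK].
have tK := tame_edom K0.
(* The shift formula is available for nonnegative functions, and F is a difference of two tame
   ones. *)
have FKE x : F x = (F x + edom K x) - edom K x by rewrite addrK.
have tFK : tame (fun x => F x + edom K x) by exact: tameD.
under eq_Rintegral do rewrite FKE.
under [RHS]eq_Rintegral do rewrite FKE mulrBl.
rewrite ExB; [|exact: tame_shift tFK|exact: tame_shift].
rewrite ExB; [|exact: tameM|exact: tameM].
rewrite (nonneg _ (tame_edom K0)); last by move=> x; exact: edom_ge0.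
congr (_ - _); apply: nonneg => // x.
by have := FK x; rewrite ler_norml => /andP[]; lra.
Qed.

Lemma Ex_cvg (F_ : nat -> rV -> R) F G : (forall m, measurable_fun setT (F_ m)) ->
  measurable_fun setT F -> tame G -> (forall m x, `|F_ m x| <= G x) ->
  {ae Q, forall x, F_ m x @[m --> \oo] --> F x} ->
  Ex (F_ m) @[m --> \oo] --> Ex F.
Proof.
move=> mF_ mF tG FG FF.
have [] := @dominated_convergence _ _ _ Q setT measurableT
  (fun m => EFin \o F_ m) (EFin \o F) (EFin \o G).
- by move=> m; exact/measurable_EFinP.
- exact/measurable_EFinP.
- move: FF; apply: filterS => x h _; apply: cvg_comp h _.
  by apply: cvg_EFin; [exact: nearW|exact: cvg_id].
- exact: tame_integrable.
- by apply: aeW => x m _; rewrite /= lee_fin.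
move=> iF _ h; apply: fine_cvg; rewrite /Rintegral fineK //.
exact: integrable_fin_num.
Qed.

End expectation.

(** * Functions with exponentially growing Lipschitz constants *)

Section explip.
Context {R : realType} {n : nat}.
Notation rV := 'rV[R]_n.
Implicit Types (F G u v : rV -> R) (x : rV).

Definition shift1 (i : 'I_n) (h : R) (x : rV) : rV := h *: delta_mx 0 i + x.

(* The Lipschitz constant may itself grow exponentially, so that products of
   Lipschitz functions stay in the class. *)
Definition explip u := continuous u /\ exists2 K, 0 <= K &
  (forall x, `|u x| <= edom K x) /\
  (forall i h x, `|u (shift1 i h x) - u x| <=
     `|h| * (edom K x + edom K (shift1 i h x))).

Lemma explip_measurable u : explip u -> measurable_fun setT u.
Proof. by move=> [cu _]; exact: continuous_measurable_rV. Qed.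

Lemma explip_tame u : explip u -> tame u.
Proof.
move=> eu; split; first exact: explip_measurable.
by case: eu => _ [K K0 [uK _]]; exists K.
Qed.

Lemma explip_common u v : explip u -> explip v -> exists2 K, 0 <= K &
  [/\ forall x, `|u x| <= edom K x, forall x, `|v x| <= edom K x,
   forall i h x, `|u (shift1 i h x) - u x| <=
     `|h| * (edom K x + edom K (shift1 i h x)) &
   forall i h x, `|v (shift1 i h x) - v x| <=
     `|h| * (edom K x + edom K (shift1 i h x))].
Proof.
move=> [_ [K K0 [uK u2]]] [_ [K' K'0 [vK v2]]].
have l1 x : edom K x <= edom (K + K') x by rewrite ler_edom // lerDl.
have l2 x : edom K' x <= edom (K + K') x by rewrite ler_edom // lerDr.
exists (K + K'); first exact: addr_ge0.
split => [x|x|i h x|i h x].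
- exact: le_trans (l1 x).
- exact: le_trans (l2 x).
- by apply: le_trans (u2 _ _ _) _; rewrite ler_wpM2l // lerD.
- by apply: le_trans (v2 _ _ _) _; rewrite ler_wpM2l // lerD.
Qed.

Lemma explip_cst c : explip (fun=> c).
Proof.
split; first by move=> x; exact: (@cvg_cst _ _ _ (nbhs x)).
have [_ [K K0 cK]] := tame_cst (n := n) c.
exists K => //; split => // i h x; rewrite subrr normr0 mulr_ge0 // addr_ge0 //; exact: edom_ge0.
Qed.

Lemma continuous_coord (i : 'I_n) : continuous (fun x : rV => x 0 i).
Proof. exact: coord_continuous. Qed.

Lemma explip_coord i : explip (fun x : rV => x 0 i).
Proof.
split; first exact: continuous_coord.
have [_ [K K0 cK]] := @tame_coord R n i.
have K1 x : 1 <= edom (K + 1) x.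
  have e1 : 1 <= expR ((K + 1) * nrm1 x).
    by rewrite -[leLHS]expR0 ler_expR mulr_ge0 ?nrm1_ge0 ?addr_ge0.
  rewrite /edom (le_trans e1) // ler_peMl ?expR_ge0 //; lra.
have K0' : 0 <= K + 1 by lra.
exists (K + 1) => //; split => [x|j h x].
  by apply: le_trans (cK x) _; rewrite ler_edom //; lra.
rewrite /shift1 !mxE eqxx /= addrK normrM.
apply: (@le_trans _ _ (`|h| * 1)).
  by rewrite ler_wpM2l //; case: eqP; rewrite ?normr1 ?normr0.
rewrite ler_wpM2l //; apply: le_trans (K1 x) _; rewrite lerDl; exact: edom_ge0.
Qed.

Lemma explipD u v : explip u -> explip v -> explip (fun x => u x + v x).
Proof.
move=> eu ev; split.
  case: eu => cu _; case: ev => cv _ x.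
  have c1 : u y @[y --> x] --> u x by exact: cu.
  have c2 : v y @[y --> x] --> v x by exact: cv.
  exact: (cvgD c1 c2).
have [K K0 [uK vK u2 v2]] := explip_common eu ev.
exists (K + K); first exact: addr_ge0.
split => [x|i h x].
  by apply: le_trans (ler_normD _ _) _; apply: le_trans (edomD x K0 K0); rewrite lerD.
rewrite opprD addrACA; apply: le_trans (ler_normD _ _) _.
apply: le_trans (lerD (u2 i h x) (v2 i h x)) _.
rewrite -mulrDr ler_wpM2l // addrACA lerD //; exact: edomD.
Qed.

Lemma explipM u v : explip u -> explip v -> explip (fun x => u x * v x).
Proof.
move=> eu ev; split.
  case: eu => cu _; case: ev => cv _ x.
  have c1 : u y @[y --> x] --> u x by exact: cu.
  have c2 : v y @[y --> x] --> v x by exact: cv.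
  exact: (cvgM c1 c2).
have [K K0 [uK vK u2 v2]] := explip_common eu ev.
pose K2 := K * K + (K + K).
have K20 : 0 <= K2 by rewrite !addr_ge0 ?mulr_ge0.
have sq x : edom K x * edom K x <= edom K2 x by exact: edomM.
exists (K2 + K2); first exact: addr_ge0.
split => [x|i h x].
  rewrite normrM; apply: le_trans (ler_edom x K20 _); last by rewrite lerDl.
  by apply: le_trans (sq x); rewrite ler_pM.
set y := shift1 i h x.
have -> : u y * v y - u x * v x = u y * (v y - v x) + (u y - u x) * v x by ring.
apply: le_trans (ler_normD _ _) _; rewrite !normrM.
have a0 := edom_ge0 x K0; have b0 := edom_ge0 y K0.
apply: (@le_trans _ _ (edom K y * (`|h| * (edom K x + edom K y)) +
   (`|h| * (edom K x + edom K y)) * edom K x)).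
  by apply: lerD; apply: ler_pM => //; [exact: v2|exact: u2].
(* The two terms add up to |h| (edom K x + edom K y)^2, and (a + b)^2 <= 2 a^2 + 2 b^2 separates x
   from y. *)
apply: (@le_trans _ _ (`|h| * ((edom K x * edom K x + edom K x * edom K x) +
   (edom K y * edom K y + edom K y * edom K y)))).
  have -> : edom K y * (`|h| * (edom K x + edom K y)) +
    `|h| * (edom K x + edom K y) * edom K x = `|h| * (edom K x + edom K y) ^+ 2 by ring.
  rewrite ler_wpM2l //; have := sqr_ge0 (edom K x - edom K y); rewrite !expr2; lra.
rewrite ler_wpM2l // lerD //.
  by apply: le_trans (edomD x K20 K20); rewrite lerD.
by apply: le_trans (edomD y K20 K20); rewrite lerD.
Qed.

Lemma explipZ c u : explip u -> explip (fun x => c * u x).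
Proof. by move=> eu; apply: explipM => //; exact: explip_cst. Qed.

Lemma explipB u v : explip u -> explip v -> explip (fun x => u x - v x).
Proof.
move=> eu ev; under eq_fun do rewrite -mulN1r.
by apply: explipD => //; exact: explipZ.
Qed.

Lemma explip_sum (I : Type) (r : seq I) (P : pred I) (u : I -> rV -> R) :
  (forall i, P i -> explip (u i)) -> explip (fun x => \sum_(i <- r | P i) u i x).
Proof.
move=> tF; elim: r => [|i r IH].
  by under eq_fun do rewrite big_nil; exact: explip_cst.
under eq_fun do rewrite big_cons.
by case Pi: (P i) => //; apply: explipD => //; exact: tF.
Qed.

Lemma enorm_ge0 (x : rV) : 0 <= enorm x. Proof. exact: sqrtr_ge0. Qed.

Lemma enormE2 (x : rV) : enorm x ^+ 2 = \sum_i x 0 i ^+ 2.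
Proof. by rewrite /enorm sqr_sqrtr // sumr_ge0 // => i _; exact: sqr_ge0. Qed.

Lemma ler_coord_enorm (x : rV) i : `|x 0 i| <= enorm x.
Proof.
rewrite -[`|_|]sqrtr_sqr ler_wsqrtr // (bigD1 i) //= lerDl sumr_ge0 // => j _.
exact: sqr_ge0.
Qed.

Lemma enorm_le_nrm1 x : enorm x <= nrm1 x.
Proof.
rewrite -(ger0_norm (nrm1_ge0 x)) -sqrtr_sqr ler_wsqrtr //.
rewrite expr2 {1}/nrm1 mulr_suml ler_sum // => i _.
by rewrite -real_normK ?num_real // expr2 ler_wpM2l // ler_coord_nrm1.
Qed.

Lemma explip_lipschitz u : (forall x y, `|u x - u y| <= enorm (x - y)) -> explip u.
Proof.
move=> lu; split.
  move=> x A /nbhs_ballP[e /= e0 eA]; change (nbhs x (u @^-1` A)).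
  (* The l1 norm is at most n times the sup norm; dividing by [n.+1] rather than n gives a strict
     bound and covers n = 0. *)
  have n0 : (0 : R) < n.+1%:R^-1 * e by rewrite mulr_gt0 ?invr_gt0.
  apply/nbhs_ballP; exists (n.+1%:R^-1 * e) => // y [_ xy].
  apply: eA; rewrite /ball /= (le_lt_trans (lu _ _)) // (le_lt_trans (enorm_le_nrm1 _)) //.
  apply: (@le_lt_trans _ _ (\sum_(i < n) n.+1%:R^-1 * e)).
    apply: ler_sum => i _; rewrite !mxE; apply: ltW; exact: xy.
  rewrite sumr_const card_ord (_ : _ *+ n = n%:R / n.+1%:R * e); last first.
    by rewrite -[LHS]mulr_natl mulrA.
  rewrite -[ltRHS]mul1r ltr_pM2r //.
  by rewrite ltr_pdivrMr // mul1r ltr_nat.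
have n1 x : nrm1 x <= edom 1 x.
  by rewrite /edom !mul1r; apply: le_trans (expR_ge1Dx _); rewrite lerDr.
have [_ [K K0 cK]] := tame_cst (n := n) (u 0).
have K0' : 0 <= K + 1 by lra.
have K1 x : 1 <= edom (K + 1) x.
  have e1 : 1 <= expR ((K + 1) * nrm1 x).
    by rewrite -[leLHS]expR0 ler_expR mulr_ge0 ?nrm1_ge0.
  rewrite /edom (le_trans e1) // ler_peMl ?expR_ge0 //; lra.
exists (K + 1) => //; split => [x|i h x].
  apply: le_trans (edomD x K0 ler01); rewrite -[u x](subrK (u 0)) addrC.
  apply: le_trans (ler_normD _ _) _; apply: lerD => //.
  by rewrite (le_trans (lu _ _)) // subr0 (le_trans (enorm_le_nrm1 _)).
apply: le_trans (lu _ _) _; rewrite /shift1 addrK.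
apply: (@le_trans _ _ (`|h| * 1)).
  have c j : (h *: delta_mx 0 i : rV) 0 j = if j == i then h else 0.
    by rewrite !mxE eqxx /=; case: eqP => _; rewrite ?mulr1 ?mulr0.
  rewrite mulr1 /enorm (bigD1 i) //= c eqxx big1 ?addr0 ?sqrtr_sqr //.
  by move=> j /negbTE ji; rewrite c ji expr0n.
rewrite ler_wpM2l //; apply: le_trans (K1 x) _; rewrite lerDl; exact: edom_ge0.
Qed.

Lemma shift1_upd i h x : shift1 i h x = upd i (x 0 i + h) x.
Proof. exact: upd_shift. Qed.

Lemma shift1_upd_upd i h t x : shift1 i h (upd i t x) = upd i (t + h) x.
Proof. by rewrite shift1_upd updE eqxx upd_upd. Qed.

Lemma explip_section u i x : explip u -> locally_lipschitz (fun t => u (upd i t x)).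
Proof.
move=> [_ [K K0 [_ u2]]] M; pose M' := Num.max M 0.
exists (2 * (K * expR (K * (M' + nrm1 x)))) => a b Ma ab bM.
have -> : upd i b x = shift1 i (b - a) (upd i a x).
  by rewrite shift1_upd_upd addrC subrK.
apply: le_trans (u2 _ _ _) _; rewrite ger0_norm ?subr_ge0 // mulrC.
rewrite ler_wpM2r ?subr_ge0 // shift1_upd_upd (addrC a) subrK.
have e t : - M <= t <= M -> edom K (upd i t x) <= K * expR (K * (M' + nrm1 x)).
  move=> tM; rewrite /edom ler_wpM2l // ler_expR ler_wpM2l //.
  apply: le_trans (nrm1_upd _ _ _) _; rewrite lerD2r /M' le_max ler_norml tM //.
have := e a; have := e b; rewrite Ma bM (le_trans ab bM) (le_trans Ma ab) /=.
by move=> /(_ isT) ? /(_ isT) ?; lra.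
Qed.

Lemma derivable_section u i t x :
  derivable (fun t => u (upd i t x)) t 1 <-> derivable u (upd i t x) (delta_mx 0 i).
Proof.
rewrite /derivable.
have -> : (fun h : R => h^-1 *: (((fun t => u (upd i t x)) \o shift t) (h *: (1 : R)) - u (upd i t x))) =
  (fun h : R => h^-1 *: ((u \o shift (upd i t x)) (h *: delta_mx 0 i) - u (upd i t x))).
  apply/funext => h /=; congr (_ *: (u _ - _)).
  by rewrite -/(shift1 i h _) shift1_upd_upd /GRing.scale /= mulr1 addrC.
by [].
Qed.

Lemma derive_section u i t x :
  'D_1 (fun t => u (upd i t x)) t = partial i u (upd i t x).
Proof.
rewrite /partial /derive.
have -> : (fun h : R => h^-1 *: (((fun t => u (upd i t x)) \o shift t) (h *: (1 : R)) - u (upd i t x))) =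
  (fun h : R => h^-1 *: ((u \o shift (upd i t x)) (h *: delta_mx 0 i) - u (upd i t x))).
  apply/funext => h /=; congr (_ *: (u _ - _)).
  by rewrite -/(shift1 i h _) shift1_upd_upd /GRing.scale /= mulr1 addrC.
by [].
Qed.

Lemma measurable_partial i u : explip u -> measurable_fun setT (partial i u).
Proof. by move=> [cu _]; exact: measurable_derive. Qed.

Lemma partial_cvg u i x (h : nat -> R) : derivable u x (delta_mx 0 i) ->
  (forall m, h m != 0) -> h @ \oo --> 0 ->
  (h m)^-1 * (u (shift1 i (h m) x) - u x) @[m --> \oo] --> partial i u x.
Proof. exact: derivable_cvg_seq. Qed.

Definition hseq (m : nat) : R := m.+1%:R^-1.

Lemma hseq_gt0 m : 0 < hseq m. Proof. by rewrite invr_gt0. Qed.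

Lemma hseq_le1 m : hseq m <= 1.
Proof. by rewrite invf_le1 // ler1n. Qed.

Lemma hseq_cvg : hseq @ \oo --> 0. Proof. exact: cvg_harmonic. Qed.

Lemma quotient_bound u : explip u -> exists2 K, 0 <= K &
  forall i h x, h != 0 -> `|h| <= 1 ->
  `|h^-1 * (u (shift1 i h x) - u x)| <= edom K x.
Proof.
(* The second summand handles [edom K] at the shifted point, by [edom_shift] with |h| <= 1. *)
move=> [_ [K K0 [_ u2]]]; exists (K + K * expR K).
  by rewrite addr_ge0 ?mulr_ge0 ?expR_ge0.
have KK0 : 0 <= K * expR K by rewrite mulr_ge0 ?expR_ge0.
move=> i h x h0 h1; rewrite normrM normfV ler_pdivrMl ?normr_gt0 //.
apply: le_trans (u2 i h x) _; rewrite ler_wpM2l //.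
apply: le_trans (edomD x K0 KK0); rewrite lerD2l.
apply: le_trans (edom_shift i h x K0) _; rewrite ler_edom //.
  by rewrite mulr_ge0 ?expR_ge0.
by rewrite ler_wpM2l // ler_expR -[leRHS]mulr1 ler_wpM2l.
Qed.

(* Where the partial derivative does not exist, 'D is the junk value point. *)
Lemma partial_norm_le u i x C : 0 <= C ->
  (forall m, `|(hseq m)^-1 * (u (shift1 i (hseq m) x) - u x)| <= C) ->
  `|partial i u x| <= C + `|point : R|.
Proof.
move=> C0 uC; have [du|nd] := pselect (derivable u x (delta_mx 0 i)); last first.
  have -> : partial i u x = point.
    by rewrite /partial /derive; apply: getPN => l /= ul; apply: nd; apply/cvg_ex; exists l.
  by rewrite lerDr.
apply: (@le_trans _ _ C); last by rewrite lerDl.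
have hn0 m : hseq m != 0 by rewrite gt_eqF ?hseq_gt0.
have h' := cvg_norm (partial_cvg du hn0 hseq_cvg) _.
rewrite -(cvg_lim (@Rhausdorff R) (h' _)).
by apply: limr_le; [apply/cvg_ex; eexists; exact: h'|exact: nearW].
Qed.

Lemma tame_partial i u : explip u -> tame (partial i u).
Proof.
move=> eu; have [K K0 uK] := quotient_bound eu.
apply: (tame_le (measurable_partial i eu) (tameD (tame_edom K0) (tame_cst `|point : R|))) => x.
rewrite [leRHS]ger0_norm ?addr_ge0 ?edom_ge0 //; apply: partial_norm_le => [|m].
  exact: edom_ge0.
apply: uK; first by rewrite gt_eqF ?hseq_gt0.
by rewrite ger0_norm ?hseq_le1 // ltW ?hseq_gt0.
Qed.

Variables (s : R) (s0 : 0 < s) (Q : probability rV R).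
Hypothesis gQ : gaussian s Q.

(** On each line in direction i the section is locally Lipschitz, so the bad points are
    Lebesgue-null and hence null for the normal law. Resampling coordinate i assembles the lines. *)
Lemma explip_derivable_ae i u : explip u ->
  {ae Q, forall x, derivable u x (delta_mx 0 i)}.
Proof.
move=> eu; exists (~` [set x | derivable u x (delta_mx 0 i)]).
have mD : measurable (~` [set x | derivable u x (delta_mx 0 i)]).
  by apply: measurableC; apply: measurable_derivable; case: eu.
split => //; apply: (ae_resample gQ (i := i)) => // x.
have [A [mA A0 Asub]] := locally_lipschitz_derivable (explip_section i x eu).
exists A; split; first exact: mA.
  exact: ((null_content_dominatesP _ _).1 (@normal_prob_dominates R 0 s)).
move=> t /= nd; apply: Asub => /= dt; apply: nd; exact/derivable_section.
Qed.

End explip.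

(** * First and second order Stein formulas *)

Section stein.
Context {R : realType} {n : nat}.
Notation rV := 'rV[R]_n.
Implicit Types (F G u v : rV -> R) (x : rV).
Variables (s : R) (s0 : 0 < s) (Q : probability rV R).
Hypothesis gQ : gaussian s Q.
Notation Ex F := (\int[Q]_x F x).

(** Bundles what dominated convergence requires in a form stable under sums and products, since the
    limits below are of products of quotients, adjoints and densities. *)
Definition dominated_cvg (F_ : nat -> rV -> R) F :=
  [/\ forall m, measurable_fun setT (F_ m), measurable_fun setT F,
      exists2 G, tame G & forall m x, `|F_ m x| <= G x &
      {ae Q, forall x, F_ m x @[m --> \oo] --> F x}].

Lemma dominated_Ex (F_ : nat -> rV -> R) F : dominated_cvg F_ F -> Ex (F_ m) @[m --> \oo] --> Ex F.
Proof. by move=> [mF_ mF [G tG FG] FF]; exact: (Ex_cvg s0 gQ mF_ mF tG FG FF). Qed.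

Lemma dominated_cvgM (F_ : nat -> rV -> R) F (G_ : nat -> rV -> R) G : dominated_cvg F_ F -> dominated_cvg G_ G ->
  dominated_cvg (fun m x => F_ m x * G_ m x) (fun x => F x * G x).
Proof.
move=> [mF_ mF [B tB FB] FF] [mG_ mG [C tC GC] GG]; split.
- by move=> m; exact: measurable_funM.
- exact: measurable_funM.
- exists (fun x => B x * C x); first exact: tameM.
  by move=> m x; rewrite normrM ler_pM.
- by move: FF GG; apply: filterS2 => x h1 h2; exact: cvgM.
Qed.

Lemma dominated_cvgD (F_ : nat -> rV -> R) F (G_ : nat -> rV -> R) G : dominated_cvg F_ F -> dominated_cvg G_ G ->
  dominated_cvg (fun m x => F_ m x + G_ m x) (fun x => F x + G x).
Proof.
move=> [mF_ mF [B tB FB] FF] [mG_ mG [C tC GC] GG]; split.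
- by move=> m; exact: measurable_funD.
- exact: measurable_funD.
- exists (fun x => B x + C x); first exact: tameD.
  by move=> m x; apply: le_trans (ler_normD _ _) _; rewrite lerD.
- by move: FF GG; apply: filterS2 => x h1 h2; exact: cvgD.
Qed.

Lemma dominated_cvg_cst F : tame F -> dominated_cvg (fun=> F) F.
Proof.
move=> tF; case: (tF) => mF _; split => //.
- by exists (fun x => `|F x|) => //; exact: tame_norm.
- by apply: aeW => x; exact: cvg_cst.
Qed.

(* cm i h is the Cameron-Martin density of the translation by h along coordinate
   i, and adj i h is the adjoint of the difference quotient quot i h in L^2(Q).
   As h tends to 0, s ^+ 2 * adj i h tends to delta i. *)
Definition quot i h u x := h^-1 * (u (shift1 i h x) - u x).
Definition cm i h x := expR ((h * x 0 i - h ^+ 2 / 2) / s ^+ 2).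
Definition adj i h u x := h^-1 * (u (shift1 i (- h) x) * cm i h x - u x).
Definition delta i u x := x 0 i * u x - s ^+ 2 * partial i u x.

Lemma tame_cm i h : tame (cm i h).
Proof.
have := tame_exp i (h / s ^+ 2) (- (h ^+ 2 / 2) / s ^+ 2).
by under eq_fun do rewrite mulrAC -mulrDl.
Qed.

Lemma shift1D i h h' x : shift1 i h (shift1 i h' x) = shift1 i (h + h') x.
Proof. by rewrite /shift1 addrA -scalerDl. Qed.

Lemma shift1_0 i x : shift1 i 0 x = x.
Proof. by rewrite /shift1 scale0r add0r. Qed.

Lemma shift1C i j h h' x : shift1 i h (shift1 j h' x) = shift1 j h' (shift1 i h x).
Proof. by rewrite /shift1 addrCA. Qed.

Lemma tame_quot i h u : tame u -> tame (quot i h u).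
Proof. by move=> tu; apply: tameZ; apply: tameB => //; exact: tame_shift. Qed.

Lemma tame_adj i h u : tame u -> tame (adj i h u).
Proof.
move=> tu; apply: tameZ; apply: tameB => //; apply: tameM; last exact: tame_cm.
exact: tame_shift.
Qed.

(** Cameron-Martin for the function u(x) v(x - h e_i), whose translate by h is u(x + h e_i) v(x). *)
Lemma Ex_adj i h u v : tame u -> tame v ->
  Ex (fun x => quot i h u x * v x) = Ex (fun x => u x * adj i h v x).
Proof.
move=> tu tv; rewrite /quot /adj.
pose F x := u x * v (shift1 i (- h) x).
have tF : tame F by apply: tameM => //; exact: tame_shift.
have FE x : u (shift1 i h x) * v x = F (shift1 i h x).
  by rewrite /F shift1D addNr shift1_0.
under eq_Rintegral do rewrite -mulrA mulrBl FE.
under [RHS]eq_Rintegral do rewrite mulrCA mulrBr mulrA.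
have tuv : tame (fun x => u x * v x) by exact: tameM.
have tFh : tame (fun x => F (shift1 i h x)) by exact: tame_shift.
have tFc : tame (fun x => F x * cm i h x) by apply: tameM => //; exact: tame_cm.
rewrite (ExZ s0 gQ); last exact: tameB.
rewrite (ExZ s0 gQ); last exact: tameB.
rewrite (ExB s0 gQ) // (ExB s0 gQ) //; congr (_ * (_ - _)).
exact: Ex_shift.
Qed.

Lemma cm_shift1 i j h x :
  cm j h (shift1 i h x) = cm j h x * expR ((i == j)%:R * h ^+ 2 / s ^+ 2).
Proof.
rewrite /cm -expRD -mulrDl /shift1 !mxE eqxx /= eq_sym.
move: (x 0 j) ((i == j)%:R) => y b.
by have -> : h * (h * b + y) - h ^+ 2 / 2 = h * y - h ^+ 2 / 2 + b * h ^+ 2 by ring.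
Qed.

(* The commutation relation behind the second order formula. *)
Lemma quot_adj i j h v x : h != 0 -> quot i h (adj j h v) x =
  adj j h (quot i h v) x +
  (i == j)%:R * (h ^+ 2)^-1 * (expR (h ^+ 2 / s ^+ 2) - 1) * (v x * cm j h x).
Proof.
move=> h0; rewrite /quot /adj cm_shift1 [shift1 i h (shift1 j _ _)]shift1C.
have [->|ij] := eqVneq i j.
  rewrite shift1D addNr shift1_0 mul1r /=; field.
  exact: h0.
by rewrite mul0r mul0r expR0 /=; ring.
Qed.

(** Move [adj i] onto the other factor as a quotient, commute that quotient past [adj j], and move
    [adj j] back. The commutator leaves the Kronecker term. *)
Lemma Ex_adj_adj i j h u v : h != 0 -> tame u -> tame v ->
  Ex (fun x => adj i h u x * adj j h v x) =
  Ex (fun x => quot j h u x * quot i h v x) +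
  (i == j)%:R * ((h ^+ 2)^-1 * (expR (h ^+ 2 / s ^+ 2) - 1)) * Ex (fun x => u x * v x * cm j h x).
Proof.
move=> h0 tu tv.
have tuvc : tame (fun x => u x * v x * cm j h x).
  by apply: tameM; [exact: tameM|exact: tame_cm].
under eq_Rintegral do rewrite mulrC.
rewrite -Ex_adj; [|exact: tame_adj|by []].
under eq_Rintegral do rewrite quot_adj // mulrDl.
rewrite (ExD s0 gQ); last 2 first.
- by apply: tameM => //; apply: tame_adj; exact: tame_quot.
- by apply: tameM => //; apply: tameZ; apply: tameM => //; exact: tame_cm.
congr (_ + _).
  under eq_Rintegral do rewrite mulrC.
  by rewrite -Ex_adj //; exact: tame_quot.
rewrite -(ExZ s0 gQ) //; apply: eq_Rintegral => x _; ring.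
Qed.

Lemma hseq_neq0 m : hseq m != 0 :> R.
Proof. by rewrite gt_eqF ?hseq_gt0. Qed.

Lemma quot_dominated i u : explip u ->
  dominated_cvg (fun m => quot i (hseq m) u) (partial i u).
Proof.
move=> eu; have tu := explip_tame eu; split.
- by move=> m; have [] := tame_quot i (hseq m) tu.
- exact: measurable_partial.
- have [K K0 uK] := quotient_bound eu; exists (edom K); first exact: tame_edom.
  move=> m x; apply: uK; first exact: hseq_neq0.
  by rewrite ger0_norm ?hseq_le1 // ltW ?hseq_gt0.
- move: (explip_derivable_ae gQ i eu); apply: filterS => x du.
  exact: (partial_cvg du hseq_neq0 hseq_cvg).
Qed.

Lemma quotN_dominated i u : explip u ->
  dominated_cvg (fun m => quot i (- hseq m) u) (partial i u).
Proof.
move=> eu; have tu := explip_tame eu; split.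
- by move=> m; have [] := tame_quot i (- hseq m) tu.
- exact: measurable_partial.
- have [K K0 uK] := quotient_bound eu; exists (edom K); first exact: tame_edom.
  move=> m x; apply: uK; first by rewrite oppr_eq0 hseq_neq0.
  by rewrite normrN ger0_norm ?hseq_le1 // ltW ?hseq_gt0.
- move: (explip_derivable_ae gQ i eu); apply: filterS => x du.
  apply: (@partial_cvg _ _ _ _ _ (fun m => - hseq m) du).
    by move=> m; rewrite oppr_eq0 hseq_neq0.
  by rewrite -oppr0; apply: cvgN; exact: hseq_cvg.
Qed.

(** A bound on [cm i h] uniform in 0 < h <= 1, used for domination as h tends to 0. *)
Let cmB i x : R := expR ((`|x 0 i| + 1) / s ^+ 2).

Let tame_cmB i : tame (cmB i).
Proof.
apply: (@tame_le _ _ _ (fun x => expR (s ^- 2 * x 0 i + s ^- 2) +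
   expR (- s ^- 2 * x 0 i + s ^- 2))).
- apply: measurableT_comp => //; apply: measurable_funM => //.
  by apply: measurable_funD => //; apply: measurableT_comp => //; exact: measurable_coord.
- by apply: tameD; exact: tame_exp.
- move=> x; rewrite !ger0_norm ?addr_ge0 ?expR_ge0 // /cmB.
  have := expR_ge0 (s ^- 2 * x 0 i + s ^- 2).
  have := expR_ge0 (- s ^- 2 * x 0 i + s ^- 2).
  rewrite mulrDl mul1r (mulrC `|x 0 i|).
  by case: (ger0P (x 0 i)) => _; rewrite ?mulrN ?mulNr; move: (expR _) (expR _) => ? ?; lra.
Qed.

Let cm_exponent i h x : 0 < h -> h <= 1 ->
  `|(h * x 0 i - h ^+ 2 / 2) / s ^+ 2| <= h * ((`|x 0 i| + 1) / s ^+ 2).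
Proof.
move=> h0 h1; rewrite normrM (ger0_norm (_ : 0 <= s ^- 2)) ?invr_ge0 ?sqr_ge0 //.
rewrite mulrA ler_wpM2r ?invr_ge0 ?sqr_ge0 // (le_trans (ler_normB _ _)) //.
rewrite normrM (gtr0_norm h0) mulrDr lerD2l ger0_norm ?divr_ge0 ?sqr_ge0 //.
by have := sqr_ge0 h; rewrite expr2 mulr1; nra.
Qed.

(** Both signs follow from 1 + a <= exp a, used at a and at - a. *)
Let expR_sub1_le (a : R) : `|expR a - 1| <= `|a| * expR `|a|.
Proof.
have h1 := expR_ge1Dx a; have h2 := expR_ge1Dx (- a).
have ea : expR a * expR (- a) = 1 by rewrite expRxMexpNx_1.
have a0 := expR_gt0 a; have a1 := expR_gt0 (- a).
have [a_ge0|a_lt0] := ger0P a.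
  rewrite ler_norml; apply/andP; split; last by nra.
  by rewrite (@le_trans _ _ 0) ?oppr_le0 ?mulr_ge0 ?expR_ge0 //; lra.
have e1 : 1 <= expR (- a) by lra.
rewrite ler_norml; apply/andP; split; first by nra.
nra.
Qed.

Let cm_cvg i x : (hseq m)^-1 * (cm i (hseq m) x - 1) @[m --> \oo] --> x 0 i / s ^+ 2.
Proof.
pose q (h : R) := (h * x 0 i - h ^+ 2 / 2) / s ^+ 2.
have dq : is_derive (0 : R) (1 : R) q (x 0 i / s ^+ 2).
  have -> : q = (fun h => (x 0 i / s ^+ 2) * h + (- (2 * s ^+ 2)^-1) * h ^+ 2).
    by apply/funext => h; rewrite /q; field; rewrite gt_eqF.
  by apply: is_derive_eq; rewrite !scale0r addr0 scaler0 addr0 /GRing.scale /= mulr1.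
have q0 : q 0 = 0 by rewrite /q mul0r expr0n /= mul0r subr0 mul0r.
have d2 := @is_derive1_comp _ expR q 0 _ _ (is_derive_expR (q 0)) dq.
rewrite q0 expR0 mul1r in d2.
have := derivable_cvg_seq (@ex_derive _ _ _ _ _ _ _ d2) hseq_neq0 hseq_cvg.
rewrite (@derive_val _ _ _ _ _ _ _ d2) /= q0 expR0.
by under eq_fun do rewrite /GRing.scale /= mulr1 addr0.
Qed.

Lemma cm_quot_dominated i :
  dominated_cvg (fun m x => (hseq m)^-1 * (cm i (hseq m) x - 1)) (fun x => x 0 i / s ^+ 2).
Proof.
have mc m : measurable_fun setT (cm i (hseq m)) by have [] := tame_cm i (hseq m).
split.
- by move=> m; apply: measurable_funM => //; exact: measurable_funB.
- by apply: measurable_funM => //; exact: measurable_coord.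
- exists (fun x => (`|x 0 i| + 1) / s ^+ 2 * cmB i x).
    apply: tameM => //.
    have := tameZ (s ^- 2) (tameD (tame_norm (tame_coord i)) (tame_cst 1)).
    by under eq_fun do rewrite mulrC.
  move=> m x; have e := cm_exponent i x (hseq_gt0 m) (hseq_le1 m).
  have b0 : 0 <= (`|x 0 i| + 1) / s ^+ 2 by rewrite divr_ge0 ?sqr_ge0 ?addr_ge0.
  rewrite normrM normfV (gtr0_norm (hseq_gt0 m)) ler_pdivrMl ?hseq_gt0 //.
  apply: le_trans (expR_sub1_le _) _; rewrite mulrA ler_pM ?expR_ge0 //.
  rewrite /cmB ler_expR; apply: le_trans e _.
  by rewrite ler_piMl // hseq_le1.
- by apply: aeW => x; exact: cm_cvg.
Qed.

Lemma cm_dominated i : dominated_cvg (fun m => cm i (hseq m)) (fun=> 1).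
Proof.
split.
- by move=> m; have [] := tame_cm i (hseq m).
- exact: measurable_cst.
- exists (cmB i) => // m x; rewrite ger0_norm ?expR_ge0 // /cm /cmB ler_expR.
  have e := cm_exponent i x (hseq_gt0 m) (hseq_le1 m).
  apply: le_trans (ler_norm _) _; apply: le_trans e _.
  by rewrite ler_piMl ?hseq_le1 // divr_ge0 ?sqr_ge0 ?addr_ge0.
- apply: aeW => x.
  have h1 := cvgM (@hseq_cvg R) (@cm_cvg i x).
  have h := cvgD (h1 _) (@cvg_cst _ (1 : R) _ \oo _).
  have -> : (fun m => cm i (hseq m) x) =
      (fun m => hseq m * ((hseq m)^-1 * (cm i (hseq m) x - 1)) + 1).
    by apply/funext => m; rewrite mulrA divff ?hseq_neq0 // mul1r subrK.
  by rewrite -[X in _ --> X]add0r -[X in _ --> X + _](mul0r (x 0 i / s ^+ 2)); exact: h.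
Qed.

(** A discrete product rule: minus the backward quotient of u times the density, plus u times the
    quotient of the density. The limits are - [partial i u] and x_i u / s^2. *)
Lemma adj_dominated i u : explip u ->
  dominated_cvg (fun m => adj i (hseq m) u) (fun x => s ^- 2 * delta i u x).
Proof.
move=> eu; have tu := explip_tame eu.
have h := dominated_cvgD
  (dominated_cvgM (dominated_cvgM (dominated_cvg_cst (tame_cst (-1))) (quotN_dominated i eu)) (cm_dominated i))
  (dominated_cvgM (dominated_cvg_cst tu) (cm_quot_dominated i)).
have -> : (fun x => s ^- 2 * delta i u x) =
    (fun x => -1 * partial i u x * 1 + u x * (x 0 i / s ^+ 2)).
  by apply/funext => x; rewrite /delta; field; rewrite gt_eqF.
have -> : (fun m => adj i (hseq m) u) = (fun m x => -1 * quot i (- hseq m) u x * cm i (hseq m) x +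
     u x * ((hseq m)^-1 * (cm i (hseq m) x - 1))).
  apply/funext => m; apply/funext => x; rewrite /adj /quot; field.
  exact: hseq_neq0.
exact: h.
Qed.

Lemma tame_delta i u : explip u -> tame (delta i u).
Proof.
move=> eu; apply: tameB; last by apply: tameZ; exact: tame_partial.
by apply: tameM; [exact: tame_coord|exact: explip_tame].
Qed.

Lemma stein i u v : explip u -> explip v ->
  Ex (fun x => delta i u x * v x) = s ^+ 2 * Ex (fun x => u x * partial i v x).
Proof.
move=> eu ev; have tu := explip_tame eu; have tv := explip_tame ev.
have h1 := dominated_Ex (dominated_cvgM (quot_dominated i ev) (dominated_cvg_cst tu)).
have h2 := dominated_Ex (dominated_cvgM (dominated_cvg_cst tv) (adj_dominated i eu)).
have E : (fun m => Ex (fun x => quot i (hseq m) v x * u x)) =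
    (fun m => Ex (fun x => v x * adj i (hseq m) u x)).
  by apply/funext => m; exact: Ex_adj.
rewrite E in h1.
have := cvg_unique (@Rhausdorff R) h1 h2 => /(_ _).
under eq_Rintegral do rewrite mulrC.
under [in X in _ = X -> _]eq_Rintegral do rewrite mulrCA (mulrC (v _)).
move=> ->; rewrite (ExZ s0 gQ); last by apply: tameM => //; exact: tame_delta.
by rewrite mulrA divff ?mul1r // expf_neq0 // gt_eqF.
Qed.

(** The limit of [Ex_adj_adj]. At the discrete level every term is a product of first order
    quotients, so u and v may be merely Lipschitz. *)
Lemma second_order_stein i j u v : explip u -> explip v ->
  Ex (fun x => delta i u x * delta j v x) =
  (i == j)%:R * s ^+ 2 * Ex (fun x => u x * v x) +
  s ^+ 4 * Ex (fun x => partial j u x * partial i v x).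
Proof.
move=> eu ev; have tu := explip_tame eu; have tv := explip_tame ev.
have h1 := dominated_Ex (dominated_cvgM (adj_dominated i eu) (adj_dominated j ev)).
have h2 := dominated_Ex (dominated_cvgM (quot_dominated j eu) (quot_dominated i ev)).
have h3 := dominated_Ex (dominated_cvgM (dominated_cvg_cst (tameM tu tv)) (cm_dominated j)).
(* The commutator coefficient, by (exp a - 1) / a -> 1 at a = h^2 / s^2. *)
have hs : ((hseq m : R) ^+ 2)^-1 * (expR (hseq m ^+ 2 / s ^+ 2) - 1) @[m --> \oo] --> s ^- 2.
  pose a m : R := hseq m ^+ 2 / s ^+ 2.
  have a0 m : a m != 0 by rewrite mulf_neq0 ?invr_eq0 ?expf_neq0 ?hseq_neq0 // gt_eqF.
  have ac : a @ \oo --> 0.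
    have := cvgM (cvgM (@hseq_cvg R) (@hseq_cvg R)) (@cvg_cst _ (s ^- 2) _ \oo _).
    by rewrite !mul0r; apply.
  have := derivable_cvg_seq (@ex_derive _ _ _ _ _ _ _ (is_derive_expR (0 : R))) a0 ac.
  rewrite (@derive_val _ _ _ _ _ _ _ (is_derive_expR (0 : R))) expR0 => h.
  have := cvgM h (@cvg_cst _ (s ^- 2) _ \oo _); rewrite mul1r.
  have -> : (fun m => ((hseq m : R) ^+ 2)^-1 * (expR (hseq m ^+ 2 / s ^+ 2) - 1)) =
      (fun m => (a m)^-1 * (expR (a m + 0) - 1) * s ^- 2).
    by apply/funext => m; rewrite addr0 /a; field; rewrite hseq_neq0 gt_eqF.
  have e1 : (fun m => (a m)^-1 *: (expR ((a m)%:A + 0) - 1)) =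
     (fun m => (a m)^-1 * (expR (a m + 0) - 1)).
    by apply/funext => m; rewrite /GRing.scale /= mulr1.
  by rewrite e1; apply.
have h4 := cvgD h2 (cvgM (cvgM (@cvg_cst _ ((i == j)%:R : R) _ \oo _) hs) h3).
have E : (fun m => Ex (fun x => adj i (hseq m) u x * adj j (hseq m) v x)) =
    (fun m => Ex (fun x => quot j (hseq m) u x * quot i (hseq m) v x) +
      (i == j)%:R * ((hseq m ^+ 2)^-1 * (expR (hseq m ^+ 2 / s ^+ 2) - 1)) *
      Ex (fun x => u x * v x * cm j (hseq m) x)).
  by apply/funext => m; apply: Ex_adj_adj => //; exact: hseq_neq0.
rewrite E in h1.
have : Ex (fun x => s ^- 2 * delta i u x * (s ^- 2 * delta j v x)) =
    Ex (fun x => partial j u x * partial i v x) +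
    (i == j)%:R / s ^+ 2 * Ex (fun x => u x * v x * 1).
  by apply: (cvg_unique (@Rhausdorff R) h1); exact: h4.
under eq_Rintegral do rewrite mulrACA.
rewrite (ExZ s0 gQ); last by apply: tameM; exact: tame_delta.
have -> : Ex (fun x => u x * v x * 1) = Ex (fun x => u x * v x).
  by apply: eq_Rintegral => x _; rewrite mulr1.
set a := Ex (fun x => delta i u x * delta j v x).
set b := Ex (fun x => partial j u x * partial i v x).
set c := Ex (fun x => u x * v x).
move: a b c ((i == j)%:R) => a b c k h.
have -> : a = s ^+ 4 * (s ^- 2 / s ^+ 2 * a) by field; rewrite gt_eqF.
by rewrite h; field; rewrite gt_eqF.
Qed.

End stein.

(** * Efron-Stein and Poincare inequalities *)

Section real_integrable.
Context d (T : measurableType d) (R : realType) (mu : {measure set T -> \bar R}).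
Implicit Types f g : T -> R.

Lemma integrable_realD f g : mu.-integrable setT (EFin \o f) ->
  mu.-integrable setT (EFin \o g) -> mu.-integrable setT (EFin \o (fun x => f x + g x)).
Proof. by move=> fi gi; exact: (integrableD measurableT fi gi). Qed.

Lemma integrable_realZ c f : mu.-integrable setT (EFin \o f) ->
  mu.-integrable setT (EFin \o (fun x => c * f x)).
Proof. by move=> fi; have := integrableZl measurableT c fi; apply: eq_integrable. Qed.

Lemma integrable_sqrM f g : measurable_fun setT f -> measurable_fun setT g ->
  mu.-integrable setT (EFin \o (fun x => f x ^+ 2)) ->
  mu.-integrable setT (EFin \o (fun x => g x ^+ 2)) ->
  mu.-integrable setT (EFin \o (fun x => f x * g x)).
Proof.
move=> mf mg f2 g2.
apply: (le_integrable measurableT _ _ (integrable_realD f2 g2)).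
- by apply/measurable_EFinP; exact: measurable_funM.
- move=> x _; rewrite /= lee_fin [leRHS]ger0_norm ?addr_ge0 ?sqr_ge0 //.
  by rewrite ler_norml; apply/andP; split; nra.
Qed.

End real_integrable.

Section poincare.
Context {R : realType}.
Variables (s : R) (s0 : 0 < s).
Notation N := (normal_prob 0 s).

(** For square integrable G the left side is twice the variance, and the squared mean is dropped.
    Nothing is lost later, because [normal_poincare] bounds a second moment about a point. *)
Lemma normal_pair_variance (G : R -> R) : measurable_fun setT G ->
  (\int[N]_t' \int[N]_t ((G t - G t') ^+ 2)%:E <= 2%:E * \int[N]_t (G t ^+ 2)%:E)%E.
Proof.
move=> mG.
have mG2 : measurable_fun setT (fun t => (G t ^+ 2)%:E).
  by apply/measurable_EFinP; exact: measurable_funX.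
have [fin|] := boolP ((\int[N]_t (G t ^+ 2)%:E) < +oo)%E; last first.
  rewrite -leNgt leye_eq => /eqP ->.
  by rewrite gt0_muley ?leey.
have iG2 : N.-integrable setT (EFin \o (fun t => G t ^+ 2)).
  apply/integrableP; split => //; under eq_integral => t _ do rewrite /= ger0_norm ?sqr_ge0 //.
  exact: fin.
have ic c : N.-integrable setT (EFin \o (fun=> c : R)) by exact: finite_measure_integrable_cst.
have iG : N.-integrable setT (EFin \o G).
  apply: (@le_integrable _ _ _ N setT measurableT _ (EFin \o (fun t => G t ^+ 2 + 1))).
  - exact/measurable_EFinP.
  - move=> t _; rewrite /= lee_fin [leRHS]ger0_norm ?addr_ge0 ?sqr_ge0 //.
    by rewrite ler_norml; apply/andP; split; nra.
  - exact: (integrableD measurableT iG2 (ic 1)).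
pose m := \int[N]_t G t; pose v := \int[N]_t (G t ^+ 2).
have E1 t' : (\int[N]_t ((G t - G t') ^+ 2)%:E = (v - 2 * G t' * m + G t' ^+ 2)%:E)%E.
  have i1 : N.-integrable setT (EFin \o (fun t => - (2 * G t') * G t)).
    exact: integrable_realZ.
  have i2 := integrableD measurableT iG2 i1.
  have i3 := integrableD measurableT i2 (ic (G t' ^+ 2)).
  have e t : (G t - G t') ^+ 2 = (G t ^+ 2 + - (2 * G t') * G t) + G t' ^+ 2 by ring.
  under eq_integral do rewrite e.
  rewrite -[LHS]fineK; last exact: (integrable_fin_num measurableT i3).
  congr EFin.
  have -> : fine (\int[N]_t (G t ^+ 2 + - (2 * G t') * G t + G t' ^+ 2)%:E)%E =
     \int[N]_t (G t ^+ 2 + - (2 * G t') * G t + G t' ^+ 2) by [].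
  rewrite (RintegralD measurableT i2 (ic _)) (RintegralD measurableT iG2 i1).
  rewrite (RintegralZl _ measurableT iG) (Rintegral_cst N measurableT).
  rewrite [X in fine X](@probability_setT _ _ _ N) /= mulr1 /v /m; ring.
under eq_integral do rewrite E1.
have i1 : N.-integrable setT (EFin \o (fun t => - (2 * m) * G t)).
  exact: integrable_realZ.
have i2 := integrableD measurableT iG2 i1.
have i3 := integrableD measurableT i2 (ic v).
have e t : v - 2 * G t * m + G t ^+ 2 = (G t ^+ 2 + - (2 * m) * G t) + v by ring.
under eq_integral do rewrite e.
have -> : (\int[N]_t (G t ^+ 2)%:E = v%:E)%E.
  by rewrite /v /Rintegral fineK //; exact: (integrable_fin_num measurableT iG2).
rewrite -[leLHS]fineK; last exact: (integrable_fin_num measurableT i3).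
rewrite -EFinM lee_fin.
have -> : fine (\int[N]_t (G t ^+ 2 + - (2 * m) * G t + v)%:E)%E =
     \int[N]_t (G t ^+ 2 + - (2 * m) * G t + v) by [].
rewrite (RintegralD measurableT i2 (ic _)) (RintegralD measurableT iG2 i1).
rewrite (RintegralZl _ measurableT iG) (Rintegral_cst N measurableT).
rewrite [X in fine X](@probability_setT _ _ _ N) /= mulr1 -/v -/m.
have := sqr_ge0 m; rewrite expr2; lra.
Qed.

Context {n : nat}.
Notation rV := 'rV[R]_n.
Variables (Q : probability rV R).
Hypothesis gQ : gaussian s Q.
Notation Ex F := (\int[Q]_x F x).
Notation QQ := (Q \x Q)%E.

Section efron_stein.
Variables (k : rV -> R) (tk : tame k).

Definition swapped (D : pred 'I_n) (p : rV * rV) : R := k (swap_coords D p).1.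

Let mk : measurable_fun setT k. Proof. by case: tk. Qed.

Lemma measurable_swapped D : measurable_fun setT (swapped D).
Proof.
apply: measurableT_comp => //; apply: measurableT_comp => //.
exact: measurable_swap_coords.
Qed.

Lemma swapped_sqr D : (\int[QQ]_p (swapped D p ^+ 2)%:E = (Ex (fun x => k x ^+ 2))%:E)%E.
Proof.
have mF : measurable_fun setT (fun p : rV * rV => (k p.1 ^+ 2)%:E).
  by apply/measurable_EFinP; apply: measurable_funX; exact: measurableT_comp.
rewrite -(@ge0_swap_coords _ _ _ _ gQ D (fun p => (k p.1 ^+ 2)%:E)) //; last first.
  by move=> p; rewrite lee_fin sqr_ge0.
rewrite fubini_tonelli1 //; last by move=> p; rewrite lee_fin sqr_ge0.
rewrite -(EFin_Ex s0 gQ (tameX2 tk)); apply: eq_integral => x _.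
by rewrite /fubini_F /= integral_cst // [X in (_ * X)%E](@probability_setT _ _ _ Q) mule1.
Qed.

Lemma integrable_swappedM D D' : QQ.-integrable setT (EFin \o (fun p => swapped D p * swapped D' p)).
Proof.
have i2 C : QQ.-integrable setT (EFin \o (fun p => swapped C p ^+ 2)).
  apply/integrableP; split.
    by apply/measurable_EFinP; apply: measurable_funX; exact: measurable_swapped.
  under eq_integral => p _ do rewrite /= ger0_norm ?sqr_ge0 //.
  by rewrite swapped_sqr ltry.
by apply: integrable_sqrM => //; exact: measurable_swapped.
Qed.

(* The covariance structure of the exchanged copies: E k(X) k(X^D), where X^D is
   X with the coordinates in D taken from an independent copy. *)
Definition overlap D : R := \int[QQ]_p (swapped xpred0 p * swapped D p).

Lemma swappedE C D p : swapped C (swap_coords D p) = swapped (fun j => C j (+) D j) p.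
Proof. by rewrite /swapped swap_coordsD. Qed.

Lemma eq_swapped D D' : D =1 D' -> swapped D = swapped D'.
Proof.
move=> DD; apply/funext => p; congr (k _); apply/rowP => j; by rewrite !mxE DD.
Qed.

(** The law of the pair is invariant under [swap_coords C], so the mixed moment depends only on the
    symmetric difference of the two sets. *)
Lemma overlapE C D : \int[QQ]_p (swapped C p * swapped D p) = overlap (fun j => C j (+) D j).
Proof.
rewrite /overlap.
have -> : \int[QQ]_p (swapped C p * swapped D p) =
    \int[QQ]_p (swapped C (swap_coords C p) * swapped D (swap_coords C p)).
  have [_ h] := integral_transfer (measurable_swap_coords C)
    (fun A mA => swap_coords_preserves gQ C mA) (integrable_swappedM C D).
  exact: (congr1 fine h).
apply: eq_Rintegral => p _; rewrite !swappedE; congr (_ * _).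
  by rewrite (@eq_swapped _ xpred0) // => j; rewrite addbb.
by rewrite (@eq_swapped _ (fun j => C j (+) D j)) // => j; rewrite addbC.
Qed.

Lemma overlap0 : overlap xpred0 = Ex (fun x => k x ^+ 2).
Proof.
rewrite /overlap -[RHS]/(fine (_)%:E) -(swapped_sqr xpred0).
by apply: (congr1 fine); apply: eq_integral => p _; rewrite expr2.
Qed.

(** With all coordinates exchanged the two vectors are independent and the moment factors. *)
Lemma overlap_all : overlap xpredT = Ex k ^+ 2.
Proof.
have ik := tame_integrable s0 gQ tk.
have i := integrable_swappedM xpred0 xpredT.
rewrite /overlap /Rintegral -(integral12_prod_meas1 i) /fubini_F /=.
have e x : (\int[Q]_y (swapped xpred0 (x, y) * swapped xpredT (x, y))%:E = (k x * Ex k)%:E)%E.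
  have -> : (\int[Q]_y (swapped xpred0 (x, y) * swapped xpredT (x, y))%:E =
     \int[Q]_y (k x * k y)%:E)%E.
    apply: eq_integral => y _; congr ((k _ * k _)%:E); by apply/rowP => j; rewrite mxE.
  by rewrite (EFin_Ex s0 gQ (tameZ (k x) tk)) (ExZ s0 gQ).
under eq_integral do rewrite e.
change (Ex (fun x => k x * Ex k) = Ex k ^+ 2).
by under eq_Rintegral do rewrite mulrC; rewrite (ExZ s0 gQ) // expr2.
Qed.

(* Expand 0 <= E (k(X) - k(X^C) - k(X^D) + k(X^(C+D)))^2. *)
Lemma overlap_subadditive C D :
  overlap xpred0 - overlap (fun j => C j (+) D j) <=
  (overlap xpred0 - overlap C) + (overlap xpred0 - overlap D).
Proof.
pose E := fun j => C j (+) D j.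
pose a := swapped xpred0; pose b := swapped C; pose c := swapped D; pose e := swapped E.
have h : 0 <= \int[QQ]_p ((a p - b p - c p + e p) ^+ 2) by apply: Rintegral_ge0 => p _; exact: sqr_ge0.
pose I := \int[QQ]_p ((a p - b p - c p + e p) ^+ 2).
have ee p : (a p - b p - c p + e p) ^+ 2 =
   (((a p * a p + b p * b p) + (c p * c p + e p * e p)) +
   2 * ((a p * e p + b p * c p))) - 2 * ((a p * b p + a p * c p) + (b p * e p + c p * e p)).
  by ring.
have i D1 D2 := integrable_swappedM D1 D2.
have iD := @integrable_realD _ _ _ QQ.
have iZ := @integrable_realZ _ _ _ QQ.
move: h; under eq_Rintegral do rewrite ee.
rewrite RintegralB //; last 2 first.
- by apply: (iD); [apply: (iD); apply: (iD); exact: i|apply: (iZ); apply: (iD); exact: i].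
- by apply: (iZ); apply: (iD); apply: (iD); exact: i.
rewrite RintegralD //; last 2 first.
- by apply: (iD); apply: (iD); exact: i.
- by apply: (iZ); apply: (iD); exact: i.
rewrite RintegralZl //; last by apply: (iD); exact: i.
rewrite RintegralZl //; last by apply: (iD); apply: (iD); exact: i.
rewrite !(RintegralD measurableT); try by [exact: i|apply: (iD); exact: i].
rewrite !overlapE.
have x0 D1 : (fun j => D1 j (+) D1 j) = xpred0 :> pred 'I_n by apply/funext => j; rewrite addbb.
have x1 : (fun j => xpred0 j (+) E j) = E :> pred 'I_n by [].
have x2 : (fun j => C j (+) E j) = D :> pred 'I_n by apply/funext => j; rewrite /E addbA addbb.
have x3 : (fun j => D j (+) E j) = C :> pred 'I_n by apply/funext => j; rewrite /E addbC -addbA addbb addbF.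
have x4 D1 : (fun j => xpred0 j (+) D1 j) = D1 :> pred 'I_n by [].
rewrite !x0 x2 x3 !x4 -/E; lra.
Qed.

(** The variance is the drop of [overlap] from the empty set to the full one. The drop is
    subadditive under symmetric difference, so adding coordinates one at a time bounds it by the
    drops at singletons. *)
Lemma efron_stein : Ex (fun x => k x ^+ 2) - Ex k ^+ 2 <= \sum_i (overlap xpred0 - overlap (pred1 i)).
Proof.
rewrite -overlap0 -overlap_all.
suff h m : (m <= n)%N -> overlap xpred0 - overlap (fun j => (j < m)%N) <=
    \sum_(i < n | (i < m)%N) (overlap xpred0 - overlap (pred1 i)).
  have := h n (leqnn n); under eq_bigl do rewrite ltn_ord.
  by congr (_ - overlap _ <= _); apply/funext => j; rewrite ltn_ord.
elim: m => [_|m IH mn].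
  by rewrite big_pred0 // (_ : (fun j : 'I_n => (j < 0)%N) = xpred0) ?subrr //; apply/funext.
have -> : (fun j : 'I_n => (j < m.+1)%N) = (fun j : 'I_n => (j < m)%N (+) (pred1 (Ordinal mn) j)).
  apply/funext => j; rewrite /= ltnS leq_eqVlt -val_eqE /=.
  by case: ltngtP.
apply: le_trans (overlap_subadditive _ _) _.
rewrite [X in _ <= X](bigD1 (Ordinal mn)) //= [X in _ <= X]addrC lerD2r; apply: le_trans (IH (ltnW mn)) _.
rewrite le_eqVlt; apply/orP; left; apply/eqP; apply: eq_bigl => j.
have -> : (j != Ordinal mn) = (nat_of_ord j != m) by [].
by rewrite ltnS; case: (ltngtP (nat_of_ord j) m).
Qed.

End efron_stein.

Lemma measurable_integral_upd i (F : rV -> \bar R) :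
  measurable_fun setT F -> (forall x, 0 <= F x)%E ->
  measurable_fun setT (fun x => \int[N]_t F (upd i t x))%E.
Proof.
move=> mF F0.
apply: (@measurable_fun_fubini_tonelli_F _ _ _ _ _ N (fun p : rV * R => F (upd i p.2 p.1))) => //.
by apply: measurableT_comp => //; exact: measurable_upd.
Qed.

(** Twice the left side is the mean of the squared change of k when coordinate i is replaced by an
    independent one. With the other coordinates fixed this is a statement about a pair of
    independent normal variables. *)
Lemma coordinate_poincare i k : explip k ->
  overlap k xpred0 - overlap k (pred1 i) <= s ^+ 2 * Ex (fun x => partial i k x ^+ 2).
Proof.
move=> ek; have tk := explip_tame ek; have tp := tame_partial i ek.
pose a := swapped k xpred0; pose b := swapped k (pred1 i).
have i1 D1 D2 := integrable_swappedM tk D1 D2.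
have i2 : QQ.-integrable setT (EFin \o (fun p => a p * a p + b p * b p)).
  by apply: integrable_realD; exact: i1.
have i3 : QQ.-integrable setT (EFin \o (fun p => -2 * (a p * b p))).
  by apply: integrable_realZ; exact: i1.
have E : \int[QQ]_p ((a p - b p) ^+ 2) = 2 * (overlap k xpred0 - overlap k (pred1 i)).
  have ee p : (a p - b p) ^+ 2 = (a p * a p + b p * b p) + -2 * (a p * b p) by ring.
  under eq_Rintegral do rewrite ee.
  rewrite (RintegralD measurableT i2 i3) (RintegralD measurableT (i1 _ _) (i1 _ _)).
  rewrite (RintegralZl _ measurableT (i1 _ _)) !(overlapE tk).
  have x0 D1 : (fun j => D1 j (+) D1 j) = xpred0 :> pred 'I_n by apply/funext => j; rewrite addbb.
  rewrite !x0 (_ : (fun j => xpred0 j (+) pred1 i j) = pred1 i) //; ring.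
suff h : (\int[QQ]_p ((a p - b p) ^+ 2)%:E <= (2 * (s ^+ 2 * Ex (fun x => partial i k x ^+ 2)))%:E)%E.
  rewrite -(@ler_pM2l _ 2) // -E -lee_fin /Rintegral fineK //.
  rewrite ge0_fin_numE; first by apply: le_lt_trans h _; rewrite ltry.
  by apply: integral_ge0 => p _; rewrite lee_fin sqr_ge0.
have mab : measurable_fun setT (fun p => ((a p - b p) ^+ 2)%:E).
  apply/measurable_EFinP; apply: measurable_funX; apply: measurable_funB;
    exact: measurable_swapped.
have mk := explip_measurable ek.
have mu (t : R) : measurable_fun setT (upd i t : rV -> rV).
  by apply: measurable_upd => //; exact: measurable_cst.
rewrite fubini_tonelli1 //; last by move=> p; rewrite lee_fin sqr_ge0.
pose F (x : rV) (t : R) : R := (k x - k (upd i t x)) ^+ 2.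
have e1 x : (\int[Q]_y ((a (x, y) - b (x, y)) ^+ 2)%:E = \int[N]_t (F x t)%:E)%E.
  rewrite (ge0_integral_coord gQ i).
  - apply: eq_integral => y _; rewrite /a /b /swapped swap_coords1 /F /=.
    by congr ((k _ - _) ^+ 2)%:E; apply/rowP => j; rewrite mxE.
  - apply/measurable_EFinP; apply: measurable_funX; apply: measurable_funB => //.
    by apply: measurableT_comp => //; apply: measurable_upd => //; exact: measurable_cst.
  - by move=> t; rewrite lee_fin sqr_ge0.
rewrite /fubini_F; under eq_integral do rewrite e1.
have mFF : measurable_fun setT (fun x => \int[N]_t (F x t)%:E)%E.
  have ab0 p : (0 <= ((a p - b p) ^+ 2)%:E)%E by rewrite lee_fin sqr_ge0.
  have := @measurable_fun_fubini_tonelli_F _ _ _ _ _ Q _ mab ab0.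
  by rewrite /fubini_F; under eq_fun do rewrite e1.
rewrite (ge0_resample gQ i) //; last first.
  by move=> x; apply: integral_ge0 => t _; rewrite lee_fin sqr_ge0.
rewrite mulrA EFinM -(EFin_Ex s0 gQ (tameX2 tp)).
have mp2 : measurable_fun setT (fun x => (partial i k x ^+ 2)%:E).
  by apply/measurable_EFinP; apply: measurable_funX; case: tp.
have p20 x : (0 <= (partial i k x ^+ 2)%:E)%E by rewrite lee_fin sqr_ge0.
rewrite (ge0_resample gQ i mp2 p20) -ge0_integralZl //; last 3 first.
- exact: (measurable_integral_upd i mp2 p20).
- by move=> x _; apply: integral_ge0.
- by rewrite lee_fin mulr_ge0 ?sqr_ge0.
apply: ge0_le_integral => //.
- by move=> x _; apply: integral_ge0 => t _; apply: integral_ge0 => t' _; rewrite lee_fin sqr_ge0.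
- apply: (@measurable_integral_upd i (fun x => \int[N]_t (F x t)%:E)%E) => // x.
  by apply: integral_ge0 => t _; rewrite lee_fin sqr_ge0.
- by apply: emeasurable_funM => //; exact: (measurable_integral_upd i mp2 p20).
- move=> x _.
  (* Subtracting the value at 0 does not affect increments and matches the left side of
     [normal_poincare]. *)
  pose G t := k (upd i t x) - k (upd i 0 x).
  have e2 t' t : F (upd i t' x) t = (G t - G t') ^+ 2.
    by rewrite /F upd_upd /G; ring.
  under eq_integral => t' _ do under eq_integral do rewrite e2.
  apply: (le_trans (normal_pair_variance _)).
    by apply: measurable_funB => //; apply: measurableT_comp => //; apply: measurable_upd => //; exact: measurable_cst.
  rewrite EFinM -muleA lee_wpmul2l //.
  apply: (normal_poincare s0 (explip_section i x ek)).
    by case: tp => mp _; apply: measurableT_comp => //; apply: measurable_upd => //; exact: measurable_cst.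
  by apply: aeW => t _; rewrite derive_section.
Qed.

Lemma poincare k : explip k -> Ex (fun x => k x ^+ 2) - Ex k ^+ 2 <=
  s ^+ 2 * \sum_i Ex (fun x => partial i k x ^+ 2).
Proof.
move=> ek; apply: le_trans (efron_stein (explip_tame ek)) _; rewrite mulr_sumr.
by apply: ler_sum => i _; exact: coordinate_poincare.
Qed.

End poincare.

(** * Variance of a Stein sum plus a function *)

Section variance.
Context {R : realType} {n : nat}.
Notation rV := 'rV[R]_n.
Variables (s : R) (s0 : 0 < s) (Q : probability rV R).
Hypothesis gQ : gaussian s Q.
Notation Ex F := (\int[Q]_x F x).

Lemma partial_cst i c (x : rV) : partial i (fun=> c) x = 0.
Proof. exact: derive_cst. Qed.

Lemma Ex_delta i u : explip u -> Ex (delta s i u) = 0.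
Proof.
move=> eu; have := stein s0 gQ i eu (explip_cst 1).
under eq_Rintegral do rewrite mulr1.
under [in X in _ = _ * X -> _]eq_Rintegral do rewrite partial_cst mulr0.
by move=> ->; rewrite (Ex_cst Q) mulr0.
Qed.

Definition stein_sum (q : 'I_n -> rV -> R) (k : rV -> R) x := \sum_i delta s i (q i) x + k x.

(* Var (D + k) = Var D + 2 Cov (D, k) + Var k for D = sum of delta i (q i): the
   first two terms come from the Stein formulas, and bounding Var k by the
   Poincare inequality completes the square. *)
Lemma variance_bound (q : 'I_n -> rV -> R) (k : rV -> R) :
  (forall i, explip (q i)) -> explip k ->
  Ex (fun x => stein_sum q k x ^+ 2) - Ex (stein_sum q k) ^+ 2 <=
  Ex (fun x => s ^+ 2 * (\sum_i (q i x + partial i k x) ^+ 2) +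
    s ^+ 4 * (\sum_i \sum_j partial j (q i) x * partial i (q j) x)).
Proof.
move=> exq ek; pose T := stein_sum q k.
have tq i := explip_tame (exq i); have tk := explip_tame ek.
have tp i := tame_partial i ek; have tpq i j := tame_partial i (exq j).
have td i := tame_delta s i (exq i).
pose D x := \sum_i delta s i (q i) x.
have tD : tame D by apply: tame_sum => i _; exact: td.
have ED : Ex D = 0.
  by rewrite (Ex_sum s0 gQ) ?big1 // => i _; exact: Ex_delta.
have ET : Ex T = Ex k by rewrite /T /stein_sum (ExD s0 gQ) // -/D ED add0r.
have ET2 : Ex (fun x => T x ^+ 2) =
    Ex (fun x => D x * D x) + 2 * Ex (fun x => D x * k x) + Ex (fun x => k x ^+ 2).
  have e x : T x ^+ 2 = D x * D x + 2 * (D x * k x) + k x ^+ 2 by rewrite /T /stein_sum -/(D x); ring.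
  under eq_Rintegral do rewrite e.
  rewrite (ExD s0 gQ); [|by apply: tameD; [exact: tameM|apply: tameZ; exact: tameM]|exact: tameX2].
  rewrite (ExD s0 gQ); [|exact: tameM|by apply: tameZ; exact: tameM].
  by rewrite (ExZ s0 gQ) //; exact: tameM.
have EDk : Ex (fun x => D x * k x) = s ^+ 2 * \sum_i Ex (fun x => q i x * partial i k x).
  under eq_Rintegral do rewrite mulr_suml.
  rewrite (Ex_sum s0 gQ); last by move=> i _; exact: tameM.
  by rewrite mulr_sumr; apply: eq_bigr => i _; rewrite (stein s0 gQ).
have EDD : Ex (fun x => D x * D x) = s ^+ 2 * \sum_i Ex (fun x => q i x ^+ 2) +
    s ^+ 4 * \sum_i \sum_j Ex (fun x => partial j (q i) x * partial i (q j) x).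
  under eq_Rintegral do rewrite mulr_suml.
  under eq_Rintegral => x _ do under eq_bigr do rewrite mulr_sumr.
  rewrite (Ex_sum s0 gQ); last by move=> i _; apply: tame_sum => j _; exact: tameM.
  rewrite !mulr_sumr -big_split /=; apply: eq_bigr => i _.
  rewrite (Ex_sum s0 gQ); last by move=> j _; exact: tameM.
  rewrite [LHS](eq_bigr _ (fun j _ => second_order_stein s0 gQ i j (exq i) (exq j))).
  rewrite big_split /= -mulr_sumr; congr (_ + _).
  rewrite (bigD1 i) //= eqxx mul1r big1 ?addr0 // => j /negbTE ji.
  by rewrite eq_sym ji !mul0r.
have EG : Ex (fun x => s ^+ 2 * (\sum_i (q i x + partial i k x) ^+ 2) +
    s ^+ 4 * (\sum_i \sum_j partial j (q i) x * partial i (q j) x)) =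
    s ^+ 2 * (\sum_i Ex (fun x => q i x ^+ 2) + 2 * \sum_i Ex (fun x => q i x * partial i k x)
      + \sum_i Ex (fun x => partial i k x ^+ 2)) +
    s ^+ 4 * \sum_i \sum_j Ex (fun x => partial j (q i) x * partial i (q j) x).
  have tqp i : tame (fun x => (q i x + partial i k x) ^+ 2) by apply: tameX2; exact: tameD.
  have tt i j : tame (fun x => partial j (q i) x * partial i (q j) x) by exact: tameM.
  rewrite (ExD s0 gQ); last 2 first.
  - by apply: tameZ; apply: tame_sum.
  - by apply: tameZ; apply: tame_sum => i _; apply: tame_sum => j _; exact: tt.
  rewrite (ExZ s0 gQ); last by apply: tame_sum.
  rewrite (ExZ s0 gQ); last by apply: tame_sum => i _; apply: tame_sum => j _; exact: tt.
  rewrite (Ex_sum s0 gQ) //.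
  rewrite (Ex_sum s0 gQ); last by move=> i _; apply: tame_sum => j _; exact: tt.
  congr (_ * _ + _ * _); last first.
    by apply: eq_bigr => i _; rewrite (Ex_sum s0 gQ) // => j _; exact: tt.
  rewrite mulr_sumr -!big_split /=; apply: eq_bigr => i _.
  have e x : (q i x + partial i k x) ^+ 2 =
    q i x ^+ 2 + 2 * (q i x * partial i k x) + partial i k x ^+ 2 by ring.
  under eq_Rintegral do rewrite e.
  rewrite (ExD s0 gQ); [|by apply: tameD; [exact: tameX2|apply: tameZ; exact: tameM]|exact: tameX2].
  rewrite (ExD s0 gQ); [|exact: tameX2|by apply: tameZ; exact: tameM].
  by rewrite (ExZ s0 gQ) //; exact: tameM.
have := poincare s0 gQ ek.
rewrite -/T ET ET2 EDk EDD EG.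
move: (Ex (fun x => k x ^+ 2)) (\sum_i Ex (fun x => q i x ^+ 2))
  (\sum_i Ex (fun x => q i x * partial i k x)) (\sum_i Ex (fun x => partial i k x ^+ 2))
  (\sum_i \sum_j Ex (fun x => partial j (q i) x * partial i (q j) x)) (Ex k) => k2 a b c t e.
move: (s ^+ 2) (s ^+ 4) => s2 s4.
have -> : s2 * (a + 2 * b + c) + s4 * t = (s2 * a + s4 * t) + 2 * (s2 * b) + s2 * c by ring.
by move: (s2 * c) (s2 * a) (s4 * t) (2 * (s2 * b)) => ????; lra.
Qed.

End variance.

(** * The gradient of a 1-Lipschitz map is a contraction *)

Section cauchy_schwarz.
Context {R : realType} {n : nat}.
Notation rV := 'rV[R]_n.

(** Lagrange's identity: the double sum of squared minors is twice the gap between the squares of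
    the two sides. *)
Lemma cauchy_schwarz (a b : rV) : `|\sum_i a 0 i * b 0 i| <= enorm a * enorm b.
Proof.
rewrite -ler_sqr ?nnegrE ?mulr_ge0 ?enorm_ge0 // real_normK ?num_real // exprMn !enormE2.
set A := \sum_i a 0 i ^+ 2; set B := \sum_i b 0 i ^+ 2; set C := \sum_i a 0 i * b 0 i.
have h : 0 <= \sum_i \sum_j (a 0 i * b 0 j - a 0 j * b 0 i) ^+ 2.
  by apply: sumr_ge0 => i _; apply: sumr_ge0 => j _; exact: sqr_ge0.
have e : \sum_i \sum_j (a 0 i * b 0 j - a 0 j * b 0 i) ^+ 2 = 2 * (A * B) - 2 * C ^+ 2.
  have -> : 2 * (A * B) - 2 * C ^+ 2 = A * B + B * A - 2 * (C * C) by ring.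
  rewrite /A /B /C !mulr_suml mulr_sumr -sumrN -!big_split /=; apply: eq_bigr => i _.
  rewrite !mulr_sumr -sumrN -!big_split /=; apply: eq_bigr => j _.
  by move: (a 0 i) (b 0 i) (a 0 j) (b 0 j) => x y z t; ring.
by move: h; rewrite e; lra.
Qed.

Lemma enormZ c (a : rV) : enorm (c *: a) = `|c| * enorm a.
Proof.
rewrite /enorm -sqrtr_sqr -sqrtrM ?sqr_ge0 // mulr_sumr; congr (Num.sqrt _).
by apply: eq_bigr => i _; rewrite mxE exprMn.
Qed.

Lemma enorm_delta i : enorm (delta_mx 0 i : rV) = 1.
Proof.
rewrite /enorm (bigD1 i) //= mxE !eqxx /= big1 ?addr0 ?expr1n ?sqrtr1 // => j /negbTE ji.
by rewrite mxE ji andbF expr0n.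
Qed.

End cauchy_schwarz.

Section lipschitz.
Context {R : realType} {n : nat}.
Notation rV := 'rV[R]_n.
Variables (s : R) (s0 : 0 < s) (Q : probability rV R).
Hypothesis gQ : gaussian s Q.
Notation Ex F := (\int[Q]_x F x).

Lemma explip_lipschitzZ (u : rV -> R) K : 0 <= K ->
  (forall x y, `|u x - u y| <= K * enorm (x - y)) -> explip u.
Proof.
move=> K0 uK; have K1 : 0 < K + 1 by rewrite ltr_wpDl.
have -> : u = (fun x => (K + 1) * ((K + 1)^-1 * u x)).
  by apply/funext => x; rewrite mulrA divff ?mul1r // gt_eqF.
apply: explipZ; apply: explip_lipschitz => x y.
rewrite -mulrBr normrM normfV (gtr0_norm K1) ler_pdivrMl //.
by apply: le_trans (uK _ _) _; rewrite ler_wpM2r ?enorm_ge0 // lerDl.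
Qed.

Variables (u : rV -> R) (K : R).
Hypothesis (K0 : 0 <= K) (uK : forall x y, `|u x - u y| <= K * enorm (x - y)).

Let eu : explip u. Proof. exact: explip_lipschitzZ K0 uK. Qed.

Let explip_translate (a : rV) : explip (fun x => u (a + x)).
Proof.
apply: (explip_lipschitzZ K0) => x y; apply: le_trans (uK _ _) _.
by rewrite opprD addrACA subrr add0r.
Qed.

Variable v : rV.

(** Interpolates between 0 and v, one coordinate at a time, for the induction in
    [weak_directional]. *)
Definition trunc_row m : rV := \row_j (if (j < m)%N then v 0 j else 0).

Let V := trunc_row.
Let hs k : R := hseq k.

(** Unlike in [cm_dominated], the step [hs k * v 0 i] may be zero or negative. *)
Let cm_dom i : dominated_cvg Q (fun k => cm s i (hs k * v 0 i)) (fun=> 1).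
Proof.
pose a := `|v 0 i|.
pose B (x : rV) := expR (a / s ^+ 2 * x 0 i + a ^+ 2 / s ^+ 2) +
  expR (- (a / s ^+ 2) * x 0 i + a ^+ 2 / s ^+ 2).
split.
- by move=> k; have [] := tame_cm s i (hs k * v 0 i).
- exact: measurable_cst.
- exists B; first by apply: tameD; exact: tame_exp.
  move=> k x; rewrite ger0_norm ?expR_ge0 // /cm.
  have s2 : 0 < s ^- 2 by rewrite invr_gt0 exprn_gt0.
  have ha : `|hs k * v 0 i| <= a.
    by rewrite normrM ger0_norm ?ler_piMl ?hseq_le1 // ltW ?hseq_gt0.
  move: (hs k * v 0 i) ha => h ha.
  have h1 : h * x 0 i <= a * `|x 0 i|.
    by apply: le_trans (ler_norm _) _; rewrite normrM ler_wpM2r.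
  have h2 : (h * x 0 i - h ^+ 2 / 2) / s ^+ 2 <= (a * `|x 0 i| + a ^+ 2) / s ^+ 2.
    rewrite ler_wpM2r ?(ltW s2) //; have := sqr_ge0 h; have := sqr_ge0 a; lra.
  apply: (@le_trans _ _ (expR ((a * `|x 0 i| + a ^+ 2) / s ^+ 2))); first by rewrite ler_expR.
  rewrite /B; case: (ger0P (x 0 i)) => _.
    by rewrite mulrDl mulrAC lerDl expR_ge0.
  by rewrite mulrN -mulNr mulrDl mulrAC mulNr lerDr expR_ge0.
- apply: aeW => x; rewrite /cm -[X in _ --> X]expR0.
  pose q k := (hs k * v 0 i * x 0 i - (hs k * v 0 i) ^+ 2 / 2) / s ^+ 2.
  suff c3 : q @ \oo --> (0 : R) by exact: (cvg_comp _ _ c3 (@continuous_expR R 0)).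
  have c1 : hs k * v 0 i @[k --> \oo] --> (0 : R).
    by rewrite -[X in _ --> X](mul0r (v 0 i)); apply: cvgM; [exact: hseq_cvg|exact: cvg_cst].
  have c2 := cvgM (cvgB (cvgM c1 (@cvg_cst _ (x 0 i) _ \oo _))
    (cvgM (cvgM c1 c1) (@cvg_cst _ (2^-1 : R) _ \oo _))) (@cvg_cst _ (s ^- 2) _ \oo _).
  have -> : (0 : R) = (0 * x 0 i - 0 * 0 / 2) / s ^+ 2 by rewrite !mul0r subr0 mul0r.
  exact: c2.
Qed.

Let shift_dom i phi : explip phi -> (forall x, 0 <= phi x <= 1) ->
  dominated_cvg Q (fun k x => phi (shift1 i (- (hs k * v 0 i)) x)) phi.
Proof.
move=> ephi phi01; split.
- move=> k; apply: measurable_shift; exact: explip_measurable.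
- exact: explip_measurable.
- exists (fun=> 1); first exact: tame_cst.
  by move=> k x; have /andP[h1 h2] := phi01 (shift1 i (- (hs k * v 0 i)) x); rewrite ger0_norm.
- apply: aeW => x; case: ephi => cphi _.
  have c1 : - (hs k * v 0 i) @[k --> \oo] --> (0 : R).
    have -> : (0 : R) = - (0 * v 0 i) by rewrite mul0r oppr0.
    by apply: cvgN; apply: cvgM; [exact: hseq_cvg|exact: cvg_cst].
  have c2 : (- (hs k * v 0 i)) *: (delta_mx 0 i : rV) + x @[k --> \oo] --> 0 *: (delta_mx 0 i : rV) + x.
    by apply: cvgD; [apply: cvgZr_tmp c1|exact: cvg_cst].
  rewrite scale0r add0r in c2; exact: (cvg_comp _ _ c2 (cphi x)).
Qed.

(* One coordinate of v is shifted at a time; a Gaussian change of variables moves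
   the shift from u to the test function, where continuity suffices. *)
Lemma weak_directional m phi : (m <= n)%N -> explip phi -> (forall x, 0 <= phi x <= 1) ->
  (hs k)^-1 * Ex (fun x => (u (hs k *: V m + x) - u x) * phi x) @[k --> \oo] -->
  \sum_(i < n | (i < m)%N) v 0 i * Ex (fun x => partial i u x * phi x).
Proof.
elim: m => [|m IH] mn ephi phi01.
  rewrite big_pred0 //.
  have -> : V 0 = 0 by apply/rowP => j; rewrite !mxE ltn0.
  under eq_fun => k.
    under eq_Rintegral do rewrite scaler0 add0r subrr mul0r.
    by rewrite (Ex_cst Q) mulr0; over.
  exact: cvg_cst.
pose i := Ordinal mn; have tphi := explip_tame ephi.
have hs0 k : 0 < hs k by exact: hseq_gt0.
have VS k x : hs k *: V m.+1 + x = hs k *: V m + shift1 i (hs k * v 0 i) x.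
  rewrite /shift1 addrA; congr (_ + x); apply/rowP => j; rewrite !mxE ltnS eqxx /=.
  have -> : (j == i) = (nat_of_ord j == m) by [].
  case: (ltngtP j m) => [||jm]; rewrite ?mulr1n ?mulr0n ?mulr0 ?addr0 ?add0r ?mulr1 //.
  by congr (_ * v 0 _); apply/val_inj.
pose G k x := u (hs k *: V m + x) - u x.
have tG k : tame (G k).
  apply: tameB; last exact: explip_tame.
  by apply: explip_tame; exact: explip_translate.
have GK k x : `|(hs k)^-1 * G k x| <= K * enorm (V m).
  rewrite normrM normfV (gtr0_norm (hs0 k)) ler_pdivrMl //.
  by apply: le_trans (uK _ _) _; rewrite addrK enormZ (gtr0_norm (hs0 k)) mulrCA.
pose phik k x := phi (shift1 i (- (hs k * v 0 i)) x) * cm s i (hs k * v 0 i) x.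
have tphik k : tame (phik k) by apply: tameM; [exact: tame_shift|exact: tame_cm].
have dphi : dominated_cvg Q phik phi.
  have := dominated_cvgM (shift_dom i ephi phi01) (cm_dom i).
  by under [fun x => _ * 1]eq_fun do rewrite mulr1.
(* A is the quotient for the first m coordinates, B the error of moving the new shift onto phi, C
   the quotient along coordinate i alone. B tends to 0 because its quotient is bounded by K times
   the norm of [V m] while [phik] tends to phi in mean. *)
pose A k := (hs k)^-1 * Ex (fun x => G k x * phi x).
pose B k := Ex (fun x => ((hs k)^-1 * G k x) * (phik k x - phi x)).
pose C k := Ex (fun x => (hs k)^-1 * (u (shift1 i (hs k * v 0 i) x) - u x) * phi x).
have E k : (hs k)^-1 * Ex (fun x => (u (hs k *: V m.+1 + x) - u x) * phi x) = A k + B k + C k.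
  pose F y := G k y * phi (shift1 i (- (hs k * v 0 i)) y).
  have tF : tame F by apply: tameM => //; exact: tame_shift.
  have e x : (u (hs k *: V m.+1 + x) - u x) * phi x =
     F (shift1 i (hs k * v 0 i) x) + (u (shift1 i (hs k * v 0 i) x) - u x) * phi x.
    rewrite /F shift1D addNr shift1_0 VS /G -mulrDl; congr (_ * _); ring.
  have tus : tame (fun x => (u (shift1 i (hs k * v 0 i) x) - u x) * phi x).
    apply: tameM => //; apply: tameB; last exact: explip_tame.
    by apply: tame_shift; exact: explip_tame.
  under eq_Rintegral do rewrite e.
  rewrite (ExD s0 gQ) //; last exact: tame_shift.
  have -> : Ex (fun x => F (shift1 i (hs k * v 0 i) x)) = Ex (fun x => G k x * phik k x).
    rewrite [LHS](Ex_shift s0 gQ i (hs k * v 0 i) tF); apply: eq_Rintegral => x _.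
    by rewrite /F /phik /cm mulrA.
  have tGp : tame (fun x => G k x * phi x) by exact: tameM.
  have tGq : tame (fun x => G k x * (phik k x - phi x)) by apply: tameM => //; exact: tameB.
  have -> : Ex (fun x => G k x * phik k x) =
     Ex (fun x => G k x * phi x) + Ex (fun x => G k x * (phik k x - phi x)).
    rewrite -(ExD s0 gQ) //; apply: eq_Rintegral => x _; ring.
  rewrite !mulrDr -!(ExZ s0 gQ) //; congr (_ + _ + _).
  - by rewrite /A (ExZ s0 gQ).
  - by apply: eq_Rintegral => x _; rewrite mulrA.
  - by apply: eq_Rintegral => x _; rewrite mulrA.
have cA : A @ \oo --> \sum_(i < n | (i < m)%N) v 0 i * Ex (fun x => partial i u x * phi x).
  by apply: IH => //; exact: ltnW.
have cB : B @ \oo --> (0 : R).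
  have dd : dominated_cvg Q (fun k x => `|phik k x - phi x|) (fun=> 0).
    case: dphi => mk mp [H tH Hk] ck; split.
    - by move=> k; apply: measurableT_comp => //; exact: measurable_funB.
    - exact: measurable_cst.
    - exists (fun x => H x + `|phi x|); first by apply: tameD => //; exact: tame_norm.
      by move=> k x; rewrite normr_id; apply: le_trans (ler_normB _ _) _; rewrite lerD2r.
    - move: ck; apply: filterS => x ck.
      have c1 := cvgB ck (@cvg_cst _ (phi x) _ \oo _).
      by have := cvg_norm (c1 _ _) _; rewrite subrr normr0; apply.
  have c := dominated_Ex s0 gQ dd; rewrite (Ex_cst Q) in c.
  pose b k := K * enorm (V m) * Ex (fun x => `|phik k x - phi x|).
  have cb : b @ \oo --> (0 : R).
    by rewrite -(mulr0 (K * enorm (V m))); apply: cvgM => //; exact: cvg_cst.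
  have Bb k : `|B k| <= b k.
    have tn : tame (fun x => `|phik k x - phi x|) by apply: tame_norm; exact: tameB.
    have tB : tame (fun x => (hs k)^-1 * G k x * (phik k x - phi x)).
      by apply: tameM; [exact: tameZ|exact: tameB].
    rewrite /b -(ExZ s0 gQ) //.
    apply: le_trans (le_normr_Rintegral measurableT (tame_integrable s0 gQ tB)) _.
    apply: (Ex_ae_le s0 gQ); [exact: tame_norm|exact: tameZ|].
    by apply: aeW => x; rewrite normrM ler_wpM2r.
  apply: (@squeeze_cvgr _ _ _ _ (fun k => - b k) b) => //.
    by apply: nearW => k; have := Bb k; rewrite ler_norml.
  by rewrite -oppr0; exact: cvgN.
have cC : C @ \oo --> v 0 i * Ex (fun x => partial i u x * phi x).
  (* If v_i = 0 the step is zero and there is no quotient to pass to the limit in; both sides are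
     0. *)
  have [v0|v0] := eqVneq (v 0 i) 0.
    have -> : C = fun=> 0.
      apply/funext => k; rewrite /C v0; under eq_Rintegral do
        rewrite mulr0 shift1_0 subrr mulr0 mul0r.
      exact: (Ex_cst Q).
    by rewrite v0 mul0r; exact: cvg_cst.
  have h1 k : hs k * v 0 i != 0 by rewrite mulf_neq0 // gt_eqF.
  have h2 : hs k * v 0 i @[k --> \oo] --> 0.
    by rewrite -[X in _ --> X](mul0r (v 0 i)); apply: cvgM; [exact: hseq_cvg|exact: cvg_cst].
  have du : dominated_cvg Q (fun k => quot i (hs k * v 0 i) u) (partial i u).
    split.
    - by move=> k; have [] := tame_quot i (hs k * v 0 i) (explip_tame eu).
    - exact: measurable_partial.
    - exists (fun=> K); first exact: tame_cst.
      move=> k x; rewrite /quot normrM normfV ler_pdivrMl ?normr_gt0 //.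
      by apply: le_trans (uK _ _) _; rewrite /shift1 addrK enormZ enorm_delta mulr1 mulrC.
    - move: (explip_derivable_ae gQ i eu); apply: filterS => x dx.
      exact: (partial_cvg dx h1 h2).
  have c := dominated_Ex s0 gQ (dominated_cvgM du (dominated_cvg_cst Q tphi)).
  have -> : C = (fun k => v 0 i * Ex (fun x => quot i (hs k * v 0 i) u x * phi x)).
    apply/funext => k; rewrite -(ExZ s0 gQ); last first.
      by apply: tameM => //; apply: tame_quot; exact: explip_tame.
    apply: eq_Rintegral => x _; rewrite /quot mulrA; congr (_ * _).
    by set d := u _ - u x; rewrite mulrA [v 0 i * _]mulrC invfM -[_ * v 0 i]mulrA mulVf // mulr1.
  by apply: cvgM => //; exact: cvg_cst.
under eq_fun do rewrite E.
have -> : \sum_(i < n | (i < m.+1)%N) v 0 i * Ex (fun x => partial i u x * phi x) =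
  \sum_(i < n | (i < m)%N) v 0 i * Ex (fun x => partial i u x * phi x) + 0 +
   v 0 i * Ex (fun x => partial i u x * phi x).
  rewrite addr0 (bigD1 i) //= addrC; congr (_ + _); apply: eq_bigl => j.
  have -> : (j != i) = (nat_of_ord j != m) by [].
  by rewrite ltnS; case: (ltngtP (nat_of_ord j) m).
exact: cvgD (cvgD cA cB) cC.
Qed.

(** Every quotient along v is at most K times the norm of v, and this bound passes to the weak
    limit, which involves the partial derivatives only. *)
Lemma weak_directional_le phi : explip phi -> (forall x, 0 <= phi x <= 1) ->
  Ex (fun x => (\sum_i v 0 i * partial i u x) * phi x) <= K * enorm v * Ex phi.
Proof.
move=> ephi phi01; have tphi := explip_tame ephi.
have := weak_directional (leqnn n) ephi phi01.
have -> : V n = v by apply/rowP => j; rewrite mxE ltn_ord.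
have -> : \sum_(i < n | (i < n)%N) v 0 i * Ex (fun x => partial i u x * phi x) =
  Ex (fun x => (\sum_i v 0 i * partial i u x) * phi x).
  have tp i : tame (fun x => v 0 i * (partial i u x * phi x)).
    by apply: tameZ; apply: tameM => //; exact: tame_partial.
  transitivity (Ex (fun x => \sum_i v 0 i * (partial i u x * phi x))).
    rewrite (Ex_sum s0 gQ) //.
    apply: eq_big => [i|i _]; first by rewrite ltn_ord.
    by rewrite (ExZ s0 gQ) //; apply: tameM => //; exact: tame_partial.
  by apply: eq_Rintegral => x _; rewrite mulr_suml; apply: eq_bigr => i _; rewrite mulrA.
move=> c; rewrite -(cvg_lim (@Rhausdorff R) c); apply: limr_le; first by apply/cvg_ex; eexists; exact: c.
apply: nearW => k; have hk : 0 < hs k by exact: hseq_gt0.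
rewrite ler_pdivrMl // -(ExZ s0 gQ) // -(ExZ s0 gQ); last exact: tameZ.
apply: (Ex_ae_le s0 gQ).
- apply: tameM => //; apply: tameB; last exact: explip_tame.
  by apply: explip_tame; exact: explip_translate.
- by apply: tameZ; exact: tameZ.
- apply: aeW => x; rewrite mulrA ler_wpM2r //; first by have /andP[] := phi01 x.
  by apply: le_trans (ler_norm _) _; apply: le_trans (uK _ _) _; rewrite addrK enormZ (gtr0_norm hk) mulrCA.
Qed.

End lipschitz.

(** * From test functions to almost every point *)

Section approximation.
Context {R : realType} {n : nat}.
Notation rV := 'rV[R]_n.
Variables (s : R) (s0 : 0 < s) (Q : probability rV R).
Hypothesis gQ : gaussian s Q.
Notation Ex F := (\int[Q]_x F x).

Let tame_indic (A : set rV) : measurable A -> tame (\1_A : rV -> R).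
Proof.
move=> mA; apply: (tame_le _ (tame_cst 1)); first exact: measurable_indic.
by move=> x; rewrite indicE normr1; case: (_ \in _); rewrite ?normr1 ?normr0.
Qed.

(* Approximable sets form a sigma-algebra, so the continuous test functions of
   weak_directional can be replaced by indicators. *)
Definition approximable (A : set rV) := measurable A /\
  forall e, 0 < e -> exists2 phi, explip phi &
    (forall x, 0 <= phi x <= 1) /\ Ex (fun x => `|phi x - \1_A x|) <= e.

Let tame_dist (phi : rV -> R) (A : set rV) : explip phi -> measurable A -> tame (fun x => `|phi x - \1_A x|).
Proof.
by move=> ephi mA; apply: tame_norm; apply: tameB; [exact: explip_tame|exact: tame_indic].
Qed.

Lemma approximableC A : approximable A -> approximable (~` A).
Proof.
move=> [mA hA]; split; first exact: measurableC.
move=> e /hA[phi ephi [phi01 le]]; exists (fun x => 1 - phi x).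
  by apply: explipB => //; exact: explip_cst.
split; first by move=> x; have /andP[? ?] := phi01 x; apply/andP; split; lra.
have -> : (fun x => `|1 - phi x - \1_(~` A) x|) = (fun x => `|phi x - \1_A x|) => //.
apply/funext => x; rewrite -normrN; congr (`|_|).
rewrite !indicE; have [xA|xA] := boolP (x \in A).
  by rewrite in_setC xA /=; lra.
by rewrite in_setC xA /=; lra.
Qed.

Lemma approximableI A B : approximable A -> approximable B -> approximable (A `&` B).
Proof.
move=> [mA hA] [mB hB]; split; first exact: measurableI.
move=> e e0; have e2 : 0 < e / 2 by rewrite divr_gt0.
have [phi ephi [phi01 lephi]] := hA _ e2; have [psi epsi [psi01 lepsi]] := hB _ e2.
exists (fun x => phi x * psi x); first exact: explipM.
split.
  move=> x; have /andP[? ?] := phi01 x; have /andP[? ?] := psi01 x.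
  by rewrite mulr_ge0 // mulr_ile1.
have -> : e = e / 2 + e / 2 by lra.
apply: le_trans (lerD lephi lepsi).
rewrite -(ExD s0 gQ); [|exact: tame_dist|exact: tame_dist].
apply: (Ex_ae_le s0 gQ).
- by apply: tame_dist; [exact: explipM|exact: measurableI].
- by apply: tameD; exact: tame_dist.
- apply: aeW => x; rewrite !indicE in_setI.
  have /andP[a0 a1] := phi01 x; have /andP[b0 b1] := psi01 x.
  have -> : phi x * psi x - ((x \in A) && (x \in B))%:R =
    (phi x - (x \in A)%:R) * psi x + (x \in A)%:R * (psi x - (x \in B)%:R).
    by case: (x \in A); case: (x \in B) => /=; ring.
  apply: le_trans (ler_normD _ _) _; rewrite !normrM lerD //.
    by rewrite ler_piMr // ger0_norm.
  by rewrite ler_piMl //; case: (x \in A); rewrite ?normr1 ?normr0.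
Qed.

Lemma approximableU A B : approximable A -> approximable B -> approximable (A `|` B).
Proof.
move=> hA hB; rewrite -[A `|` B]setCK setCU; apply: approximableC.
by apply: approximableI; exact: approximableC.
Qed.

(** Finite unions tend to the countable one in mean by dominated convergence; one of them within e /
    2 is then approximated within e / 2. *)
Lemma approximable_bigcup (A : nat -> set rV) : (forall k, approximable (A k)) ->
  approximable (\bigcup_k A k).
Proof.
move=> hA; pose B m := \big[setU/set0]_(k < m) A k.
have h0 : approximable set0.
  split => // e e0; exists (fun=> 0); first exact: explip_cst.
  split; first by move=> x; rewrite lexx ler01.
  under eq_Rintegral do rewrite indic0 subrr normr0.
  by rewrite (Ex_cst Q) ltW.
have hB m : approximable (B m).
  by rewrite /B; elim/big_ind: _ => // C D; exact: approximableU.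
have mU : measurable (\bigcup_k A k) by apply: bigcup_measurable => k _; case: (hA k).
split => // e e0; have e2 : 0 < e / 2 by rewrite divr_gt0.
have c : Ex (fun x => `|\1_(B m) x - \1_(\bigcup_k A k) x|) @[m --> \oo] --> Ex (fun=> 0).
  apply: (Ex_cvg s0 gQ (G := fun=> 1)).
  - by move=> m; apply: measurableT_comp => //; apply: measurable_funB; apply: measurable_indic => //; case: (hB m).
  - exact: measurable_cst.
  - exact: tame_cst.
  - move=> m x; rewrite normr_id !indicE.
    by case: (x \in _); case: (x \in _); rewrite ?subrr ?subr0 ?sub0r ?normrN ?normr1 ?normr0.
  - apply: aeW => x; have [[k _ xk]|nx] := pselect ((\bigcup_k A k) x).
      apply: cvg_near_cst; near=> m.
      have xB : B m x by rewrite /B -bigcup_mkord; exists k => //=; near: m; exact: nbhs_infty_gt.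
      rewrite !indicE !mem_set // ?subrr ?normr0 //; by exists k.
    apply: cvg_near_cst; near=> m.
    rewrite !indicE !memNset // ?subrr ?normr0 //.
    by rewrite /B -bigcup_mkord => -[k _ xk]; apply: nx; exists k.
rewrite (Ex_cst Q) in c.
have [m hm] : exists m, Ex (fun x => `|\1_(B m) x - \1_(\bigcup_k A k) x|) <= e / 2.
  have /cvgrPdist_le := c; move=> /(_ _ e2)[m _ hm]; exists m.
  by have := hm m (leqnn _); rewrite sub0r normrN; apply: le_trans; exact: ler_norm.
have [mB /(_ _ e2)[phi ephi [phi01 le]]] := hB m.
exists phi => //; split => //; have -> : e = e / 2 + e / 2 by lra.
apply: le_trans (lerD le hm).
have td : tame (fun x => `|\1_(B m) x - \1_(\bigcup_k A k) x|).
  by apply: tame_norm; apply: tameB; exact: tame_indic.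
rewrite -(ExD s0 gQ) //; last exact: tame_dist.
apply: (Ex_ae_le s0 gQ); [exact: tame_dist|by apply: tameD => //; exact: tame_dist|].
by apply: aeW => x; exact: ler_distD.
Unshelve. all: by end_near. Qed.

Lemma approximable_ray i a : approximable [set x : rV | x 0 i <= a].
Proof.
have mray : measurable [set x : rV | x 0 i <= a].
  rewrite (_ : [set x : rV | _] = (fun x : rV => x 0 i) @^-1` `]-oo, a]); last first.
    by apply/seteqP; split => x /=; rewrite in_itv.
  by rewrite -[X in measurable X]setTI; apply: measurable_coord.
split => // e e0.
(* A ramp equal to 1 for x_i <= a and to 0 from a + [hseq k] on. *)
pose phi k (x : rV) : R := (hseq k)^-1 * Num.min (hseq k) (Num.max 0 (a + hseq k - x 0 i)).
have hs0 k : 0 < hseq k :> R by exact: hseq_gt0.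
have ephi k : explip (phi k).
  apply: explipZ; apply: explip_lipschitz => x y.
  apply: le_trans (ler_coord_enorm _ i); rewrite !mxE.
  move: (x 0 i) (y 0 i) (hseq k) => p q h.
  rewrite /Num.min /Num.max ler_norml.
  case: (ltP 0 (a + h - p)) => h1; case: (ltP 0 (a + h - q)) => h2;
  do ?[case: (ltP h _) => ?]; case: (ger0P (p - q)) => ?; apply/andP; split; lra.
have phi01 k x : 0 <= phi k x <= 1.
  rewrite mulr_ge0 /=; last 2 first.
  - by rewrite invr_ge0 ltW.
  - by rewrite le_min ltW //= le_max lexx.
  by rewrite ler_pdivrMl // mulr1 ge_min lexx.
have c : Ex (fun x => `|phi k x - \1_[set x : rV | x 0 i <= a] x|) @[k --> \oo] --> Ex (fun=> 0).
  apply: (Ex_cvg s0 gQ (G := fun=> 1)).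
  - by move=> k; have [] := tame_dist (ephi k) mray.
  - exact: measurable_cst.
  - exact: tame_cst.
  - move=> k x; rewrite normr_id !indicE; have := phi01 k x.
    move: (phi k x) => p /andP[p0 p1].
    by case: (x \in _) => /=; rewrite ?mulr1n ?mulr0n ler_norml; apply/andP; split; lra.
  - apply: aeW => x; apply: cvg_near_cst.
    have [xa|xa] := leP (x 0 i) a.
      apply: nearW => k; rewrite indicE mem_set //= /phi.
      rewrite min_l ?mulVf ?gt_eqF // ?subrr ?normr0 //.
      by rewrite le_max; apply/orP; right; lra.
    near=> k; rewrite indicE memNset /=; last by apply/negP; rewrite -ltNge.
    rewrite /phi max_l ?min_r ?mulr0 ?subr0 ?normr0 // ?ltW //.
    have : hseq k < x 0 i - a.
      near: k; have /cvgrPdist_lt/(_ (x 0 i - a)) := @hseq_cvg R.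
      rewrite subr_gt0 => /(_ xa); apply: filterS => k.
      by rewrite sub0r normrN gtr0_norm.
    lra.
rewrite (Ex_cst Q) in c.
have /cvgrPdist_le := c; move=> /(_ _ e0)[k _ hk]; exists (phi k) => //; split => //.
by have := hk k (leqnn _); rewrite sub0r normrN; apply: le_trans; exact: ler_norm.
Unshelve. all: by end_near. Qed.

Lemma measurable_approximable A : measurable A -> approximable A.
Proof.
move=> mA.
have sC : sigma_algebra setT approximable.
  split.
  - split => // e e0; exists (fun=> 0); first exact: explip_cst.
    split; first by move=> x; rewrite lexx ler01.
    under eq_Rintegral do rewrite indic0 subrr normr0.
    by rewrite (Ex_cst Q) ltW.
  - by move=> B hB; rewrite setTD; exact: approximableC.
  - exact: approximable_bigcup.
have hcoord i (B : set R) : measurable B -> approximable ((fun x : rV => x 0 i) @^-1` B).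
  rewrite -[measurable B]/(@measurable _ (measurableTypeR R) B) RGenOInfty.measurableE.
  move: B; apply: (smallest_sub (X := fun B : set R => approximable ((fun x : rV => x 0 i) @^-1` B))).
    case: sC => c0 cC cU; split.
    - by rewrite preimage_set0.
    - by move=> B hB; exact: (cC _ hB).
    - by move=> B hB; rewrite preimage_bigcup; exact: cU.
  move=> _ [a ->].
  rewrite (_ : _ @^-1` _ = ~` [set x : rV | x 0 i <= a]).
    by apply: approximableC; exact: approximable_ray.
  by apply/seteqP; split => x /=; rewrite in_itv /= andbT ltNge => /negP.
suff : @measurable _ rV `<=` approximable by apply.
apply: smallest_sub => // _ [B mB ->].
have -> : rbox B = \big[setI/setT]_(i < n) ((fun x : rV => x 0 i) @^-1` B i).
  rewrite -bigcap_seq; apply/seteqP; split => x /= hx i; first by move=> _; exact: hx.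
  by apply: hx => /=; rewrite mem_index_enum.
elim/big_ind: _ => //.
- rewrite -setC0; apply: approximableC; case: sC => //.
- exact: approximableI.
- by move=> i _; exact: hcoord.
Qed.

Variables (u : rV -> R) (K : R) (v : rV).
Hypothesis (K0 : 0 <= K) (uK : forall x y, `|u x - u y| <= K * enorm (x - y)).

Let D x := \sum_i v 0 i * partial i u x.

(** On the set A where the bound fails the excess is positive. The weak inequality, extended to the
    indicator of A, makes its integral at most 0, so A is null. *)
Lemma lipschitz_derive_le : {ae Q, forall x, D x <= K * enorm v}.
Proof.
have eu : explip u := explip_lipschitzZ K0 uK.
have tp i := tame_partial i eu.
have tD : tame D by apply: tame_sum => i _; exact: tameZ.
(* A bound valid everywhere, even where a partial derivative takes the default value [point]. It
   controls the error of replacing the indicator of A by a test function. *)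
pose M : R := K * enorm v + \sum_i `|v 0 i| * (K + `|point : R|).
have DM x : `|K * enorm v - D x| <= M.
  apply: le_trans (ler_normB _ _) _; rewrite ger0_norm ?mulr_ge0 ?enorm_ge0 // lerD2l.
  apply: le_trans (ler_norm_sum _ _ _) _; apply: ler_sum => i _.
  rewrite normrM ler_wpM2l //.
  apply: partial_norm_le => // m; have h0 := @hseq_gt0 R m.
  rewrite normrM normfV ler_pdivrMl ?normr_gt0 ?gt_eqF //.
  by apply: le_trans (uK _ _) _; rewrite /shift1 addrK enormZ enorm_delta mulr1 mulrC.
have M0 : 0 <= M by rewrite (le_trans _ (DM 0)).
pose A := [set x | K * enorm v < D x].
have mD : measurable_fun setT D by case: tD.
have mA : measurable A.
  rewrite (_ : A = D @^-1` `]K * enorm v, +oo[); last first.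
    by apply/seteqP; split => x /=; rewrite in_itv /= andbT.
  by rewrite -[X in measurable X]setTI; apply: mD.
have tA : tame (\1_A : rV -> R) by exact: tame_indic.
pose rho x := K * enorm v - D x.
have trho : tame rho by apply: tameB => //; exact: tame_cst.
have ge0 : 0 <= Ex (fun x => rho x * \1_A x).
  apply/ler_addgt0Pr => e e0.
  have [_ /(_ (e / (M + 1)))[|phi ephi [phi01 le]]] := measurable_approximable mA.
    by rewrite divr_gt0 // ltr_wpDl.
  have tphi := explip_tame ephi.
  have h := weak_directional_le s0 gQ K0 uK v ephi phi01.
  have h0 : 0 <= Ex (fun x => rho x * phi x).
    under eq_Rintegral do rewrite /rho mulrBl.
    rewrite (ExB s0 gQ); [|exact: tameZ|exact: tameM].
    by rewrite (ExZ s0 gQ) // subr_ge0.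
  apply: le_trans h0 _.
  have tdist : tame (fun x => `|phi x - \1_A x|) by exact: tame_dist.
  have : Ex (fun x => rho x * phi x) <=
      Ex (fun x => rho x * \1_A x + (M + 1) * `|phi x - \1_A x|).
    apply: (Ex_ae_le s0 gQ); [exact: tameM| |].
      by apply: tameD; [exact: tameM|exact: tameZ].
    apply: aeW => x; rewrite -lerBlDl -mulrBr.
    apply: le_trans (ler_norm _) _; rewrite normrM ler_wpM2r //.
    by apply: le_trans (DM x) _; rewrite lerDl.
  rewrite (ExD s0 gQ); [|exact: tameM|exact: tameZ].
  rewrite (ExZ s0 gQ) // => h1; apply: le_trans h1 _; rewrite lerD2l mulrC.
  by rewrite -ler_pdivlMr // ltr_wpDl.
pose g x := (D x - K * enorm v) * \1_A x.
have tg : tame g by apply: tameM => //; apply: tameB => //; exact: tame_cst.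
have g0 x : 0 <= g x.
  rewrite /g indicE; have [xA|xA] := boolP (x \in A); last by rewrite mulr0.
  by rewrite mulr1 subr_ge0 ltW //; move: xA; rewrite inE.
have Eg : (\int[Q]_x (g x)%:E = 0)%E.
  rewrite (EFin_Ex s0 gQ tg); congr EFin; apply/eqP; rewrite eq_le Ex_ge0 // andbT.
  rewrite -oppr_ge0 -mulN1r -(ExZ s0 gQ) //.
  rewrite (_ : (fun x => -1 * g x) = (fun x => rho x * \1_A x)) //.
  by apply/funext => x; rewrite /g /rho; ring.
have : ae_eq Q setT (fun x => (g x)%:E) (cst 0%E).
  apply/(ae_eq_integral_abs _ measurableT); first by apply/measurable_EFinP; case: tg.
  rewrite -Eg; apply: eq_integral => x _ /=; by rewrite ger0_norm.
apply: filterS => x /(_ I) [gx].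
rewrite leNgt; apply/negP => xA; move: gx; rewrite /g indicE mem_set // mulr1 => /eqP.
by rewrite subr_eq0 gt_eqF.
Qed.

End approximation.

(** * Inequalities for positive semi-definite contractions *)

Section dot.
Context {R : realType} {n : nat}.
Notation rV := 'rV[R]_n.
Implicit Types (u v w : rV) (A : 'M[R]_n).

Definition dot u v : R := \sum_i u 0 i * v 0 i.

Lemma dotE u v : dot u v = (u *m v^T) 0 0.
Proof. by rewrite mxE; apply: eq_bigr => i _; rewrite mxE. Qed.

Lemma dotC u v : dot u v = dot v u.
Proof. by apply: eq_bigr => i _; rewrite mulrC. Qed.

Lemma dotDl u v w : dot (u + v) w = dot u w + dot v w.
Proof. by rewrite -big_split; apply: eq_bigr => i _; rewrite mxE mulrDl. Qed.

Lemma dotZl a u v : dot (a *: u) v = a * dot u v.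
Proof. by rewrite mulr_sumr; apply: eq_bigr => i _; rewrite mxE mulrA. Qed.

Lemma dotDr u v w : dot w (u + v) = dot w u + dot w v.
Proof. by rewrite dotC dotDl !(dotC w). Qed.

Lemma dotZr a u v : dot u (a *: v) = a * dot u v.
Proof. by rewrite dotC dotZl dotC. Qed.

Lemma dotNl u v : dot (- u) v = - dot u v.
Proof. by rewrite -scaleN1r dotZl mulN1r. Qed.

Lemma dotNr u v : dot u (- v) = - dot u v.
Proof. by rewrite dotC dotNl dotC. Qed.

Lemma enorm_dot u : enorm u ^+ 2 = dot u u.
Proof. by rewrite enormE2; apply: eq_bigr => i _; rewrite expr2. Qed.

Lemma dot_ge0 u : 0 <= dot u u.
Proof. by rewrite -enorm_dot sqr_ge0. Qed.

Lemma dot_sym A u v : A^T = A -> dot (u *m A) v = dot u (v *m A).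
Proof. by move=> sA; rewrite !dotE trmx_mul sA mulmxA. Qed.

(** The operator norm bound in bilinear form, as it arises from the scalar functions [dot w (f x)]
    differentiated along v. *)
Definition contraction A := forall v w, dot (v *m A) w <= enorm v * enorm w.

Variable A : 'M[R]_n.
Hypotheses (sA : sym_psd A) (cA : contraction A).

Lemma psd_dot v : 0 <= dot (v *m A) v.
Proof. by case: sA => _ /(_ v); rewrite dotE. Qed.

Lemma contraction_dot v : dot (v *m A) v <= dot v v.
Proof. by rewrite -enorm_dot expr2; exact: cA. Qed.

(* Positivity of A at v - vA, together with A <= 1 at vA. *)
Lemma contraction_sqr v : dot (v *m A) (v *m A) <= dot (v *m A) v.
Proof.
case: (sA) => tA _; set t := v *m A.
have := psd_dot (v + (-1) *: t); have := contraction_dot t.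
rewrite mulmxDl -scalemxAl -/t !(dotDl, dotDr, dotZl, dotZr).
by rewrite (dot_sym t v tA) -/t; lra.
Qed.

(** The square expands to v.v - 2 vA.v + vA.vA; the last term is at most vA.v, which is
    nonnegative. *)
Lemma sub_contraction_sqr v : dot (v - v *m A) (v - v *m A) <= dot v v.
Proof.
have := contraction_sqr v; have := psd_dot v.
by rewrite -scaleN1r !(dotDl, dotDr, dotZl, dotZr) (dotC v); lra.
Qed.

Lemma dot_delta_mx u i : dot u (delta_mx 0 i) = u 0 i.
Proof.
rewrite /dot (bigD1 i) //= mxE !eqxx mulr1 big1 ?addr0 // => j /negbTE ji.
by rewrite mxE ji andbF mulr0.
Qed.

Lemma delta_mx_mul i j : (delta_mx 0 i *m A : rV) 0 j = A i j.
Proof. by rewrite -rowE mxE. Qed.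

(** Sum [contraction_sqr] over the standard basis: A^2 <= A when the spectrum lies in [0, 1]. *)
Lemma contraction_trace_sqr : \sum_i \sum_j A j i * A i j <= \tr A.
Proof.
apply: ler_sum => i _; have := contraction_sqr (delta_mx 0 i).
rewrite dot_delta_mx delta_mx_mul; apply: le_trans.
rewrite le_eqVlt; apply/orP; left; apply/eqP; apply: eq_bigr => j _.
by rewrite delta_mx_mul; case: sA => tA _; rewrite -{1}tA mxE.
Qed.

Lemma psd_trace_ge0 : 0 <= \tr A.
Proof.
apply: sumr_ge0 => i _; have := psd_dot (delta_mx 0 i).
by rewrite dot_delta_mx delta_mx_mul.
Qed.

(* With w := - F - e / 2, the right side minus the left side is
   4 (wA.w - wA.wA) + 4 (w + 3/4 e)A.(w + 3/4 e) + 9/4 (e.e - eA.e). *)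
Lemma combined_contraction (F e : rV) :
  dot (2 *: (F *m A) + (-2) *: F + e *m A + 2^-1 *: e)
      (2 *: (F *m A) + (-2) *: F + e *m A + 2^-1 *: e) <=
  4 * dot (e - F) (e - F) - 6 * dot (e - F) e + (9 / 2) * dot e e.
Proof.
case: (sA) => tA _.
pose w := - F + (- 2^-1) *: e.
have h1 := contraction_sqr w; have h2 := psd_dot (w + (3 / 4) *: e).
have h3 := contraction_dot e; move: h1 h2 h3.
rewrite /w !(mulmxDl, mulNmx, =^~ scalemxAl).
rewrite !(dotDl, dotDr, dotZl, dotZr, dotNl, dotNr).
rewrite ?(dotC F (F *m A)) ?(dotC F (e *m A)) ?(dotC e (F *m A)) ?(dotC e (e *m A)).
rewrite ?(dotC F e) ?(dotC (F *m A) (e *m A)).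
have -> : dot (F *m A) e = dot (e *m A) F by rewrite (dot_sym F e tA) dotC.
lra.
Qed.

End dot.

Lemma ae_forall_count d (T : measurableType d) (R : realType)
    (mu : {measure set T -> \bar R}) (I : countType) (P : I -> T -> Prop) :
  (forall i, {ae mu, forall x, P i x}) -> {ae mu, forall x, forall i, P i x}.
Proof.
move=> h.
have : {ae mu, forall x, forall k : nat, if unpickle k is Some i then P i x else True}.
  by apply/ae_foralln => k; case: (unpickle k) => [i|] //; apply: aeW.
by apply: filterS => x hx i; have := hx (pickle i); rewrite pickleK.
Qed.

Lemma cvg_sumr (R : realType) (I : Type) (r : seq I) (a : I -> nat -> R) (l : I -> R) :
  (forall i, a i k @[k --> \oo] --> l i) ->
  \sum_(i <- r) a i k @[k --> \oo] --> \sum_(i <- r) l i.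
Proof.
move=> al; elim: r => [|i r IH].
  by under eq_fun do rewrite big_nil; rewrite big_nil; exact: cvg_cst.
by under eq_fun do rewrite big_cons; rewrite big_cons; exact: cvgD.
Qed.

Section dot_limits.
Context {R : realType} {n : nat}.
Notation rV := 'rV[R]_n.

Lemma continuous_dot_cvg (a b : nat -> rV) (a' b' : rV) :
  (forall i, a k 0 i @[k --> \oo] --> a' 0 i) -> (forall i, b k 0 i @[k --> \oo] --> b' 0 i) ->
  dot (a k) (b k) @[k --> \oo] --> dot a' b'.
Proof.
move=> ha hb; apply: cvg_sumr => i; exact: cvgM.
Qed.

(** A countable family that is dense after scaling. The inequalities tested on it are homogeneous,
    so they extend to all vectors by continuity. *)
Definition int_row (z : 'rV[int]_n) : rV := map_mx intr z.

Lemma int_row_approx (y : rV) : exists z : nat -> 'rV[int]_n,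
  forall j, (hseq k *: int_row (z k)) 0 j @[k --> \oo] --> y 0 j.
Proof.
exists (fun k => \row_j Num.floor (y 0 j / hseq k)) => j.
apply: (@squeeze_cvgr _ _ _ _ (fun k => y 0 j - hseq k) (fun=> y 0 j)); last 2 first.
- rewrite -[X in _ --> X]subr0; apply: cvgB; [exact: cvg_cst|exact: hseq_cvg].
- exact: cvg_cst.
apply: nearW => k; rewrite !mxE; have h0 := @hseq_gt0 R k.
have := floor_itv (y 0 j / hseq k); move: (Num.floor _) => m /andP[h1 h2].
rewrite [_ * m%:~R]mulrC -ler_pdivlMr // h1 andbT.
move: h2; rewrite ltr_pdivrMr // intrD mulrDl mul1r => h2; lra.
Qed.

End dot_limits.

(** * Contractivity of the gradient almost everywhere *)

Section gradient_contraction.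
Context {R : realType} {n : nat}.
Notation rV := 'rV[R]_n.
Variables (s : R) (s0 : 0 < s) (Q : probability rV R).
Hypothesis gQ : gaussian s Q.
Variable f : rV -> rV.
Hypothesis lf : lipschitz1 f.

Lemma lipschitz1_dot w x y : `|dot w (f x) - dot w (f y)| <= enorm w * enorm (x - y).
Proof.
have -> : dot w (f x) - dot w (f y) = dot w (f x - f y).
  by rewrite dotDr dotNr.
apply: le_trans (cauchy_schwarz _ _) _.
by rewrite ler_wpM2l ?enorm_ge0.
Qed.

Lemma explip_component j : explip (fun x => f x 0 j).
Proof.
apply: explip_lipschitz => x y; apply: le_trans (lf x y).
by apply: le_trans (ler_coord_enorm _ j); rewrite !mxE.
Qed.

(** Existence of all partial derivatives only, which is weaker than differentiability at x. *)
Definition differentiable_coords x := forall i j, derivable (fun x => f x 0 j) x (delta_mx 0 i).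

Lemma differentiable_coords_ae : {ae Q, forall x, differentiable_coords x}.
Proof.
have : {ae Q, forall x, forall p : 'I_n * 'I_n, derivable (fun x => f x 0 p.2) x (delta_mx 0 p.1)}.
  by apply: ae_forall_count => p; apply: (explip_derivable_ae gQ); exact: explip_component.
by apply: filterS => x h i j; exact: (h (i, j)).
Qed.

Lemma partial_dot w i x : differentiable_coords x ->
  partial i (fun x => dot w (f x)) x = \sum_j w 0 j * gradmx f x i j.
Proof.
move=> dx; rewrite /partial /dot.
have -> : (fun x => \sum_j w 0 j * f x 0 j) = \sum_j (fun x => w 0 j * f x 0 j).
  by apply/funext => y; rewrite fct_sumE.
rewrite derive_sum => [|j].
  by apply: eq_bigr => j _; rewrite mxE (deriveZ (w 0 j) (dx i j)).
exact: (@derivableZ _ _ _ (fun x => f x 0 j) (w 0 j) x _ (dx i j)).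
Qed.

(** The scalar function [dot w (f x)] is Lipschitz with constant the norm of w, and its gradient
    paired with v is the bilinear form. *)
Lemma contraction_pair_ae v w :
  {ae Q, forall x, dot (v *m gradmx f x) w <= enorm v * enorm w}.
Proof.
have := lipschitz_derive_le s0 gQ v (enorm_ge0 w) (lipschitz1_dot w).
move: differentiable_coords_ae; apply: filterS2 => x dx; rewrite mulrC.
have -> : dot (v *m gradmx f x) w =
    \sum_i v 0 i * partial i (fun x => dot w (f x)) x => //.
rewrite /dot; under eq_bigr => j _ do rewrite mxE mulr_suml.
rewrite exchange_big /=; apply: eq_bigr => i _; rewrite partial_dot // mulr_sumr.
by apply: eq_bigr => j _; rewrite -mulrA (mulrC (gradmx _ _ _ _)).
Qed.

(** The exceptional set must not depend on v and w. It is collected over the countably many pairs of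
    integer vectors, and the rest follows by scaling and limits at a fixed point. *)
Lemma gradmx_contraction_ae : {ae Q, forall x, contraction (gradmx f x)}.
Proof.
pose P (p : 'rV[int]_n * 'rV[int]_n) x :=
  dot (int_row p.1 *m gradmx f x) (int_row p.2) <= enorm (int_row p.1) * enorm (int_row p.2).
have : {ae Q, forall x, forall p, P p x}.
  by apply: ae_forall_count => p; exact: contraction_pair_ae.
apply: filterS => x hx v w.
have [zv zvc] := int_row_approx v; have [zw zwc] := int_row_approx w.
have c1 : dot ((hseq k *: int_row (zv k)) *m gradmx f x) (hseq k *: int_row (zw k)) @[k --> \oo]
    --> dot (v *m gradmx f x) w.
  apply: continuous_dot_cvg => [i|i]; last exact: zwc.
  under eq_fun do rewrite mxE; rewrite mxE; apply: cvg_sumr => j.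
  by apply: cvgM; [exact: zvc|exact: cvg_cst].
have cn (y : nat -> rV) (y' : rV) : (forall i, y k 0 i @[k --> \oo] --> y' 0 i) ->
    enorm (y k) @[k --> \oo] --> enorm y'.
  move=> yc; have c : dot (y k) (y k) @[k --> \oo] --> dot y' y' by exact: continuous_dot_cvg.
  have e (a : rV) : enorm a = Num.sqrt (dot a a).
    by rewrite -enorm_dot sqrtr_sqr ger0_norm ?enorm_ge0.
  under eq_fun do rewrite e; rewrite e.
  exact: (cvg_comp _ _ c (@sqrt_continuous R (dot y' y'))).
have c2 := cvgM (cn _ _ zvc) (cn _ _ zwc).
apply: (ler_cvg_to c1 (c2 _)); apply: nearW => k.
rewrite /= -scalemxAl dotZl dotZr !enormZ [X in _ <= X]mulrACA mulrA.
rewrite !(ger0_norm (ltW (@hseq_gt0 R k))) ler_wpM2l //.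
- by rewrite mulr_ge0 // ltW ?hseq_gt0.
- exact: (hx (zv k, zw k)).
Qed.

End gradient_contraction.

(** * Variance bounds for SURE *)

Section quadratic_family.
Context {R : realType} {n : nat}.
Notation rV := 'rV[R]_n.
Variables (s : R) (s0 : 0 < s) (Q : probability rV R).
Hypothesis gQ : gaussian s Q.
Notation Ex F := (\int[Q]_x F x).
Variable F : rV -> rV.
Hypothesis lF : lipschitz1 F.
Notation A x := (gradmx F x).

Let exF j : explip (fun x => F x 0 j). Proof. exact: explip_component. Qed.

Lemma is_derive_coord i j (x : rV) : is_derive x (delta_mx 0 i) (fun y : rV => y 0 j) (i == j)%:R.
Proof.
have h : (fun h : R => h^-1 *: (((fun y : rV => y 0 j) \o shift x) (h *: delta_mx 0 i) - x 0 j)) @ 0^'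
    --> ((i == j)%:R : R).
  apply: cvg_near_cst; near=> h.
  have h0 : h != 0 by near: h; exact: nbhs_dnbhs_neq.
  by rewrite /= !mxE eqxx /= addrK /GRing.scale /= mulKf // eq_sym.
have d : derivable (fun y : rV => y 0 j) x (delta_mx 0 i) by apply/cvg_ex; eexists; exact: h.
apply: DeriveDef => //.
exact: (cvg_lim (@Rhausdorff R) h).
Unshelve. all: by end_near. Qed.

(* The values (-2, 0, 1, 0, 0) and (-2, 0, 0, 0, 0) give the error of SURE for the
   risk and for the loss, and (-3, 3/2, 1, 1, -1/2) gives SURE + s^2 df, all up to
   additive constants. *)
Variables (al be ga et ze : R).

Definition family_field i x := al * F x 0 i + be * x 0 i.
Definition family_fun x := \sum_j (ga * (F x 0 j * F x 0 j) + et * (x 0 j * F x 0 j) + ze * (x 0 j * x 0 j)).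

Lemma explip_family_field i : explip (family_field i).
Proof. by apply: explipD; apply: explipZ => //; exact: explip_coord. Qed.

Lemma explip_family_fun : explip family_fun.
Proof.
have exX := @explip_coord R n.
by apply: explip_sum => j _; apply: explipD; [apply: explipD|]; apply: explipZ; exact: explipM.
Qed.

Let derF i j x : differentiable_coords F x -> is_derive x (delta_mx 0 i) (fun x => F x 0 j) (A x i j).
Proof. by move=> dx; rewrite mxE; apply: DeriveDef => //; exact: dx. Qed.

Lemma partial_family_field i j x : differentiable_coords F x ->
  partial i (family_field j) x = al * A x i j + be * (i == j)%:R.
Proof.
move=> dx; have d1 := derF i j dx; have d2 := is_derive_coord i j x.
have d := is_deriveD (is_deriveZ al d1) (is_deriveZ be d2).
exact: (@derive_val _ _ _ _ _ _ _ d).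
Qed.

Lemma partial_family_fun i x : differentiable_coords F x ->
  partial i family_fun x = 2 * ga * (\sum_j F x 0 j * A x i j) +
    et * (F x 0 i + \sum_j x 0 j * A x i j) + 2 * ze * x 0 i.
Proof.
move=> dx; have d2 j := is_derive_coord i j x.
have d1 j := derF i j dx.
have d j := is_deriveD (is_deriveD (is_deriveZ ga (is_deriveM (d1 j) (d1 j)))
  (is_deriveZ et (is_deriveM (d2 j) (d1 j)))) (is_deriveZ ze (is_deriveM (d2 j) (d2 j))).
have dS := @is_derive_sum _ _ _ n _ _ _ _ d.
transitivity ('D_(delta_mx 0 i) (\sum_(j < n)
   (ga \*: ((fun x => F x 0 j) * (fun x => F x 0 j)) + et \*: ((fun x : rV => x 0 j) * (fun x => F x 0 j)) +
    ze \*: ((fun x : rV => x 0 j) * (fun x : rV => x 0 j)))) x).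
  by congr ('D_ _ _ _); apply/funext => y; rewrite fct_sumE.
rewrite (@derive_val _ _ _ _ _ _ _ dS) /GRing.scale /=.
have e (g : 'I_n -> R) : \sum_j g j * (i == j)%:R = g i.
  rewrite (bigD1 i) //= eqxx mulr1 big1 ?addr0 // => j /negbTE ji.
  by rewrite eq_sym ji mulr0.
rewrite -(e (F x 0)) -(e (x 0)) -big_split /= !mulr_sumr -!big_split /=.
apply: eq_bigr => j _; move: (F x 0 j) (x 0 j) (A x i j) ((i == j)%:R) => a b c f; ring.
Qed.

(* The value of q + grad k where the gradient of F is symmetric. *)
Definition combined_vector x : rV :=
  (2 * ga) *: (F x *m A x) + (al + et) *: F x + et *: (x *m A x) + (be + 2 * ze) *: x.

Hypothesis psdA : {ae Q, forall x, sym_psd (A x)}.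

Lemma family_variance (H : rV -> R) : tame H ->
  (forall x, sym_psd (A x) -> contraction (A x) ->
     s ^+ 2 * dot (combined_vector x) (combined_vector x) +
     s ^+ 4 * (\sum_i \sum_j (al * A x j i + be * (j == i)%:R) * (al * A x i j + be * (i == j)%:R)) <= H x) ->
  Ex (fun x => stein_sum s family_field family_fun x ^+ 2) -
    Ex (stein_sum s family_field family_fun) ^+ 2 <= Ex H.
Proof.
move=> tH hH; have exk := explip_family_fun; have exq := explip_family_field.
apply: le_trans (variance_bound s0 gQ exq exk) _.
apply: (Ex_ae_le s0 gQ) => //.
  apply: tameD; apply: tameZ; apply: tame_sum => i _.
    by apply: tameX2; apply: tameD; [exact: explip_tame|exact: tame_partial].
  by apply: tame_sum => j _; apply: tameM; exact: tame_partial.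
have := gradmx_contraction_ae s0 gQ lF; have := differentiable_coords_ae gQ lF.
move: psdA; apply: filterS3 => x pA dx cA.
apply: le_trans (hH x pA cA).
rewrite le_eqVlt; apply/orP; left; apply/eqP; congr (_ * _ + _ * _).
  apply: eq_bigr => i _; rewrite expr2; suff -> : family_field i x + partial i family_fun x =
    combined_vector x 0 i by [].
  rewrite partial_family_fun // /family_field !mxE.
  (* Differentiation pairs F with row i of A; symmetry turns this into the row vector
     [F x *m A x]. *)
  have tA j : A x i j = A x j i by case: pA => pt _; rewrite -{1}pt mxE.
  under eq_bigr do rewrite tA; under [\sum_j x 0 j * _]eq_bigr do rewrite tA.
  move: (F x 0 i) (x 0 i) (\sum_j F x 0 j * A x j i) (\sum_j x 0 j * A x j i) => a b c d; ring.
apply: eq_bigr => i _; apply: eq_bigr => j _.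
by rewrite !partial_family_field.
Qed.

Lemma stein_sum_family x : differentiable_coords F x ->
  stein_sum s family_field family_fun x =
  (al + et) * dot x (F x) + ga * dot (F x) (F x) + (be + ze) * dot x x
  - s ^+ 2 * (al * divergence F x + be * n%:R).
Proof.
move=> dx; rewrite /stein_sum /family_fun /divergence /dot.
have -> : (n%:R : R) = \sum_(i < n) 1 by rewrite sumr_const card_ord.
rewrite !mulr_sumr -!big_split /= mulr_sumr -sumrN -!big_split /=; apply: eq_bigr => i _.
rewrite /delta partial_family_field // eqxx mulr1 mxE /family_field.
by move: (F x 0 i) (x 0 i) (partial i _ x) => a b c; ring.
Qed.

End quadratic_family.

Section sure_estimates.
Context {R : realType} {n : nat}.
Notation rV := 'rV[R]_n.
Variables (s : R) (s0 : 0 < s) (Q : probability rV R).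
Hypothesis gQ : gaussian s Q.
Notation Ex F := (\int[Q]_x F x).
Variable F : rV -> rV.
Hypothesis lF : lipschitz1 F.
Notation A x := (gradmx F x).
Hypothesis psdA : {ae Q, forall x, sym_psd (A x)}.

Let exF j : explip (fun x => F x 0 j). Proof. exact: explip_component. Qed.

(** SURE as a function of the noise x: with F x = muhat (mu + x) - mu, the residual y - muhat y is x
    - F x. *)
Definition centered_sure x := dot (x - F x) (x - F x) + 2 * s ^+ 2 * divergence F x - s ^+ 2 * n%:R.

Lemma explip_dot (f g : rV -> rV) : (forall j, explip (fun x => f x 0 j)) ->
  (forall j, explip (fun x => g x 0 j)) -> explip (fun x => dot (f x) (g x)).
Proof. by move=> ef eg; apply: explip_sum => j _; exact: explipM. Qed.

Let tXF : tame (fun x => dot x (F x)).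
Proof. by apply: explip_tame; apply: explip_dot => // j; exact: explip_coord. Qed.
Let tFF : tame (fun x => dot (F x) (F x)).
Proof. by apply: explip_tame; apply: explip_dot. Qed.
Let tXX : tame (fun x : rV => dot x x).
Proof. by apply: explip_tame; apply: explip_dot => j; exact: explip_coord. Qed.

Lemma tame_divergence : tame (divergence F).
Proof. by apply: tame_sum => i _; exact: tame_partial. Qed.

Lemma centered_sureE x : centered_sure x = dot x x - 2 * dot x (F x) + dot (F x) (F x)
  + 2 * s ^+ 2 * divergence F x - s ^+ 2 * n%:R.
Proof.
rewrite /centered_sure !(dotDl, dotDr, dotNl, dotNr) (dotC (F x) x).
by move: (dot _ _) (dot _ _) (dot _ _) (s ^+ 2) => a b c d; ring.
Qed.

Lemma tame_centered_sure : tame centered_sure.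
Proof.
have -> : centered_sure = (fun x => dot x x - 2 * dot x (F x) + dot (F x) (F x)
  + 2 * s ^+ 2 * divergence F x - s ^+ 2 * n%:R) by apply/funext => x; exact: centered_sureE.
apply: tameB; last exact: tame_cst.
apply: tameD; last by apply: tameZ; exact: tame_divergence.
by apply: tameD => //; apply: tameB => //; exact: tameZ.
Qed.

Lemma Ex_dot_self : Ex (fun x : rV => dot x x) = s ^+ 2 * n%:R.
Proof.
rewrite /dot (Ex_sum s0 gQ) => [|i _]; last by apply: tameM; exact: tame_coord.
transitivity (\sum_(i < n) s ^+ 2); last by rewrite sumr_const card_ord mulr_natr.
apply: eq_bigr => i _; have := Ex_delta s0 gQ i (explip_coord i).
have -> : delta s i (fun x : rV => x 0 i) = (fun x => x 0 i * x 0 i - s ^+ 2).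
  apply/funext => x; rewrite /delta /partial.
  by rewrite (@derive_val _ _ _ _ _ _ _ (is_derive_coord i i x)) eqxx mulr1.
rewrite (ExB s0 gQ); [|by apply: tameM; exact: tame_coord|exact: tame_cst].
by rewrite (Ex_cst Q) => /eqP; rewrite subr_eq0 => /eqP.
Qed.

Lemma Ex_dot_stein : Ex (fun x => dot x (F x)) = s ^+ 2 * Ex (divergence F).
Proof.
have tp i := tame_partial i (exF i).
have tx i : tame (fun x => x 0 i * F x 0 i).
  by apply: tameM; [exact: tame_coord|exact: explip_tame].
rewrite /dot /divergence !(Ex_sum s0 gQ) // mulr_sumr; apply: eq_bigr => i _.
have := Ex_delta s0 gQ i (exF i); rewrite /delta (ExB s0 gQ) //; last exact: tameZ.
by rewrite (ExZ s0 gQ) // => /eqP; rewrite subr_eq0 => /eqP.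
Qed.

(** Unbiasedness of SURE: Stein's formula turns the cross term into the divergence correction, and
    the two cancel. *)
Lemma Ex_centered_sure : Ex centered_sure = Ex (fun x => dot (F x) (F x)).
Proof.
have tD := tame_divergence.
under eq_Rintegral do rewrite centered_sureE.
rewrite (ExB s0 gQ); last 2 first.
- by apply: tameD; [apply: tameD => //; apply: tameB => //; exact: tameZ|exact: tameZ].
- exact: tame_cst.
rewrite (ExD s0 gQ); [|by apply: tameD => //; apply: tameB => //; exact: tameZ|exact: tameZ].
rewrite (ExD s0 gQ); [|by apply: tameB => //; exact: tameZ|by []].
rewrite (ExB s0 gQ) //; last exact: tameZ.
rewrite (Ex_cst Q) !(ExZ s0 gQ) // Ex_dot_self Ex_dot_stein.
set a := Ex (fun x => dot (F x) (F x)); set b := Ex (divergence F); ring.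
Qed.

Lemma Ex_divergence_ge0 : 0 <= Ex (divergence F).
Proof.
rewrite -(Ex_cst Q 0); apply: (Ex_ae_le s0 gQ); [exact: tame_cst|exact: tame_divergence|].
move: psdA; apply: filterS => x pA; have := psd_trace_ge0 pA.
by rewrite /mxtrace /divergence; under eq_bigr do rewrite mxE.
Qed.

Let trE x : \tr (A x) = divergence F x.
Proof. by rewrite /mxtrace /divergence; apply: eq_bigr => i _; rewrite mxE. Qed.

(** SURE may be negative, so the pointwise majorant has |F|^2 in its place; the expectations are the
    same. *)
Let Hrisk x := 4 * (s ^+ 2 * dot (F x) (F x) + s ^+ 4 * divergence F x).

Let tHrisk : tame Hrisk.
Proof. by apply: tameZ; apply: tameD; apply: tameZ => //; exact: tame_divergence. Qed.

Let ExHrisk : Ex Hrisk = 4 * Ex (fun x => s ^+ 2 * centered_sure x + s ^+ 4 * divergence F x).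
Proof.
have tD := tame_divergence; have tS := tame_centered_sure.
rewrite /Hrisk (ExZ s0 gQ); last by apply: tameD; exact: tameZ.
congr (_ * _); rewrite !(ExD s0 gQ); try exact: tameZ.
by rewrite !(ExZ s0 gQ) // Ex_centered_sure.
Qed.

Let trace_family (al be : R) x : sym_psd (A x) -> contraction (A x) ->
  \sum_i \sum_j (al * A x j i + be * (j == i)%:R) * (al * A x i j + be * (i == j)%:R) <=
  al ^+ 2 * divergence F x + 2 * al * be * divergence F x + be ^+ 2 * n%:R.
Proof.
move=> pA cA.
have -> : \sum_i \sum_j (al * A x j i + be * (j == i)%:R) * (al * A x i j + be * (i == j)%:R) =
    al ^+ 2 * (\sum_i \sum_j A x j i * A x i j) + 2 * al * be * divergence F x + be ^+ 2 * n%:R.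
  have -> : (n%:R : R) = \sum_(i < n) 1 by rewrite sumr_const card_ord.
  rewrite -trE /mxtrace !mulr_sumr -!big_split /=; apply: eq_bigr => i _.
  rewrite (bigD1 i) //= [in RHS](bigD1 i) //= eqxx.
  rewrite (eq_bigr (fun j => al ^+ 2 * (A x j i * A x i j))) => [|j /negbTE ji].
    rewrite -mulr_sumr /= !mulr1n; move: (A x i i) (\sum_(_ < n | _) _) => a b; ring.
  by rewrite ji eq_sym ji /= mulr0n; ring.
rewrite !lerD2r ler_wpM2l ?sqr_ge0 // -trE; exact: contraction_trace_sqr.
Qed.

(** For ga = 0 the combined vector is - 2 F and for ga = 1 it is - 2 (F - FA); either way its square
    is at most 4 |F|^2. *)
Let family_bound (ga : R) x : ga = 0 \/ ga = 1 -> sym_psd (A x) -> contraction (A x) ->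
  s ^+ 2 * dot (combined_vector F (-2) 0 ga 0 0 x) (combined_vector F (-2) 0 ga 0 0 x) +
  s ^+ 4 * (\sum_i \sum_j (-2 * A x j i + 0 * (j == i)%:R) * (-2 * A x i j + 0 * (i == j)%:R)) <= Hrisk x.
Proof.
move=> ga01 pA cA; have h := trace_family (-2) 0 pA cA.
have e : dot (combined_vector F (-2) 0 ga 0 0 x) (combined_vector F (-2) 0 ga 0 0 x) <=
    4 * dot (F x) (F x).
  rewrite /combined_vector !(mulr0, addr0, scale0r).
  case: ga01 => ->.
    rewrite mulr0 scale0r add0r !(dotZl, dotZr) mulrA.
    by have := dot_ge0 (F x); lra.
  have := sub_contraction_sqr pA cA (F x); rewrite mulr1.
  rewrite !(dotDl, dotDr, dotZl, dotZr, dotNl, dotNr) (dotC (F x) (F x *m A x)).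
  by move: (dot _ _) (dot _ _) (dot _ _) => a b c; lra.
have s2 : 0 <= s ^+ 2 by exact: sqr_ge0.
have s4 : 0 <= s ^+ 4 by rewrite exprn_ge0 // ltW.
rewrite /Hrisk; apply: (le_trans (lerD (ler_wpM2l s2 e) (ler_wpM2l s4 h))).
move: (dot _ _) (divergence F x) (s ^+ 2) (s ^+ 4) => a b c d.
by rewrite le_eqVlt; apply/orP; left; apply/eqP; ring.
Qed.

Definition sure_risk_gap x := centered_sure x - Ex (fun x => dot (F x) (F x)) + (n%:R * s ^+ 2 - dot x x).

Definition sure_loss_gap x := centered_sure x - dot (F x) (F x) + (n%:R * s ^+ 2 - dot x x).

(** T differs from a Stein sum by the constant c almost everywhere, so E T = 0 makes E T^2 the
    variance of that sum. The risk has ga = 1 and the loss ga = 0. *)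
Let gap_variance (ga c : R) (T : rV -> R) : ga = 0 \/ ga = 1 -> tame T ->
  (forall x, T x = -2 * dot x (F x) + ga * dot (F x) (F x) + 2 * s ^+ 2 * divergence F x - c) ->
  Ex T = 0 -> Ex (fun x => T x ^+ 2) <= 4 * Ex (fun x => s ^+ 2 * centered_sure x + s ^+ 4 * divergence F x).
Proof.
move=> ga01 tT TE T0.
have h := family_variance s0 gQ lF psdA tHrisk (fun x => @family_bound ga x ga01).
rewrite -ExHrisk; apply: le_trans h.
pose W := stein_sum s (family_field F (-2) 0) (family_fun F ga 0 0).
have tW : tame W.
  apply: tameD; last by apply: explip_tame; exact: explip_family_fun.
  by apply: tame_sum => i _; apply: tame_delta; exact: explip_family_field.
have WT : {ae Q, forall x, W x = T x + c}.
  have := differentiable_coords_ae gQ lF; apply: filterS => x dx.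
  rewrite /W stein_sum_family // TE; move: (dot _ _) (dot _ _) (dot _ _) (divergence F x) => a b e f; ring.
have EW : Ex W = c.
  rewrite (Ex_ae_eq tW (tameD tT (tame_cst c)) WT) (ExD s0 gQ) //; last exact: tame_cst.
  by rewrite (Ex_cst Q) T0 add0r.
have EW2 : Ex (fun x => W x ^+ 2) = Ex (fun x => T x ^+ 2) + c ^+ 2.
  have t1 : tame (fun x => T x ^+ 2 + 2 * c * T x + c ^+ 2).
    by apply: tameD; [apply: tameD; [exact: tameX2|exact: tameZ]|exact: tame_cst].
  rewrite (Ex_ae_eq (tameX2 tW) t1); last first.
    by move: WT; apply: filterS => x ->; ring.
  rewrite (ExD s0 gQ); [|by apply: tameD; [exact: tameX2|exact: tameZ]|exact: tame_cst].
  rewrite (ExD s0 gQ); [|exact: tameX2|exact: tameZ].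
  by rewrite (ExZ s0 gQ) // T0 mulr0 addr0 (Ex_cst Q).
by rewrite -/W EW2 EW addrK.
Qed.

Lemma tame_sure_risk_gap : tame sure_risk_gap.
Proof.
apply: tameD; first by apply: tameB; [exact: tame_centered_sure|exact: tame_cst].
by apply: tameB => //; exact: tame_cst.
Qed.

Lemma tame_sure_loss_gap : tame sure_loss_gap.
Proof.
apply: tameD; first by apply: tameB; [exact: tame_centered_sure|].
by apply: tameB => //; exact: tame_cst.
Qed.

Lemma Ex_sure_risk_gap : Ex sure_risk_gap = 0.
Proof.
rewrite /sure_risk_gap (ExD s0 gQ); last 2 first.
- by apply: tameB; [exact: tame_centered_sure|exact: tame_cst].
- by apply: tameB => //; exact: tame_cst.
rewrite (ExB s0 gQ tame_centered_sure (tame_cst _)) (ExB s0 gQ (tame_cst _) tXX).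
by rewrite !(Ex_cst Q) Ex_centered_sure Ex_dot_self subrr add0r mulrC subrr.
Qed.

Lemma Ex_sure_loss_gap : Ex sure_loss_gap = 0.
Proof.
rewrite /sure_loss_gap (ExD s0 gQ); last 2 first.
- by apply: tameB; [exact: tame_centered_sure|].
- by apply: tameB => //; exact: tame_cst.
rewrite (ExB s0 gQ tame_centered_sure tFF) (ExB s0 gQ (tame_cst _) tXX).
by rewrite !(Ex_cst Q) Ex_centered_sure Ex_dot_self subrr add0r mulrC subrr.
Qed.

Lemma sure_risk_gap_variance :
  Ex (fun x => sure_risk_gap x ^+ 2) <= 4 * Ex (fun x => s ^+ 2 * centered_sure x + s ^+ 4 * divergence F x).
Proof.
apply: (gap_variance (ga := 1) (c := Ex (fun x => dot (F x) (F x)))).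
- by right.
- exact: tame_sure_risk_gap.
- by move=> x; rewrite /sure_risk_gap centered_sureE; ring.
- exact: Ex_sure_risk_gap.
Qed.

Lemma sure_loss_gap_variance :
  Ex (fun x => sure_loss_gap x ^+ 2) <= 4 * Ex (fun x => s ^+ 2 * centered_sure x + s ^+ 4 * divergence F x).
Proof.
apply: (gap_variance (ga := 0) (c := 0)).
- by left.
- exact: tame_sure_loss_gap.
- by move=> x; rewrite /sure_loss_gap centered_sureE; ring.
- exact: Ex_sure_loss_gap.
Qed.

Definition sure_df x := centered_sure x + s ^+ 2 * divergence F x.

Lemma tame_sure_df : tame sure_df.
Proof. by apply: tameD; [exact: tame_centered_sure|apply: tameZ; exact: tame_divergence]. Qed.

Lemma Ex_sure_df : Ex sure_df = Ex (fun x => dot (F x) (F x)) + s ^+ 2 * Ex (divergence F).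
Proof.
have tD := tame_divergence; have tS := tame_centered_sure.
rewrite /sure_df (ExD s0 gQ) //; last exact: tameZ.
by rewrite (ExZ s0 gQ) // Ex_centered_sure.
Qed.

Lemma Ex_sure_df_ge0 : 0 <= Ex sure_df.
Proof.
rewrite Ex_sure_df addr_ge0 //; first by apply: Ex_ge0 => x; exact: dot_ge0.
by rewrite mulr_ge0 ?sqr_ge0 // Ex_divergence_ge0.
Qed.

(** Matching 3 s^2 df, x.F and F.F forces al = -3, et = 1 and ga = 1; only the split be + ze = 1 is
    free. The choice be = 3/2 cancels the divergence in [trace_family], where al^2 + 2 al be = 9 -
    9. *)
Lemma sure_df_variance : Ex (fun x => sure_df x ^+ 2) - Ex sure_df ^+ 2 <=
  4 * s ^+ 2 * Ex sure_df + 6 * s ^+ 4 * n%:R.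
Proof.
have tD := tame_divergence.
pose H x := s ^+ 2 * (4 * dot (x - F x) (x - F x) - 6 * dot (x - F x) x + (9 / 2) * dot x x) +
  s ^+ 4 * (9 / 4) * n%:R.
have HE x : H x = s ^+ 2 * (5 / 2 * dot x x - 2 * dot x (F x) + 4 * dot (F x) (F x)) + s ^+ 4 * (9 / 4) * n%:R.
  rewrite /H !(dotDl, dotDr, dotNl, dotNr) (dotC (F x) x).
  by move: (dot _ _) (dot _ _) (dot _ _) => a b c; field.
have t1 : tame (fun x => 5 / 2 * dot x x - 2 * dot x (F x)) by apply: tameB; exact: tameZ.
have t2 : tame (fun x => 5 / 2 * dot x x - 2 * dot x (F x) + 4 * dot (F x) (F x)).
  by apply: tameD => //; exact: tameZ.
have tH : tame H.
  rewrite (_ : H = (fun x => s ^+ 2 *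
    (5 / 2 * dot x x - 2 * dot x (F x) + 4 * dot (F x) (F x)) + s ^+ 4 * (9 / 4) * n%:R)).
    by apply: tameD; [exact: tameZ|exact: tame_cst].
  by apply/funext => x; exact: HE.
have EH : Ex H = s ^+ 2 * (5 / 2 * (s ^+ 2 * n%:R) - 2 * (s ^+ 2 * Ex (divergence F)) +
   4 * Ex (fun x => dot (F x) (F x))) + s ^+ 4 * (9 / 4) * n%:R.
  under eq_Rintegral do rewrite HE.
  rewrite (ExD s0 gQ); [|exact: tameZ|exact: tame_cst].
  rewrite (Ex_cst Q) (ExZ s0 gQ) // (ExD s0 gQ) //; last exact: tameZ.
  rewrite (ExB s0 gQ); [|exact: tameZ|exact: tameZ].
  by rewrite !(ExZ s0 gQ) // Ex_dot_self Ex_dot_stein.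
have hb x : sym_psd (A x) -> contraction (A x) ->
  s ^+ 2 * dot (combined_vector F (-3) (3 / 2) 1 1 (- 2^-1) x) (combined_vector F (-3) (3 / 2) 1 1 (- 2^-1) x) +
  s ^+ 4 * (\sum_i \sum_j (-3 * A x j i + 3 / 2 * (j == i)%:R) * (-3 * A x i j + 3 / 2 * (i == j)%:R)) <= H x.
  move=> pA cA; have h := trace_family (-3) (3 / 2) pA cA.
  have e := combined_contraction pA cA (F x) x.
  have s2 : 0 <= s ^+ 2 by exact: sqr_ge0.
  have s4 : 0 <= s ^+ 4 by rewrite exprn_ge0 // ltW.
  have -> : combined_vector F (-3) (3 / 2) 1 1 (- 2^-1) x =
     2 *: (F x *m A x) + (-2) *: F x + x *m A x + 2^-1 *: x.
    have e1 : (-3 + 1 : R) = -2 by lra.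
    have e2 : (3 / 2 + 2 * - 2^-1 : R) = 2^-1 by lra.
    by rewrite /combined_vector mulr1 scale1r e1 e2.
  rewrite /H; apply: (le_trans (lerD (ler_wpM2l s2 e) (ler_wpM2l s4 h))).
  rewrite lerD2l -[s ^+ 4 * _ * _]mulrA ler_wpM2l //.
  by move: (divergence F x) (n%:R : R) => a b; lra.
have h := family_variance s0 gQ lF psdA tH hb.
pose W := stein_sum s (family_field F (-3) (3 / 2)) (family_fun F 1 1 (- 2^-1)).
have tW : tame W.
  apply: tameD; last by apply: explip_tame; exact: explip_family_fun.
  by apply: tame_sum => i _; apply: tame_delta; exact: explip_family_field.
have tS := tame_sure_df.
pose c : R := - (2^-1 * (s ^+ 2 * n%:R)).
have WS : {ae Q, forall x, W x = sure_df x + c}.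
  have := differentiable_coords_ae gQ lF; apply: filterS => x dx.
  rewrite /W stein_sum_family // /sure_df centered_sureE /c.
  by move: (dot _ _) (dot _ _) (dot _ _) (divergence F x) => a b e f; field.
have EW : Ex W = Ex sure_df + c.
  rewrite (Ex_ae_eq tW (tameD tS (tame_cst c)) WS) (ExD s0 gQ) //; last exact: tame_cst.
  by rewrite (Ex_cst Q).
have EW2 : Ex (fun x => W x ^+ 2) = Ex (fun x => sure_df x ^+ 2) + 2 * c * Ex sure_df + c ^+ 2.
  have t3 : tame (fun x => sure_df x ^+ 2 + 2 * c * sure_df x + c ^+ 2).
    by apply: tameD; [apply: tameD; [exact: tameX2|exact: tameZ]|exact: tame_cst].
  rewrite (Ex_ae_eq (tameX2 tW) t3); last first.
    by move: WS; apply: filterS => x ->; ring.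
  rewrite (ExD s0 gQ); [|by apply: tameD; [exact: tameX2|exact: tameZ]|exact: tame_cst].
  rewrite (ExD s0 gQ); [|exact: tameX2|exact: tameZ].
  by rewrite (ExZ s0 gQ) // (Ex_cst Q).
move: h; rewrite -/W EW2 EW EH => h.
have -> : Ex (fun x => sure_df x ^+ 2) - Ex sure_df ^+ 2 =
  Ex (fun x => sure_df x ^+ 2) + 2 * c * Ex sure_df + c ^+ 2 - (Ex sure_df + c) ^+ 2 by ring.
apply: le_trans h _; rewrite Ex_sure_df.
have := Ex_divergence_ge0; set a := Ex (fun x => dot (F x) (F x)); set b := Ex (divergence F) => b0.
have a0 : 0 <= a by apply: Ex_ge0 => x; exact: dot_ge0.
have s4 : 0 <= s ^+ 4 by rewrite exprn_ge0 // ltW.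
have s4b : 0 <= s ^+ 4 * b by rewrite mulr_ge0.
have s4n : 0 <= s ^+ 4 * n%:R by rewrite mulr_ge0.
have e4 : s ^+ 2 * s ^+ 2 = s ^+ 4 by rewrite -exprD.
(* Once 4 s^2 a cancels, s^4 (19/4 n - 2 b) <= s^4 (4 b + 6 n) remains, which holds as b >= 0. *)
rewrite !(mulrDr, mulrBr, mulrN) -?mulrA.
nra.
Qed.

End sure_estimates.

(** * Concentration *)

Section gaussian_law.
Context {R : realType}.

Lemma normal_prob_scale (s : R) (B : set R) : 0 < s -> measurable B ->
  normal_prob 0 s [set t | B (t / s)] = normal_prob 0 1 B.
Proof.
move=> s0 mB.
have mV : measurable [set t : R | B (t / s)].
  have ms : measurable_fun setT (fun t : R => t / s) by exact: measurable_funM.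
  by rewrite -[X in measurable X]setTI; exact: (ms measurableT B mB).
have E (r : R) (V : set R) : 0 < r -> measurable V ->
    normal_prob 0 r V = (\int[lebesgue_measure]_x ((\1_V x)%:E * (normal_pdf 0 r x)%:E))%E.
  move=> r0 mV'; rewrite -(@ge0_integral_normal _ r) //.
  - by rewrite integral_indic // setIT.
  - by apply/measurable_EFinP; exact: measurable_indic.
rewrite (E _ _ s0 mV) (E _ _ ltr01 mB).
have mpdf (r : R) : measurable_fun setT (fun x => (normal_pdf 0 r x)%:E).
  by apply/measurable_EFinP; exact: measurable_normal_pdf.
have mf : measurable_fun setT (fun x : R => ((\1_[set t | B (t / s)] x)%:E * (normal_pdf 0 s x)%:E)%E).
  by apply: emeasurable_funM => //; apply/measurable_EFinP; exact: measurable_indic.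
rewrite (ge0_integral_affine 0 s0 mf); last first.
  by move=> x; rewrite mule_ge0 // lee_fin // normal_pdf_ge0.
rewrite -ge0_integralZl //.
- apply: eq_integral => x _; rewrite addr0 -!EFinM; congr EFin.
  rewrite !normal_pdf_centerE ?ltr01 //.
  have -> : \1_[set t | B (t / s)] (s * x) = \1_B x :> R.
    have xs : s * x / s = x by rewrite mulrAC divff ?mul1r // gt_eqF.
    suff e : (s * x \in [set t | B (t / s)]) = (x \in B) by rewrite !indicE e.
    by apply/idP/idP; rewrite !inE /= xs.
  have -> : normal_peak s = normal_peak 1 / s.
    rewrite /normal_peak expr1n mul1r -mulrnAr sqrtrM ?sqr_ge0 // sqrtr_sqr gtr0_norm //.
    by rewrite invfM mulrC.
  have -> : - (s * x) ^+ 2 / (s ^+ 2 *+ 2) = - x ^+ 2 / (1 ^+ 2 *+ 2).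
    by field; rewrite gt_eqF.
  by field; rewrite gt_eqF.
- have := measurableT_comp mf (_ : measurable_fun setT (fun x : R => s * x + 0)); apply.
  by apply: measurable_funD => //; exact: measurable_funM.
- by move=> x _; rewrite mule_ge0 // lee_fin // normal_pdf_ge0.
- by rewrite lee_fin ltW.
Qed.

Context {n : nat}.
Notation rV := 'rV[R]_n.

Lemma centered_normal_measurable d (T : measurableType d) (P : probability T R) s
    (Z : T -> rV) : centered_normal P s Z -> measurable_fun setT Z.
Proof. by case=> mZ _ _; exact: measurable_rV. Qed.

Lemma centered_normal_gaussian d (T : measurableType d) (P : probability T R) s
    (Z : T -> rV) : centered_normal P s Z -> gaussian s (pushforward P Z).
Proof.
case=> mZ lZ iZ B mB; rewrite /pushforward.
rewrite -[LHS]/(P [set w | forall i, B i (Z w 0 i)]) iZ //.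
by apply: eq_bigr => i _; exact: lZ.
Qed.

Lemma measurable_enorm_sqr : measurable_fun setT (fun x : rV => enorm x ^+ 2).
Proof.
under eq_fun do rewrite enormE2; apply: measurable_sum => i.
by apply: measurable_funX; exact: measurable_coord.
Qed.

(** Scaling by 1/s gives a law with the same values on boxes as Q1, hence the same law. This links
    the noise to a chi-square variable realized on another space. *)
Lemma gaussian_enorm_law s (Q Q1 : probability rV R) (B : set R) : 0 < s ->
  gaussian s Q -> gaussian 1 Q1 -> measurable B ->
  Q [set x | B (enorm x ^+ 2 / s ^+ 2)] = Q1 [set x | B (enorm x ^+ 2)].
Proof.
move=> s0 gQ gQ1 mB.
have ms : measurable_fun setT (fun x : rV => s^-1 *: x).
  apply: measurable_rV => i; under eq_fun do rewrite mxE.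
  by apply: measurable_funM => //; exact: measurable_coord.
pose m2 := measure_function_pushforward__canonical__measure_function_Measure Q ms.
have -> : [set x : rV | B (enorm x ^+ 2 / s ^+ 2)] = (fun x : rV => s^-1 *: x) @^-1` [set x | B (enorm x ^+ 2)].
  apply/seteqP; split => x /=; rewrite enormZ exprMn ger0_norm ?invr_ge0 ?(ltW s0) // exprVn mulrC //.
have mE : measurable [set x : rV | B (enorm x ^+ 2)].
  by rewrite -[X in measurable X]setTI; exact: (measurable_enorm_sqr measurableT mB).
change (m2 [set x : rV | B (enorm x ^+ 2)] = Q1 [set x : rV | B (enorm x ^+ 2)]).
apply/esym; apply: (@rbox_measure_unique R n Q1 m2) => //.
  by rewrite [X in (X < _)%E](@probability_setT _ _ _ Q1) ltry.
move=> C mC; rewrite [LHS]gQ1 // /m2 /= /pushforward.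
have -> : (fun x : rV => s^-1 *: x) @^-1` rbox C = rbox (fun i => [set t | C i (t / s)]).
  by apply/seteqP; split => x /= h i; have := h i; rewrite /= mxE mulrC.
rewrite [RHS]gQ => [|i]; last first.
  have ms' : measurable_fun setT (fun t : R => t / s) by exact: measurable_funM.
  by rewrite -[X in measurable X]setTI; exact: (ms' measurableT _ (mC i)).
by apply: eq_bigr => i _; rewrite normal_prob_scale.
Qed.

End gaussian_law.

Section psd.
Context {R : realType} {n : nat}.
Notation rV := 'rV[R]_n.

Lemma sym_psd_int (A : 'M[R]_n) : (forall i j, A i j = A j i) ->
  (forall z : 'rV[int]_n, 0 <= dot (int_row z *m A) (int_row z)) -> sym_psd A.
Proof.
move=> sA pA; split; first by apply/matrixP => i j; rewrite mxE sA.
move=> v; rewrite -dotE.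
have [z zv] := int_row_approx v.
have c : dot ((hseq k *: int_row (z k)) *m A) (hseq k *: int_row (z k)) @[k --> \oo] --> dot (v *m A) v.
  apply: continuous_dot_cvg => [i|i]; last exact: zv.
  under eq_fun do rewrite mxE; rewrite mxE; apply: cvg_sumr => j.
  by apply: cvgM; [exact: zv|exact: cvg_cst].
rewrite -(cvg_lim (@Rhausdorff R) c); apply: limr_ge; first by apply/cvg_ex; eexists; exact: c.
apply: nearW => k; rewrite -scalemxAl dotZl dotZr mulrA mulr_ge0 ?pA //.
by rewrite mulr_ge0 // ltW ?hseq_gt0.
Qed.

Lemma measurable_gradmx (F : rV -> rV) i j : lipschitz1 F ->
  measurable_fun setT (fun x => gradmx F x i j).
Proof.
move=> lF; under eq_fun do rewrite mxE; apply: measurable_partial; exact: explip_component.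
Qed.

(* The event that the gradient is not symmetric positive semi-definite is
   replaced by a measurable one, testing integer vectors only. *)
Lemma sym_psd_transfer d (T : measurableType d) (P : probability T R) (Z : T -> rV)
    (Q : {measure set rV -> \bar R}) (F : rV -> rV) : measurable_fun setT Z ->
  (forall A, measurable A -> Q A = P (Z @^-1` A)) -> lipschitz1 F ->
  {ae P, forall w, sym_psd (gradmx F (Z w))} -> {ae Q, forall x, sym_psd (gradmx F x)}.
Proof.
move=> mZ QP lF psd.
have transfer (E : set rV) : measurable E -> (forall x, E x -> ~ sym_psd (gradmx F x)) -> Q E = 0%E.
  move=> mE nE; rewrite QP //; apply/eqP; rewrite eq_le measure_ge0 andbT.
  case: psd => N [mN N0 sub]; rewrite -N0; apply: le_measure; rewrite ?inE //.
    by rewrite -[X in measurable X]setTI; exact: mZ.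
  by move=> w /= Ew; apply: sub; exact: nE.
have h1 (p : 'I_n * 'I_n) : {ae Q, forall x, gradmx F x p.1 p.2 = gradmx F x p.2 p.1}.
  have mE : measurable [set x | gradmx F x p.1 p.2 - gradmx F x p.2 p.1 != 0].
    rewrite (_ : [set x | _] = (fun x => gradmx F x p.1 p.2 - gradmx F x p.2 p.1) @^-1` (~` [set 0])).
      rewrite -[X in measurable X]setTI; apply: measurable_funB => //.
      - exact: measurable_gradmx.
      - exact: measurable_gradmx.
      - by apply: measurableC; exact: measurable_set1.
    by apply/seteqP; split => x /= /eqP.
  exists [set x | gradmx F x p.1 p.2 - gradmx F x p.2 p.1 != 0]; split => //.
  - apply: transfer => // x /= /eqP h [sA _]; apply: h; rewrite -{1}sA mxE subrr //.
  - by move=> x /= h; rewrite subr_eq0; apply/eqP.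
have h2 (z : 'rV[int]_n) : {ae Q, forall x, 0 <= dot (int_row z *m gradmx F x) (int_row z)}.
  have md : measurable_fun setT (fun x => dot (int_row z *m gradmx F x) (int_row z)).
    apply: measurable_sum => i; apply: measurable_funM => //.
    under eq_fun do rewrite mxE; apply: measurable_sum => j; apply: measurable_funM => //.
    exact: measurable_gradmx.
  have mE : measurable [set x | dot (int_row z *m gradmx F x) (int_row z) < 0].
    rewrite (_ : [set x | _] = (fun x => dot (int_row z *m gradmx F x) (int_row z)) @^-1` `]-oo, 0[).
      by rewrite -[X in measurable X]setTI; exact: md.
    by apply/seteqP; split => x /=; rewrite in_itv.
  exists [set x | dot (int_row z *m gradmx F x) (int_row z) < 0]; split => //.
  - apply: transfer => // x /= h [_ /(_ (int_row z))]; rewrite -dotE leNgt h //.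
  - by move=> x /= /negP; rewrite -ltNge.
move: (ae_forall_count h1) (ae_forall_count h2); apply: filterS2 => x e1 e2.
by apply: sym_psd_int => // i j; exact: (e1 (i, j)).
Qed.

End psd.

(** * Normalized deviations and the quadratic inequality *)

Section normalization.
Context {R : realType} {n : nat}.
Notation rV := 'rV[R]_n.
Variables (s : R) (s0 : 0 < s) (Q : probability rV R).
Hypothesis gQ : gaussian s Q.
Notation Ex F := (\int[Q]_x F x).

(** If E W^2 = 0 there is nothing to divide by. Then W = 0 almost everywhere, and the constant 1
    keeps the second moment of X equal to 1. *)
Lemma normalize (W : rV -> R) : tame W -> exists X : rV -> R,
  [/\ tame X, forall x, 0 <= X x, Ex (fun x => X x ^+ 2) = 1 &
      {ae Q, forall x, `|W x| <= X x * Num.sqrt (Ex (fun x => W x ^+ 2))}].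
Proof.
move=> tW; have tW2 := tameX2 tW.
have E0 : 0 <= Ex (fun x => W x ^+ 2) by apply: Ex_ge0 => x; exact: sqr_ge0.
have [E00|E00] := eqVneq (Ex (fun x => W x ^+ 2)) 0.
  exists (fun=> 1); split => //; first exact: tame_cst.
    by under eq_Rintegral do rewrite expr1n; exact: Ex_cst.
  have : ae_eq Q setT (fun x => (W x ^+ 2)%:E) (cst 0%E).
    apply/(ae_eq_integral_abs _ measurableT); first by apply/measurable_EFinP; case: tW2.
    transitivity ((\int[Q]_x (W x ^+ 2)%:E)%E); last by rewrite (EFin_Ex s0 gQ tW2) E00.
    by apply: eq_integral => x _ /=; rewrite ger0_norm ?sqr_ge0.
  apply: filterS => x /(_ I) [/eqP]; rewrite sqrf_eq0 => /eqP ->.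
  by rewrite normr0 mul1r sqrtr_ge0.
set e := Ex (fun x => W x ^+ 2) in E0 E00 *.
have e0 : 0 < Num.sqrt e by rewrite sqrtr_gt0 lt_neqAle eq_sym E00.
exists (fun x => (Num.sqrt e)^-1 * `|W x|); split.
- by apply: tameZ; exact: tame_norm.
- by move=> x; rewrite mulr_ge0 ?invr_ge0 ?sqrtr_ge0.
- have h x : ((Num.sqrt e)^-1 * `|W x|) ^+ 2 = e^-1 * W x ^+ 2.
    by rewrite exprMn exprVn sqr_sqrtr // real_normK ?num_real.
  by under eq_Rintegral do rewrite h; rewrite (ExZ s0 gQ) // -/e mulVf.
- by apply: aeW => x; rewrite mulrAC mulVf ?mul1r // gt_eqF.
Qed.

End normalization.

Lemma sqrtr_le (R : realType) (a c : R) : 0 <= c -> a <= c ^+ 2 -> Num.sqrt a <= c.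
Proof. by move=> c0 h; rewrite -(ger0_norm c0) -sqrtr_sqr ler_wsqrtr. Qed.

Lemma powR4_sqr (R : realType) (x : R) : 0 <= x -> (x `^ (4^-1)) ^+ 2 = Num.sqrt x.
Proof.
move=> x0; rewrite -powR_mulrn ?powR_ge0 // -powRrM.
have -> : 4^-1 * 2%:R = 2^-1 :> R by lra.
by rewrite powR12_sqrt.
Qed.

(* The hypotheses give z ^+ 2 <= g + b * (z + sqrt 6), g and b being the first
   radicand and the second term of the conclusion. *)
Lemma quadratic_estimate (R : realType) (N s z Y S a : R) : 0 < N -> 0 < s -> 0 <= z -> 0 <= Y ->
  z ^+ 2 = 4 * a / (N * s ^+ 2) ->
  `|S - a| <= Y * (Num.sqrt N * s ^+ 2 * (z + Num.sqrt 6)) ->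
  z <= Num.sqrt (4 * Num.max (S / (N * s ^+ 2)) 0) + 4 * Y / Num.sqrt N +
       Num.sqrt (4 * Y) * (6 / N) `^ (4^-1).
Proof.
move=> N0 s0 z0 Y0 za Sa.
set g := 4 * Num.max _ _; set t := _ * (_ `^ _); set b := 4 * Y / Num.sqrt N.
have g0 : 0 <= g by rewrite mulr_ge0 // le_max lexx orbT.
have rN : 0 < Num.sqrt N by rewrite sqrtr_gt0.
have b0 : 0 <= b by rewrite divr_ge0 ?mulr_ge0 // ltW.
have t0 : 0 <= t by rewrite mulr_ge0 ?sqrtr_ge0 ?powR_ge0.
have q0 : 0 <= Num.sqrt g by exact: sqrtr_ge0.
have qg : Num.sqrt g ^+ 2 = g by rewrite sqr_sqrtr.
have tc : t ^+ 2 = b * Num.sqrt 6.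
  rewrite /t exprMn sqr_sqrtr ?mulr_ge0 // powR4_sqr; last by rewrite divr_ge0 // ltW.
  by rewrite sqrtrM // sqrtrV ?ltW // /b; field; rewrite gt_eqF.
have NN : Num.sqrt N ^+ 2 = N by rewrite sqr_sqrtr // ltW.
have Ns : 0 < N * s ^+ 2 by rewrite mulr_gt0 ?exprn_gt0.
have h : z ^+ 2 <= g + b * (z + Num.sqrt 6).
  have -> : b * (z + Num.sqrt 6) = 4 * (Y * (Num.sqrt N * s ^+ 2 * (z + Num.sqrt 6))) / (N * s ^+ 2).
    have -> : N * s ^+ 2 = Num.sqrt N ^+ 2 * s ^+ 2 by rewrite NN.
    by rewrite /b; field; apply/andP; split; rewrite gt_eqF.
  have h1 : 4 * (S / (N * s ^+ 2)) <= g by rewrite /g ler_wpM2l // le_max lexx.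
  apply: (@le_trans _ _ (4 * (S / (N * s ^+ 2)) + 4 * `|S - a| / (N * s ^+ 2))); last first.
    by apply: lerD => //; rewrite ler_wpM2r ?invr_ge0 ?(ltW Ns) // ler_wpM2l.
  rewrite za mulrA -mulrDl ler_wpM2r ?invr_ge0 ?(ltW Ns) //.
  by have := ler_norm (a - S); rewrite distrC; lra.
(* Otherwise z (z - b) > (sqrt g + t)^2 >= g + t^2, whereas [h] and t^2 = b sqrt 6 give z (z - b) <=
   g + t^2. *)
rewrite leNgt; apply/negP => hz.
have : (Num.sqrt g + t) ^+ 2 < z * (z - b).
  rewrite expr2; apply: ltr_pM; rewrite ?addr_ge0 //; lra.
have := mulr_ge0 q0 t0; nra.
Qed.

Section sure_bound.
Context {R : realType} {n : nat}.
Notation rV := 'rV[R]_n.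
Variables (s : R) (s0 : 0 < s) (Q : probability rV R).
Hypothesis gQ : gaussian s Q.
Notation Ex F := (\int[Q]_x F x).
Variable F : rV -> rV.
Hypothesis (n0 : (0 < n)%N) (lF : lipschitz1 F).
Hypothesis psdA : {ae Q, forall x, sym_psd (gradmx F x)}.

(** z is the square root of gammahat with S replaced by its mean; [quadratic_estimate] trades it for
    the random one at the cost of the terms in Y. *)
Lemma sure_bound (Z : rV -> R) : tame Z ->
  Ex (fun x => Z x ^+ 2) <= 4 * s ^+ 2 * Ex (sure_df s F) ->
  exists X Y : rV -> R, [/\ tame X /\ tame Y, (forall x, 0 <= X x) /\ (forall x, 0 <= Y x),
    Ex (fun x => X x ^+ 2) = 1, Ex (fun x => Y x ^+ 2) = 1 &
    {ae Q, forall x, `|Z x| / (s ^+ 2 * Num.sqrt n%:R) <=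
      X x * (Num.sqrt (4 * Num.max (sure_df s F x / (n%:R * s ^+ 2)) 0) + 4 * Y x / Num.sqrt n%:R +
       Num.sqrt (4 * Y x) * (6 / n%:R) `^ (4^-1))}].
Proof.
move=> tZ hZ; set a := Ex (sure_df s F) in hZ.
have N0 : 0 < n%:R :> R by rewrite ltr0n.
have a0 : 0 <= a by exact: Ex_sure_df_ge0.
have tS : tame (sure_df s F) := tame_sure_df s lF.
have tW : tame (fun x => sure_df s F x - a) by apply: tameB => //; exact: tame_cst.
have [X [tX X0 X1 XZ]] := normalize s0 gQ tZ.
have [Y [tY Y0 Y1 YW]] := normalize s0 gQ tW.
pose N : R := n%:R; pose z := Num.sqrt (4 * a / (N * s ^+ 2)).
have Ns : 0 < N * s ^+ 2 by rewrite mulr_gt0 ?exprn_gt0.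
have z0 : 0 <= z by exact: sqrtr_ge0.
have za : z ^+ 2 = 4 * a / (N * s ^+ 2).
  by rewrite sqr_sqrtr // divr_ge0 ?mulr_ge0 // ltW.
have rN : 0 < Num.sqrt N by rewrite sqrtr_gt0.
have NN : Num.sqrt N ^+ 2 = N by rewrite sqr_sqrtr // ltW.
have az : 4 * s ^+ 2 * a = (s ^+ 2 * Num.sqrt N * z) ^+ 2.
  rewrite !exprMn NN za; field; apply/andP; split; rewrite gt_eqF //.
have sN : 0 <= s ^+ 2 * Num.sqrt N by rewrite mulr_ge0 ?sqr_ge0 // ltW.
have hX : Num.sqrt (Ex (fun x => Z x ^+ 2)) <= s ^+ 2 * Num.sqrt N * z.
  by apply: sqrtr_le; [exact: mulr_ge0|rewrite -az].
have EW : Ex (fun x => (sure_df s F x - a) ^+ 2) = Ex (fun x => sure_df s F x ^+ 2) - a ^+ 2.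
  have e x : (sure_df s F x - a) ^+ 2 = sure_df s F x ^+ 2 + (- 2 * a) * sure_df s F x + a ^+ 2 by ring.
  under eq_Rintegral do rewrite e.
  rewrite (ExD s0 gQ); [|by apply: tameD; [exact: tameX2|exact: tameZ]|exact: tame_cst].
  rewrite (ExD s0 gQ); [|exact: tameX2|exact: tameZ].
  by rewrite (Ex_cst Q) (ExZ s0 gQ) // -/a; ring.
have s6 : Num.sqrt 6 ^+ 2 = 6 :> R by rewrite sqr_sqrtr.
have r6 : 0 <= Num.sqrt 6 :> R by exact: sqrtr_ge0.
(* The variance bound is (s^2 sqrt n)^2 (z^2 + 6), and z^2 + 6 <= (z + sqrt 6)^2. This is the origin
   of the 6 under the fourth root. *)
have hY : Num.sqrt (Ex (fun x => (sure_df s F x - a) ^+ 2)) <= Num.sqrt N * s ^+ 2 * (z + Num.sqrt 6).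
  have zs : 0 <= z + Num.sqrt 6 by rewrite addr_ge0.
  apply: sqrtr_le; first by apply: mulr_ge0 => //; rewrite mulrC.
  rewrite EW.
  apply: le_trans (sure_df_variance s0 gQ lF psdA) _; rewrite -/a az.
  have -> : (Num.sqrt N * s ^+ 2 * (z + Num.sqrt 6)) ^+ 2 =
    (s ^+ 2 * Num.sqrt N * z) ^+ 2 + Num.sqrt 6 ^+ 2 * s ^+ 4 * Num.sqrt N ^+ 2 +
    2 * (s ^+ 4 * Num.sqrt N ^+ 2 * (z * Num.sqrt 6)) by ring.
  by rewrite s6 NN lerDl; repeat (apply: mulr_ge0 => //); rewrite ?exprn_ge0 // ltW.
exists X, Y; split => //.
move: XZ YW; apply: filterS2 => x hx hy.
have hz := @quadratic_estimate R N s z (Y x) (sure_df s F x) a N0 s0 z0 (Y0 x) za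
  (le_trans hy (ler_wpM2l (Y0 x) hY)).
have sN0 : 0 < s ^+ 2 * Num.sqrt N by rewrite mulr_gt0 ?exprn_gt0.
rewrite ler_pdivrMr //; apply: le_trans hx _.
rewrite -[leRHS]mulrA ler_wpM2l //; apply: le_trans hX _.
by rewrite mulrC ler_wpM2r.
Qed.

End sure_bound.

(** * Markov's inequality and the union bound *)

Lemma markov_sqr d (T : measurableType d) (R : realType) (P : probability T R)
    (X : {RV P >-> R}) (b : R) : 0 < b -> ('E_P[(fun w => X w ^+ 2)%R] = 1)%E ->
  (P [set w | ((Num.sqrt b)^-1 <= `|X w|)%R] <= b%:E)%E.
Proof.
move=> b0 X1; have r0 : 0 < (Num.sqrt b)^-1 by rewrite invr_gt0 sqrtr_gt0.
have := @markov _ _ _ P X (fun r => r ^+ 2) _ r0.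
have -> : (fun r : R => r ^+ 2) \o (fun x => `|x|) \o X = (fun w => X w ^+ 2).
  by apply/funext => w /=; rewrite real_normK ?num_real.
rewrite X1 => h.
have {h} : (((Num.sqrt b)^-1 ^+ 2)%:E *
    P [set w | ((Num.sqrt b)^-1 <= `|X w|)%R] <= 1)%E.
  apply: h.
  - exact: measurable_funX.
  - by move=> r _; exact: sqr_ge0.
  - by move=> x y; rewrite !nnegrE => x0 y0 xy; rewrite ler_sqr.
rewrite exprVn (sqr_sqrtr (ltW b0)) => h.
have := lee_wpmul2l (ltW (_ : 0 < b%:E)%E) h; rewrite muleA -EFinM divff ?gt_eqF // mul1e mule1.
by apply; rewrite lte_fin.
Qed.

Section union_bound.
Context {R : realType} (n : nat) d (T : measurableType d) (P : probability T R).
Variables (sure t chi gam : T -> R) (s : R).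
Hypotheses (s0 : 0 < s) (n0 : (0 < n)%N).

(** Off a null set and the events [A1], [A2], [A3], of probabilities alpha, at most beta1 and at
    most beta2, the claimed inequality holds pointwise. *)
Lemma bound1_bound2 (X Y : {RV P >-> R}) (alpha beta1 beta2 delta v : R) :
  (forall w, 0 <= X w) -> (forall w, 0 <= Y w) ->
  ('E_P[(fun w => X w ^+ 2)%R] = 1)%E -> ('E_P[(fun w => Y w ^+ 2)%R] = 1)%E ->
  {ae P, forall w, `|sure w - t w + chi w| / (s ^+ 2 * Num.sqrt n%:R) <=
    X w * (Num.sqrt (gam w) + 4 * Y w / Num.sqrt n%:R
      + Num.sqrt (4 * Y w) * (6 / n%:R) `^ (4^-1))} ->
  measurable_fun setT (fun w => `|sure w - t w| / (s ^+ 2 * Num.sqrt (2 * n%:R))) ->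
  measurable_fun setT chi -> measurable_fun setT gam ->
  0 < beta1 -> 0 < beta2 -> alpha + beta1 + beta2 = delta ->
  P [set w | v < `|chi w| / (s ^+ 2 * Num.sqrt (2 * n%:R))] = alpha%:E ->
  ((1 - delta)%:E <=
   P [set w | `|sure w - t w| / (s ^+ 2 * Num.sqrt (2 * n%:R)) <=
      v + (Num.sqrt (gam w) + kappa n beta2) / Num.sqrt (2 * beta1)]%R)%E.
Proof.
move=> X0 Y0 X1 Y1 h msure mchi mgam b1 b2 ab hchi.
set G := [set w | _].
have msqrt (f : T -> R) : measurable_fun setT f -> measurable_fun setT (fun w => Num.sqrt (f w)).
  move=> mf; apply: measurableT_comp mf; apply: continuous_measurable_fun; exact: sqrt_continuous.
have mG : measurable G.
  rewrite -[G]setTI; apply: measurable_fun_le => //.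
  apply: measurable_funD => //; apply: measurable_funM => //; apply: measurable_funD => //.
  exact: msqrt.
pose A1 := [set w | v < `|chi w| / (s ^+ 2 * Num.sqrt (2 * n%:R))].
pose A2 := [set w | (Num.sqrt beta1)^-1 <= `|X w|].
pose A3 := [set w | (Num.sqrt beta2)^-1 <= `|Y w|].
have mA1 : measurable A1.
  have -> : A1 = ~` [set w | `|chi w| / (s ^+ 2 * Num.sqrt (2 * n%:R)) <= v].
    by rewrite /A1; apply/seteqP; split => w /=; rewrite ltNge => /negP.
  apply: measurableC; rewrite -[X in measurable X]setTI; apply: measurable_fun_le => //.
  by apply: measurable_funM => //; exact: measurableT_comp.
have mA2 : measurable A2 by rewrite -[A2]setTI; apply: measurable_fun_le => //; exact: measurableT_comp.
have mA3 : measurable A3 by rewrite -[A3]setTI; apply: measurable_fun_le => //; exact: measurableT_comp.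
case: h => N [mN N0 sub].
have sG : ~` G `<=` (N `|` A1) `|` (A2 `|` A3).
  move=> w nG; apply: contrapT => nw; apply: nG.
  have /not_orP[/not_orP[nN nA1] /not_orP[nA2 nA3]] := nw.
  have {sub} hw : `|sure w - t w + chi w| / (s ^+ 2 * Num.sqrt n%:R) <=
      X w * (Num.sqrt (gam w) + 4 * Y w / Num.sqrt n%:R + Num.sqrt (4 * Y w) * (6 / n%:R) `^ (4^-1)).
    by apply: contrapT => nb; apply: nN; exact: sub.
  move: nA1 nA2 nA3; rewrite /A1 /A2 /A3 /=.
  move=> /negP; rewrite -leNgt => h1 /negP; rewrite -ltNge ger0_norm // => h2.
  move=> /negP; rewrite -ltNge ger0_norm // => h3.
  rewrite /G /=.
  have N0' : 0 < n%:R :> R by rewrite ltr0n.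
  have q0 : 0 < Num.sqrt n%:R :> R by rewrite sqrtr_gt0.
  have r2 : 0 < Num.sqrt 2 :> R by rewrite sqrtr_gt0.
  have s2 : 0 < s ^+ 2 by rewrite exprn_gt0.
  have qb1 : 0 < Num.sqrt beta1 by rewrite sqrtr_gt0.
  have qb2 : 0 < Num.sqrt beta2 by rewrite sqrtr_gt0.
  have e2 : Num.sqrt (2 * n%:R) = Num.sqrt 2 * Num.sqrt n%:R :> R by rewrite sqrtrM.
  (* [kappa] is the left side at Y = 1 / sqrt beta2, the threshold that defines [A3]. *)
  have hk : 4 * Y w / Num.sqrt n%:R + Num.sqrt (4 * Y w) * (6 / n%:R) `^ (4^-1) <= kappa n beta2.
    rewrite /kappa addrC; apply: lerD.
      have -> : 6 / (beta2 * n%:R) = beta2^-1 * (6 / n%:R) by rewrite invfM mulrCA.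
      rewrite [(beta2^-1 * _) `^ _]powRM ?invr_ge0 ?divr_ge0 ?(ltW b2) ?(ltW N0') //.
      rewrite [leRHS]mulrA ler_wpM2r ?powR_ge0 //.
      apply: sqrtr_le; first by rewrite mulr_ge0 ?powR_ge0.
      rewrite exprMn powR4_sqr ?invr_ge0 ?(ltW b2) // sqrtrV ?(ltW b2) //.
      have -> : (2 : R) ^+ 2 = 4 by rewrite expr2; ring.
      by rewrite ler_wpM2l // ltW.
    rewrite sqrtrM ?(ltW b2) // invfM mulrA ler_wpM2r ?invr_ge0 ?(ltW q0) //.
    by rewrite ler_wpM2l // ltW.
  have hX : X w * (Num.sqrt (gam w) + 4 * Y w / Num.sqrt n%:R + Num.sqrt (4 * Y w) * (6 / n%:R) `^ (4^-1))
     <= (Num.sqrt beta1)^-1 * (Num.sqrt (gam w) + kappa n beta2).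
    rewrite -addrA; apply: ler_pM => //.
    - rewrite addr_ge0 ?sqrtr_ge0 // addr_ge0 ?mulr_ge0 ?invr_ge0 ?sqrtr_ge0 ?powR_ge0 //.
    - exact: ltW.
    - by rewrite lerD2l.
  have tri : `|sure w - t w| <= `|sure w - t w + chi w| + `|chi w|.
    by have := ler_normB (sure w - t w + chi w) (chi w); rewrite addrK.
  have d0 : 0 < s ^+ 2 * Num.sqrt (2 * n%:R) by rewrite e2 !mulr_gt0.
  rewrite ler_pdivrMr //; apply: le_trans tri _.
  move: h1; rewrite ler_pdivrMr // => h1.
  rewrite mulrDl [leRHS]addrC; apply: lerD => //.
  (* Passing from sqrt n to sqrt (2 n) in the normalization is matched by the factor sqrt 2 in sqrt
     (2 beta1). *)
  rewrite e2 sqrtrM //.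
  move: (le_trans hw hX); rewrite ler_pdivrMr ?mulr_gt0 // => /le_trans; apply.
  rewrite le_eqVlt; apply/orP; left; apply/eqP.
  move: (Num.sqrt (gam w) + _) => c; field.
  by rewrite !gt_eqF.
have PG : (P (~` G) <= delta%:E)%E.
  apply: le_trans (le_measure P _ _ sG) _; rewrite ?inE //; first exact: measurableC.
    by apply: measurableU; exact: measurableU.
  apply: le_trans (measureU2 _ _ _) _; try exact: measurableU.
  rewrite -ab -addrA EFinD; apply: leeD.
    apply: le_trans (measureU2 _ _ _) _ => //.
    by rewrite [X in (X + _)%E](N0 : P N = 0%E) add0e -hchi.
  apply: le_trans (measureU2 _ _ _) _ => //.
  by rewrite EFinD; apply: leeD; exact: markov_sqr.
have PC := probability_setC P (measurableC mG); rewrite setCK in PC.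
by rewrite PC EFinB; exact: leeB.
Qed.

End union_bound.

(** * Translation to the noise variable *)

Section translation.
Context {R : realType} {n : nat}.
Notation rV := 'rV[R]_n.
Variables (s : R) (mu : rV) (muhat : rV -> rV).
Hypothesis s0 : 0 < s.

Definition centered_estimator (x : rV) : rV := muhat (mu + x) - mu.

(** The difference quotients coincide, so the equality holds for the total ['D], also where the
    limit does not exist. *)
Lemma partial_centered i j x :
  partial i (fun u => muhat u 0 j) (mu + x) = partial i (fun x => centered_estimator x 0 j) x.
Proof.
rewrite /partial /derive.
have -> : (fun h : R => h^-1 *: (((fun u => muhat u 0 j) \o shift (mu + x)) (h *: delta_mx 0 i) - muhat (mu + x) 0 j)) =
  (fun h : R => h^-1 *: (((fun x => centered_estimator x 0 j) \o shift x)
    (h *: delta_mx 0 i) - centered_estimator x 0 j)).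
  apply/funext => h /=; congr (_ *: _).
  have e z : centered_estimator z 0 j = muhat (mu + z) 0 j - mu 0 j by rewrite !mxE.
  by rewrite !e [h *: _ + (mu + _)]addrCA opprB [RHS]addrA subrK.
by [].
Qed.

Lemma gradmx_centered x : gradmx muhat (mu + x) = gradmx centered_estimator x.
Proof. by apply/matrixP => i j; rewrite !mxE partial_centered. Qed.

Lemma divergence_centered x : divergence muhat (mu + x) = divergence centered_estimator x.
Proof. by apply: eq_bigr => i _; exact: partial_centered. Qed.

Lemma lipschitz1_centered : lipschitz1 muhat -> lipschitz1 centered_estimator.
Proof.
move=> l x y; rewrite /centered_estimator opprB addrA subrK.
by apply: le_trans (l _ _) _; rewrite opprD addrACA subrr add0r.
Qed.

Lemma SURE_centered x : SURE s muhat (mu + x) = centered_sure s centered_estimator x.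
Proof.
rewrite /SURE /centered_sure enorm_dot divergence_centered /centered_estimator.
by rewrite opprB addrA [x + mu]addrC.
Qed.

Lemma gammahat_centered x : (0 < n)%N -> gammahat s muhat (mu + x) =
  4 * Num.max (sure_df s centered_estimator x / (n%:R * s ^+ 2)) 0.
Proof.
move=> n0; rewrite /gammahat SURE_centered gradmx_centered /sure_df.
have -> : \tr (gradmx centered_estimator x) = divergence centered_estimator x.
  by rewrite /mxtrace /divergence; apply: eq_bigr => i _; rewrite mxE.
congr (_ * Num.max _ _); field.
by rewrite !gt_eqF // ltr0n.
Qed.

Lemma loss_centered x : enorm (mu - muhat (mu + x)) ^+ 2 =
  dot (centered_estimator x) (centered_estimator x).
Proof.
by rewrite enorm_dot -[mu - _]opprB dotNl dotNr opprK.
Qed.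

End translation.

Theorem theorem3p6 (R : realType) (n : nat) (d : measure_display)
    (Omega : measurableType d) (P : probability Omega R)
    (sigma : R) (mu : 'rV[R]_n) (eps : Omega -> 'rV[R]_n)
    (muhat : 'rV[R]_n -> 'rV[R]_n)
    (n_gt0 : (0 < n)%N) (sigma_gt0 : 0 < sigma)
    (eps_normal : centered_normal P sigma eps)
    (muhat_lip : lipschitz1 muhat)
    (muhat_psd : {ae P, forall w, sym_psd (gradmx muhat (mu + eps w))}) :
  let y := fun w : Omega => mu + eps w in
  let sure := fun w : Omega => SURE sigma muhat (y w) in
  let df := fun w : Omega => divergence muhat (y w) in
  let gam := fun w : Omega => gammahat sigma muhat (y w) in
  let loss := fun w : Omega => enorm (mu - muhat (y w)) ^+ 2 in
  let risk : R := fine ('E_P[loss])%E in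
  let chi := fun w : Omega => n%:R * sigma ^+ 2 - enorm (eps w) ^+ 2 in
  (* (1), for the target t, which is either the risk or the loss *)
  let bound1 := fun t : Omega -> R =>
    exists X Y : {RV P >-> R},
      [/\ forall w, 0 <= X w, forall w, 0 <= Y w,
          ('E_P[(fun w => X w ^+ 2)%R] = 1)%E,
          ('E_P[(fun w => Y w ^+ 2)%R] = 1)%E
        & {ae P, forall w,
            `|sure w - t w + chi w| / (sigma ^+ 2 * Num.sqrt n%:R) <=
            X w * (Num.sqrt (gam w) + 4 * Y w / Num.sqrt n%:R
                   + Num.sqrt (4 * Y w) * (6 / n%:R) `^ (4^-1))}] in
  (* (2), for the target t *)
  let bound2 := fun t : Omega -> R =>
    forall (alpha beta1 beta2 delta : R)
        (d' : measure_display) (Omega' : measurableType d')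
        (P' : probability Omega' R) (chi2 : Omega' -> R) (v : R),
      0 < alpha -> 0 < beta1 -> 0 < beta2 ->
      alpha + beta1 + beta2 = delta -> delta < 1 ->
      is_chi_square P' n chi2 ->
      P' [set w | (Num.sqrt (2 * n%:R))^-1 * `|chi2 w - n%:R| > v]
        = alpha%:E ->
      ((1 - delta)%:E <=
       P [set w | `|sure w - t w| / (sigma ^+ 2 * Num.sqrt (2 * n%:R)) <=
                  v + (Num.sqrt (gam w) + kappa n beta2)
                      / Num.sqrt (2 * beta1)]%R)%E in
  [/\ ('V_P[(fun w => sure w - risk + chi w)%R] <=
       4%:E * 'E_P[(fun w => sigma ^+ 2 * sure w
                                   + sigma ^+ 4 * df w)%R])%E,
      bound1 (fun=> risk),
      bound2 (fun=> risk),
      bound1 loss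
    & bound2 loss].
Proof.
move=> y sure df gam loss risk chi bound1 bound2.
pose F := centered_estimator mu muhat.
have lF : lipschitz1 F := lipschitz1_centered mu muhat_lip.
have meps : measurable_fun setT eps := centered_normal_measurable eps_normal.
(* All estimates live on the law of eps; [transfer] and [ae_transfer] carry expectations and null
   sets back to P. *)
pose Z : {mfun Omega >-> 'rV[R]_n} := mfun_Sub (mem_set meps : eps \in mfun).
pose Q : probability 'rV[R]_n R := distribution P Z.
have QP A : measurable A -> Q A = P (eps @^-1` A) by [].
have gQ : gaussian sigma Q := centered_normal_gaussian eps_normal.
have psdA : {ae Q, forall x, sym_psd (gradmx F x)}.
  apply: (sym_psd_transfer meps QP lF); move: muhat_psd; apply: filterS => w.
  by rewrite gradmx_centered.
have transfer G : tame G -> ('E_P[(fun w => G (eps w))])%E = (\int[Q]_x G x)%:E.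
  move=> tG; rewrite unlock -(EFin_Ex sigma_gt0 gQ tG).
  by have [_ ->] := integral_transfer meps QP (tame_integrable sigma_gt0 gQ tG).
have ae_transfer (B : 'rV[R]_n -> Prop) : {ae Q, forall x, B x} -> {ae P, forall w, B (eps w)}.
  move=> [N [mN N0 sub]]; exists (eps @^-1` N); split.
  - by rewrite -[X in measurable X]setTI; exact: (meps measurableT N mN).
  - by rewrite -QP.
  - by move=> w /= nB; apply: sub.
have sureE : sure = (fun w => centered_sure sigma F (eps w)).
  by apply/funext => w; exact: SURE_centered.
have dfE : df = (fun w => divergence F (eps w)).
  by apply/funext => w; exact: divergence_centered.
have gamE : gam = (fun w => 4 * Num.max (sure_df sigma F (eps w) / (n%:R * sigma ^+ 2)) 0).
  by apply/funext => w; exact: gammahat_centered.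
have lossE : loss = (fun w => dot (F (eps w)) (F (eps w))).
  by apply/funext => w; exact: loss_centered.
have chiE : chi = (fun w => n%:R * sigma ^+ 2 - dot (eps w) (eps w)).
  by apply/funext => w; rewrite /chi enorm_dot.
have tFF : tame (fun x => dot (F x) (F x)).
  by apply: explip_tame; apply: explip_dot => j; exact: explip_component.
have riskE : risk = \int[Q]_x dot (F x) (F x).
  by rewrite /risk lossE (transfer _ tFF).
have tS := tame_sure_df sigma lF; have tcS := tame_centered_sure sigma lF.
have tD := tame_divergence lF.
(* The variance bound rewritten as 4 sigma^2 E S, the form that [sure_bound] takes. *)
have ESdf : 4 * (\int[Q]_x (sigma ^+ 2 * centered_sure sigma F x + sigma ^+ 4 * divergence F x)) =
    4 * sigma ^+ 2 * \int[Q]_x (sure_df sigma F x).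
  rewrite -mulrA -(ExZ sigma_gt0 gQ) //; congr (_ * _); apply: eq_Rintegral => x _.
  by rewrite /sure_df; ring.
have tR := tame_sure_risk_gap sigma Q lF.
have tL := tame_sure_loss_gap sigma lF.
have rgap w : sure w - risk + chi w = sure_risk_gap sigma Q F (eps w).
  by rewrite sureE chiE riskE.
have lgap w : sure w - loss w + chi w = sure_loss_gap sigma F (eps w).
  by rewrite sureE chiE lossE.
have vR := sure_risk_gap_variance sigma_gt0 gQ lF psdA.
have vL := sure_loss_gap_variance sigma_gt0 gQ lF psdA.
have mk_bound1 (t : Omega -> R) G : tame G ->
    \int[Q]_x (G x ^+ 2) <= 4 * (\int[Q]_x (sigma ^+ 2 * centered_sure sigma F x + sigma ^+ 4 * divergence F x)) ->
    (forall w, sure w - t w + chi w = G (eps w)) -> bound1 t.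
  rewrite ESdf => tG vG tE.
  have [X [Y [[tX tY] [X0 Y0] X1 Y1 h]]] := sure_bound sigma_gt0 gQ n_gt0 lF psdA tG vG.
  have mX : measurable_fun setT (fun w => X (eps w)) by apply: measurableT_comp => //; case: tX.
  have mY : measurable_fun setT (fun w => Y (eps w)) by apply: measurableT_comp => //; case: tY.
  exists (mfun_Sub (mem_set mX : _ \in mfun)), (mfun_Sub (mem_set mY : _ \in mfun)); split => //=.
  - by rewrite (transfer (fun x => X x ^+ 2) (tameX2 tX)) X1.
  - by rewrite (transfer (fun x => Y x ^+ 2) (tameX2 tY)) Y1.
  - by move: (ae_transfer _ h); apply: filterS => w; rewrite tE gamE.
have b1R : bound1 (fun=> risk) by apply: (mk_bound1 _ _ tR vR) => w; exact: rgap.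
have b1L : bound1 loss by apply: (mk_bound1 _ _ tL vL) => w; exact: lgap.
have mk_bound2 (t : Omega -> R) : measurable_fun setT t -> bound1 t -> bound2 t.
  move=> mt [X [Y [X0 Y0 X1 Y1 h]]] alpha beta1 beta2 delta d' Omega' P' chi2 v
    al0 b1 b2 ab d1 [mchi2 [d'' [T'' [P'' [Z'' [nZ'' lZ'']]]]]] hv.
  have msure : measurable_fun setT sure.
    by rewrite sureE; apply: measurableT_comp => //; case: tcS.
  have mchi : measurable_fun setT chi.
    by apply: measurable_funB => //; exact: (measurableT_comp measurable_enorm_sqr meps).
  have mgam : measurable_fun setT gam.
    rewrite gamE; apply: measurable_funM => //; apply: measurable_maxr => //.
    by apply: measurable_funM => //; apply: measurableT_comp => //; case: tS.
  apply: (bound1_bound2 sigma_gt0 n_gt0 X0 Y0 X1 Y1 h) => //.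
    apply: measurable_funM => //; apply: measurableT_comp => //; exact: measurable_funB.
  exact: ab.
  rewrite -hv.
  (* As a set of values, the chi-square event can be carried from chi2 to |Z''|^2 and on to |eps|^2
     / sigma^2, all of the same law. *)
  pose B := [set c : R | v < (Num.sqrt (2 * n%:R))^-1 * `|c - n%:R|].
  have mB : measurable B.
    have -> : B = ~` [set c : R | (Num.sqrt (2 * n%:R))^-1 * `|c - n%:R| <= v].
      by rewrite /B; apply/seteqP; split => c /=; rewrite ltNge => /negP.
    apply: measurableC; rewrite -[X in measurable X]setTI; apply: measurable_fun_le => //.
    by apply: measurable_funM => //; apply: measurableT_comp => //; exact: measurable_funB.
  have mZ'' := centered_normal_measurable nZ''.
  pose Q1 : probability 'rV[R]_n R := distribution P'' (mfun_Sub (mem_set mZ'' : Z'' \in mfun)).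
  have gQ1 : gaussian 1 Q1 := centered_normal_gaussian nZ''.
  rewrite -[RHS]/(P' [set w | B (chi2 w)]) (lZ'' _ mB).
  rewrite -[RHS]/(Q1 [set x | B (enorm x ^+ 2)]) -(gaussian_enorm_law sigma_gt0 gQ gQ1 mB).
  rewrite -[RHS]/(P [set w | B (enorm (eps w) ^+ 2 / sigma ^+ 2)]).
  congr (P _); apply/seteqP.
  have e w : `|chi w| / (sigma ^+ 2 * Num.sqrt (2 * n%:R)) =
      (Num.sqrt (2 * n%:R))^-1 * `|enorm (eps w) ^+ 2 / sigma ^+ 2 - n%:R|.
    have s2 : 0 < sigma ^+ 2 by rewrite exprn_gt0.
    have -> : enorm (eps w) ^+ 2 / sigma ^+ 2 - n%:R = - chi w / sigma ^+ 2.
      by rewrite /chi; field; rewrite gt_eqF.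
    rewrite normrM normrN normfV (gtr0_norm s2) invfM mulrA [RHS]mulrC //.
  by split => w /=; rewrite e.
have mloss : measurable_fun setT loss.
  by rewrite lossE; case: tFF => mFF _; exact: (measurableT_comp mFF meps).
split => //; last 2 first.
- by apply: mk_bound2.
- by apply: mk_bound2.
have -> : (fun w => sure w - risk + chi w) = (fun w => sure_risk_gap sigma Q F (eps w)).
  by apply/funext => w; exact: rgap.
have -> : (fun w => sigma ^+ 2 * sure w + sigma ^+ 4 * df w) =
  (fun w => sigma ^+ 2 * centered_sure sigma F (eps w) + sigma ^+ 4 * divergence F (eps w)).
  by rewrite sureE dfE.
rewrite (transfer (fun x => sigma ^+ 2 * centered_sure sigma F x + sigma ^+ 4 * divergence F x)); last first.
  by apply: tameD; exact: tameZ.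
(* The gap has mean 0, so its variance is the second moment bounded in [vR]. *)
rewrite /variance covariance.unlock (transfer _ tR) (Ex_sure_risk_gap sigma_gt0 gQ lF) /=.
have -> : ((fun w => sure_risk_gap sigma Q F (eps w)) \- cst 0) *
    ((fun w => sure_risk_gap sigma Q F (eps w)) \- cst 0) =
   (fun w => sure_risk_gap sigma Q F (eps w) ^+ 2).
  by apply/funext => w /=; rewrite /GRing.mul /= subr0 expr2.
by rewrite (transfer (fun x => sure_risk_gap sigma Q F x ^+ 2) (tameX2 tR)) -EFinM lee_fin.
Qed.
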